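(* Let $M$ be a countable, $\omega$-categorical structure with $M=M^{eq}$, let $T=\mathrm{Th}(M)$, and let $G=\mathrm{Aut}(M)$ with the pointwise convergence topology. Then the homomorphism $\theta\colon \mathrm{Gal}_{KP}(T)=\mathrm{Aut}(M^* )/\mathrm{Autf}_{Sh}(M^* )\to G^{**}/{G^{**}}^{00}_{\mathrm{top}}$ is an isomorphism of topological groups, and the map $r_1\colon G\to\mathrm{Gal}_{KP}(T)$ is surjective and is the Bohr compactification of $G$.
   Context: Strong types and Galois groups: for a monster model $\mathfrak C$ of $T$, $E_L$, $E_{KP}$, $E_{Sh}$ denote, on any product of sorts, respectively the finest bounded $\emptyset$-invariant equivalence relation, the finest bounded $\emptyset$-type-definable equivalence relation, and the intersection of all $\emptyset$-definable equivalence relations with finitely many classes. $\mathrm{Autf}_L(\mathfrak C)\le\mathrm{Autf}_{KP}(\mathfrak C)\le\mathrm{Autf}_{Sh}(\mathfrak C)$ are the groups of automorphisms preserving all classes of the respective relations; $\mathrm{Gal}_L(T)$, $\mathrm{Gal}_{KP}(T)$ are the quotients of $\mathrm{Aut}(\mathfrak C)$ by the first two groups. Since $T$ is $\omega$-categorical, $\mathrm{Autf}_{KP}(\mathfrak C)=\mathrm{Autf}_{Sh}(\mathfrak C)$. Logic topology: with $\nu\colon\mathrm{Aut}(\mathfrak C)\to\mathrm{Gal}_L(T)$ the quotient map, $C\subseteq\mathrm{Gal}_L(T)$ is closed iff there are a (small) tuple $\bar a$ and a partial type $\pi(\bar x)$ over a small set with $\nu^{-1}[C]=\{\sigma:\sigma(\bar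 a)\models\pi\}$; $\mathrm{Gal}_{KP}(T)$ gets the quotient topology and is a compact Hausdorff group. The structures: let $\mathcal M$ be the structure consisting of $M$, the group $G$, the action of $G$ on $M$, and predicates for all open subsets of $G$. Let $\mathcal M^{**}=(M^{**},G^{**},\dots)\succ\mathcal M^*=(M^*,G^*,\dots)\succ\mathcal M=(M,G,\dots)$, where $\mathcal M^*$ is a monster model of $\mathrm{Th}(\mathcal M)$, $\mathcal M^{**}$ is a monster model with respect to $\mathcal M^*$ (in particular $|\mathcal M^*|^+$-saturated), and $M^{**}\succ M^*\succ M$ are monster models of $T$. Take $\mathfrak C=M^*$. ${G^{**}}^{00}_{\mathrm{top}}$ is the smallest bounded index subgroup of $G^{**}$ which is an intersection of interpretations in $\mathcal M^{**}$ of open subsets of $G$; it is normal, and $G^{**}/{G^{**}}^{00}_{\mathrm{top}}$ carries the logic topology (a subset is closed iff its preimage in $G^{**}$ is type-definable). The maps: $r_1(\sigma)=\sigma'/\mathrm{Autf}_{KP}(M^* )$ for any $\sigma'\in\mathrm{Aut}(M^* )$ extending $\sigma\in G$. Let $H$ be the group of all $\sigma\in G^{**}$ whose action on $M^{**}$ fixes $M^*$ setwise. Every $\sigma\in\mathrm{Aut}(M^* )$ equals $\sigma'|_{M^*}$ for some $\sigma'\in H$, and the coset $\sigma'/{G^{**}}^{00}_{\mathrm{top}}$ depends only on $\sigma/\mathrm{Autf}_{Sh}(M^* )$; $\theta$ is the (well-defined) group homomorphism $\theta(\sigma/\mathrm{Autf}_{Sh}(M^* ))=\sigma'/{G^{**}}^{00}_{\mathrm{top}}$.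 The Bohr compactification of a topological group is its universal continuous homomorphism with dense image into a compact Hausdorff group. *)

(* Defs.v *)
From HB Require Import structures.
From mathcomp Require Import all_boot all_classical topology.

Set Implicit Arguments.
Unset Strict Implicit.
Unset Printing Implicit Defensive.

Local Open Scope classical_set_scope.
Local Open Scope card_scope.
Local Open Scope quotient_scope.
Local Open Scope group_scope.

(* A tuple of variables is an arbitrary, possibly infinite, type V with a sort *)
(* assignment sv; tuples of elements are dependent functions (env).  Formulas  *)
(* bind one variable at a time, passing from V to option V, where None is the  *)
(* bound variable.                                                             *)

Record signature := Signature {
  lsort : Type;
  fsym : Type;
  fargs : fsym -> finType;
  fdom : forall f, fargs f -> lsort;
  fcod : fsym -> lsort;
  rsym : Type;
  rargs : rsym -> finType;
  rdom : forall r, rargs r -> lsort }.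

Record structure (L : signature) := Structure {
  carrier :> lsort L -> Type;
  fint : forall f : fsym L,
    (forall i : fargs f, carrier (fdom i)) -> carrier (fcod f);
  rint : forall r : rsym L, (forall i : rargs r, carrier (rdom i)) -> Prop;
  inhab : forall s, inhabited (carrier s) }.

Definition vext (L : signature) (V : Type) (sv : V -> lsort L) (s : lsort L)
  (o : option V) : lsort L := if o is Some v then sv v else s.

Definition vsum (L : signature) (V W : Type) (sv : V -> lsort L)
  (sw : W -> lsort L) (x : V + W) : lsort L :=
  match x with inl v => sv v | inr w => sw w end.

Inductive term (L : signature) (V : Type) (sv : V -> lsort L) :
    lsort L -> Type :=
  | Var (v : V) : term sv (sv v)
  | App (f : fsym L) (t : forall i : fargs f, term sv (fdom i)) :
      term sv (fcod f).

Inductive formula (L : signature) (V : Type) (sv : V -> lsort L) : Type :=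
  | Equ (s : lsort L) (t u : term sv s)
  | Rel (r : rsym L) (t : forall i : rargs r, term sv (rdom i))
  | Bot
  | Imp (p q : formula sv)
  | All (s : lsort L) (p : formula (vext sv s)).

Definition env (L : signature) (M : structure L) (V : Type)
  (sv : V -> lsort L) : Type := forall v, M (sv v).

Definition econs (L : signature) (M : structure L) (V : Type)
    (sv : V -> lsort L) (s : lsort L) (a : env M sv) (x : M s) :
    env M (vext sv s) :=
  fun o => match o return M (vext sv s o) with Some v => a v | None => x end.

Definition epair (L : signature) (M : structure L) (V W : Type)
    (sv : V -> lsort L) (sw : W -> lsort L) (a : env M sv) (b : env M sw) :
    env M (vsum sv sw) :=
  fun x => match x return M (vsum sv sw x) with inl v => a v | inr w => b w end.

Definition emap (L : signature) (M N : structure L)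
  (f : forall s, M s -> N s) (V : Type) (sv : V -> lsort L) (a : env M sv) :
  env N sv := fun v => f _ (a v).

Fixpoint eval (L : signature) (M : structure L) (V : Type) (sv : V -> lsort L)
    (a : env M sv) (s : lsort L) (t : term sv s) : M s :=
  match t in term _ s return M s with
  | Var v => a v
  | App f u => fint (fun i => eval a (u i))
  end.

Fixpoint sat (L : signature) (M : structure L) (V : Type) (sv : V -> lsort L)
    (p : formula sv) : env M sv -> Prop :=
  match p with
  | Equ _ t u => fun a => eval a t = eval a u
  | Rel r t => fun a => @rint L M r (fun i => eval a (t i))
  | Bot => fun _ => False
  | Imp q r => fun a => sat q a -> sat r a
  | All s q => fun a => forall x : M s, sat q (econs a x)
  end.

Definition no_var (L : signature) (v : void) : lsort L :=
  match v with end.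

Definition elementarily_equivalent (L : signature) (M N : structure L) :=
  forall (p : formula (@no_var L)) (a : env M (@no_var L))
    (b : env N (@no_var L)), sat p a <-> sat p b.

Definition elementary (L : signature) (M N : structure L)
    (f : forall s, M s -> N s) :=
  forall (V : Type) (sv : V -> lsort L) (p : formula sv) (a : env M sv),
    sat p a <-> sat p (emap f a).

Record elext (L : signature) (M : structure L) := Elext {
  ext_str :> structure L;
  ext_emb : forall s, M s -> ext_str s;
  ext_elem : elementary ext_emb }.

Lemma elementary_comp (L : signature) (M N P : structure L)
  (f : forall s, M s -> N s) (g : forall s, N s -> P s) :
  elementary f -> elementary g -> elementary (fun s x => g s (f s x)).
Proof. by move=> fE gE V sv p a; exact: iff_trans (fE _ _ p a) (gE _ _ p _). Qed.

Definition elext_trans (L : signature) (M : structure L) (N : elext M)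
    (P : elext N) : elext M :=
  Elext (elementary_comp (@ext_elem _ _ N) (@ext_elem _ _ P)).

(* No compatibility is required here: see topological_group. *)
#[short(type="preTopGroupType")]
HB.structure Definition PreTopGroup := {G of Group G & Topological G}.

Definition is_iso (L : signature) (M N : structure L)
    (f : forall s, M s -> N s) :=
  [/\ forall s, bijective (f s),
      forall (k : fsym L) (a : forall i : fargs k, M (fdom i)),
        f _ (fint a) = fint (fun i => f _ (a i)) &
      forall (r : rsym L) (a : forall i : rargs r, M (rdom i)),
        rint a <-> rint (fun i => f _ (a i))].

Record aut (L : signature) (M : structure L) := Aut {
  aut_fun :> forall s, M s -> M s;
  autP : is_iso aut_fun }.

Section AutGroup.
Variables (L : signature) (M : structure L).

Lemma aut_eq (s t : aut M) : (forall k x, s k x = t k x) -> s = t.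
Proof.
case: s t => [f fP] [g gP] /= fg.
have e : f = g by apply: functional_extensionality_dep => k; exact/funext/fg.
by case: _ / e gP => gP; congr Aut; exact: Prop_irrelevance.
Qed.

Lemma aut_one_subproof : is_iso (fun s (x : M s) => x).
Proof. by split=> // s; exists id. Qed.

Lemma aut_mul_subproof (s t : aut M) : is_iso (fun k x => s k (t k x)).
Proof.
case: s t => [f [fb ff fr]] [g [gb gf gr]]; split => [k|k a|r a] /=.
- exact: bij_comp (fb k) (gb k).
- by rewrite gf ff.
- exact: iff_trans (gr _ _) (fr _ _).
Qed.

Lemma aut_inv_fun_subproof (s : aut M) :
  {g : forall k, M k -> M k | forall k, cancel (s k) (g k) /\ cancel (g k) (s k)}.
Proof.
have [sb _ _] := autP s.
have H k : {g : M k -> M k | cancel (s k) g /\ cancel g (s k)}.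
  by apply: cid; case: (sb k) => g; exists g.
by exists (fun k => projT1 (H k)) => k; case: (H k).
Qed.

Definition aut_inv_fun (s : aut M) := sval (aut_inv_fun_subproof s).

Lemma aut_inv_subproof (s : aut M) : is_iso (aut_inv_fun s).
Proof.
have [sb sf sr] := autP s; rewrite /aut_inv_fun.
case: aut_inv_fun_subproof => g /= gK; split => [k|k a|r a].
- by exists (s k); have [] := gK k.
- apply: (can_inj (proj1 (gK _))); rewrite (proj2 (gK _)) sf; congr fint.
  by apply: functional_extensionality_dep => i; rewrite (proj2 (gK _)).
- rewrite (sr r (fun i => g _ (a i))).
  suff -> : (fun i => s _ (g _ (a i))) = a by [].
  by apply: functional_extensionality_dep => i; rewrite (proj2 (gK _)).
Qed.

Definition aut_one := Aut aut_one_subproof.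
Definition aut_mul s t := Aut (aut_mul_subproof s t).
Definition aut_inv s := Aut (aut_inv_subproof s).

HB.instance Definition _ := gen_eqMixin (aut M).
HB.instance Definition _ := gen_choiceMixin (aut M).

Lemma aut_mulA : associative aut_mul.
Proof. by move=> s t u; exact: aut_eq. Qed.
Lemma aut_mul1g : left_id aut_one aut_mul.
Proof. by move=> s; exact: aut_eq. Qed.
Lemma aut_mulg1 : right_id aut_one aut_mul.
Proof. by move=> s; exact: aut_eq. Qed.
Lemma aut_mulVg : left_inverse aut_one aut_inv aut_mul.
Proof.
move=> s; apply: aut_eq => k x /=; rewrite /aut_inv_fun.
by case: aut_inv_fun_subproof => g /= gK; rewrite (proj1 (gK _)).
Qed.
Lemma aut_mulgV : right_inverse aut_one aut_inv aut_mul.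
Proof.
move=> s; apply: aut_eq => k x /=; rewrite /aut_inv_fun.
by case: aut_inv_fun_subproof => g /= gK; rewrite (proj2 (gK _)).
Qed.

HB.instance Definition _ := isGroup.Build (aut M)
  aut_mulA aut_mul1g aut_mulg1 aut_mulVg aut_mulgV.

(* Pointwise convergence, M being discrete: the sets of automorphisms that     *)
(* agree with g on a given finite set of elements form a neighbourhood base    *)
(* at g.                                                                       *)
Definition agree_on (A : set {s & M s}) (g : aut M) : set (aut M) :=
  [set h | forall s (x : M s), A (existT _ s x) -> h s x = g s x].

Definition pointwise_open (U : set (aut M)) :=
  forall g, U g -> exists A, finite_set A /\ agree_on A g `<=` U.

Lemma pointwise_openT : pointwise_open setT.
Proof. by move=> g _; exists set0. Qed.

Lemma pointwise_openI : setI_closed pointwise_open.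
Proof.
move=> U V oU oV g [/oU[A [fA AU]] /oV[B [fB BV]]]; exists (A `|` B).
split=> [|h hAB]; first by rewrite finite_setU.
by split; [apply: AU|apply: BV] => s x ?; apply: hAB; [left|right].
Qed.

Lemma pointwise_open_bigU (I : Type) (f : I -> set (aut M)) :
  (forall i, pointwise_open (f i)) -> pointwise_open (\bigcup_i f i).
Proof.
move=> fo g [i _ /fo[A [fA Af]]]; exists A.
by split=> // h /Af fih; exists i.
Qed.

HB.instance Definition _ := isOpenTopological.Build (aut M)
  pointwise_openT pointwise_openI pointwise_open_bigU.

Lemma eval_aut (s : aut M) (V : Type) (sv : V -> lsort L) (a : env M sv) k
  (t : term sv k) : eval (emap s a) t = s k (eval a t).
Proof.
have [_ sf _] := autP s.
elim: t => //= f u IH; rewrite sf; congr fint.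
by apply: functional_extensionality_dep => i; exact: IH.
Qed.

Lemma sat_aut (s : aut M) (V : Type) (sv : V -> lsort L) (p : formula sv)
  (a : env M sv) : sat p a <-> sat p (emap s a).
Proof.
have [sb _ sr] := autP s.
elim: p a => {V sv} /=.
- move=> V sv k t u a; rewrite !eval_aut; split => [->//|].
  by apply: bij_inj; exact: sb.
- move=> V sv r t a; rewrite (sr r).
  suff -> : (fun i => s _ (eval a (t i))) = (fun i => eval (emap s a) (t i)).
    by [].
  by apply: functional_extensionality_dep => i; rewrite eval_aut.
- by [].
- by move=> V sv p IHp q IHq a; rewrite (propext (IHp a)) (propext (IHq a)).
- move=> V sv k p IH a.
  have E x : emap s (econs a x) = econs (emap s a) (s k x).
    by apply: functional_extensionality_dep => -[].
  split => H x; last by apply: (IH _).2; rewrite E; exact: H.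
  by have [g _ gK] := sb k; rewrite -(gK x) -E; apply: (IH _).1; exact: H.
Qed.

End AutGroup.

Definition subgroup (G : groupType) (H : set G) :=
  [/\ H 1, forall x y, H x -> H y -> H (x * y) & forall x, H x -> H x^-1].

Definition left_cosets (G : groupType) (H : set G) : set (set G) :=
  [set [set x * h | h in H] | x in [set: G]].

Record nsubgroup (G : groupType) := NSubgroup {
  nsub :> set G;
  nsub_subgroup : subgroup nsub;
  nsub_normal : forall x y, nsub x -> nsub (y * x * y^-1) }.

Section Quotient.
Variables (G : groupType) (N : nsubgroup G).

Definition coset_rel : rel G := fun x y => `[< nsub N (x^-1 * y) >].

Lemma coset_rel_refl : reflexive coset_rel.
Proof.
by move=> x; apply/asboolP; rewrite mulVg; have [] := nsub_subgroup N.
Qed.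

Lemma coset_rel_sym : symmetric coset_rel.
Proof.
have [_ _ NV] := nsub_subgroup N.
by move=> x y; apply/asboolP/asboolP => /NV; rewrite invgM invgK.
Qed.

Lemma coset_rel_trans : transitive coset_rel.
Proof.
have [_ NM _] := nsub_subgroup N.
move=> y x z /asboolP xy /asboolP yz; apply/asboolP.
by have := NM _ _ xy yz; rewrite mulgA mulgK.
Qed.

Canonical coset_equiv :=
  EquivRel coset_rel coset_rel_refl coset_rel_sym coset_rel_trans.

Definition quotient : Type := {eq_quot coset_rel}.

HB.instance Definition _ := Choice.on quotient.
HB.instance Definition _ := EqQuotient.on quotient.

Definition coset (x : G) : quotient := \pi_quotient x.

Lemma coset_eq (x y : G) : coset x = coset y <-> nsub N (x^-1 * y).
Proof.
split=> [/eqP|xy]; first by rewrite piE => /asboolP.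
by apply/eqP; rewrite piE; exact/asboolP.
Qed.

Definition quotient_one : quotient := coset 1.
Definition quotient_mul (a b : quotient) : quotient := coset (repr a * repr b).
Definition quotient_inv (a : quotient) : quotient := coset (repr a)^-1.

Lemma coset_repr (a : quotient) : coset (repr a) = a.
Proof. exact: reprK. Qed.

Lemma quotient_mulE x y : quotient_mul (coset x) (coset y) = coset (x * y).
Proof.
have [_ NM _] := nsub_subgroup N.
have /coset_eq hx := coset_repr (coset x).
have /coset_eq hy := coset_repr (coset y).
apply/coset_eq; move: (repr _) (repr _) hx hy => x' y' hx hy.
have := NM _ _ hy (nsub_normal y^-1 hx).
by rewrite invgM invgK !mulgA mulgK.
Qed.

Lemma quotient_invE x : quotient_inv (coset x) = coset x^-1.
Proof.
have [_ _ NV] := nsub_subgroup N.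
have /coset_eq hx := coset_repr (coset x).
apply/coset_eq; move: (repr _) hx => x' hx.
by have := nsub_normal x (NV _ hx); rewrite invgM invgK !mulgA mulgV mul1g.
Qed.

Lemma quotient_mulA : associative quotient_mul.
Proof.
move=> a b c; rewrite -(coset_repr a) -(coset_repr b) -(coset_repr c).
by rewrite !quotient_mulE mulgA.
Qed.
Lemma quotient_mul1g : left_id quotient_one quotient_mul.
Proof. by move=> a; rewrite -(coset_repr a) quotient_mulE mul1g. Qed.
Lemma quotient_mulg1 : right_id quotient_one quotient_mul.
Proof. by move=> a; rewrite -(coset_repr a) quotient_mulE mulg1. Qed.
Lemma quotient_mulVg : left_inverse quotient_one quotient_inv quotient_mul.
Proof.
by move=> a; rewrite -(coset_repr a) quotient_invE quotient_mulE mulVg.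
Qed.
Lemma quotient_mulgV : right_inverse quotient_one quotient_inv quotient_mul.
Proof.
by move=> a; rewrite -(coset_repr a) quotient_invE quotient_mulE mulgV.
Qed.

HB.instance Definition _ := isGroup.Build quotient
  quotient_mulA quotient_mul1g quotient_mulg1 quotient_mulVg quotient_mulgV.

End Quotient.

Definition topological_group (G : preTopGroupType) :=
  continuous (fun z : G * G => z.1 * z.2) /\ continuous (fun x : G => x^-1).

Definition topgroup_iso (G H : preTopGroupType) (f : G -> H) :=
  [/\ {morph f : x y / x * y}, continuous f &
      exists g : H -> G, [/\ cancel f g, cancel g f & continuous g]].

Definition compactification (G B : preTopGroupType) (r : G -> B) :=
  [/\ topological_group B, compact [set: B] & hausdorff_space B] /\
  [/\ {morph r : x y / x * y}, continuous r & dense (range r)].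

Definition bohr_compactification (G B : preTopGroupType) (r : G -> B) :=
  compactification r /\
  forall (C : preTopGroupType) (f : G -> C), compactification f ->
    exists! h : B -> C,
      [/\ {morph h : x y / x * y}, continuous h & h \o r = f].

(* Cardinals are represented by types: K stands for the cardinal kappa such    *)
(* that a monster model is kappa-saturated and strongly kappa-homogeneous.     *)
(* Both small and bounded mean less than kappa.                                *)

Definition card_lt (T U : Type) (A : set T) (B : set U) :=
  (A #<= B) /\ ~ (B #<= A).

Definition small (K T : Type) := card_lt [set: T] [set: K].

Definition uncountable_strong_limit (K : Type) :=
  small K nat /\ forall T : Type, small K T -> small K (set T).

Section ModelTheory.
Variables (L : signature) (M : structure L).

Definition realizes (V : Type) (sv : V -> lsort L) (a : env M sv)
  (p : set (formula sv)) := forall q, p q -> sat q a.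

Definition type_definable (K : Type) (V : Type) (sv : V -> lsort L)
    (D : set (env M sv)) :=
  exists (W : Type) (sw : W -> lsort L) (b : env M sw)
      (p : set (formula (vsum sv sw))),
    small K W /\ forall a, D a <-> realizes (epair a b) p.

Definition saturated (K : Type) :=
  forall (V : Type) (sv : V -> lsort L) (b : env M sv) (s : lsort L)
      (p : set (formula (vext sv s))),
    small K V ->
    (forall q : set (formula (vext sv s)), finite_set q -> q `<=` p ->
      exists x : M s, realizes (econs b x) q) ->
    exists x : M s, realizes (econs b x) p.

Definition strongly_homogeneous (K : Type) :=
  forall (V : Type) (sv : V -> lsort L) (a b : env M sv),
    small K V -> (forall p : formula sv, sat p a <-> sat p b) ->
    exists s : aut M, emap s a = b.

Definition monster (K : Type) :=
  [/\ uncountable_strong_limit K,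
      [/\ small K (lsort L), small K (fsym L) & small K (rsym L)],
      saturated K & strongly_homogeneous K].

Definition countable_structure :=
  [/\ countable [set: lsort L], countable [set: fsym L],
      countable [set: rsym L] & countable [set: {s & M s}]].

Definition omega_categorical :=
  forall N : structure L, countable [set: {s & N s}] ->
    elementarily_equivalent M N ->
    exists f : forall s, M s -> N s, is_iso f.

Definition equivalence (X : Type) (E : X -> X -> Prop) :=
  [/\ forall x, E x x, forall x y, E x y -> E y x &
      forall x y z, E x y -> E y z -> E x z].

Definition classes (X : Type) (E : X -> X -> Prop) : set (set X) :=
  [set [set y | E x y] | x in [set: X]].

(* M = M^eq: every 0-definable equivalence relation on a finite product of     *)
(* sorts has a sort of classes, with a 0-definable projection onto it.         *)
Definition is_own_eq :=
  forall (I : finType) (sv : I -> lsort L) (e : formula (vsum sv sv)),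
    equivalence (fun a b : env M sv => sat e (epair a b)) ->
    exists (s : lsort L) (proj : env M sv -> M s) (g : formula (vext sv s)),
      [/\ forall x, exists a, proj a = x,
          forall a b, proj a = proj b <-> sat e (epair a b) &
          forall a x, sat g (econs a x) <-> proj a = x].

(* The finest relations are defined as intersections of all relations of the   *)
(* given kind: these intersections are again of that kind.                     *)

Definition invariant_rel (V : Type) (sv : V -> lsort L)
    (E : env M sv -> env M sv -> Prop) :=
  forall (s : aut M) a b, E a b -> E (emap s a) (emap s b).

Definition type_definable0_rel (V : Type) (sv : V -> lsort L)
    (E : env M sv -> env M sv -> Prop) :=
  exists p : set (formula (vsum sv sv)),
    forall a b, E a b <-> realizes (epair a b) p.

Definition definable0_rel (V : Type) (sv : V -> lsort L)
    (E : env M sv -> env M sv -> Prop) :=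
  exists p : formula (vsum sv sv), forall a b, E a b <-> sat p (epair a b).

Definition bounded_rel (K X : Type) (E : X -> X -> Prop) :=
  card_lt (classes E) [set: K].

Definition E_L (K V : Type) (sv : V -> lsort L) (a b : env M sv) :=
  forall E : env M sv -> env M sv -> Prop,
    equivalence E -> invariant_rel E -> bounded_rel K E -> E a b.

Definition E_KP (K V : Type) (sv : V -> lsort L) (a b : env M sv) :=
  forall E : env M sv -> env M sv -> Prop,
    equivalence E -> type_definable0_rel E -> bounded_rel K E -> E a b.

Definition E_Sh (V : Type) (sv : V -> lsort L) (a b : env M sv) :=
  forall E : env M sv -> env M sv -> Prop,
    equivalence E -> definable0_rel E -> finite_set (classes E) -> E a b.

Definition Autf (K : Type)
    (R : forall (V : Type) (sv : V -> lsort L), env M sv -> env M sv -> Prop) :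
    set (aut M) :=
  [set s | forall (V : Type) (sv : V -> lsort L) (a : env M sv),
     small K V -> R V sv a (emap s a)].

Definition Autf_L (K : Type) := Autf K (E_L K).
Definition Autf_KP (K : Type) := Autf K (E_KP K).
Definition Autf_Sh (K : Type) := Autf K E_Sh.

Lemma emap_mul (s t : aut M) (V : Type) (sv : V -> lsort L) (a : env M sv) :
  emap (s * t : aut M)%g a = emap s (emap t a).
Proof. by []. Qed.

Lemma emap_one (V : Type) (sv : V -> lsort L) (a : env M sv) :
  emap (1%g : aut M) a = a.
Proof. by []. Qed.

Lemma type_definable0_invariant (V : Type) (sv : V -> lsort L)
  (E : env M sv -> env M sv -> Prop) :
  type_definable0_rel E -> invariant_rel E.
Proof.
move=> [p Ep] s a b /Ep ab; apply/Ep => q /ab /(sat_aut s).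
suff -> : emap s (epair a b) = epair (emap s a) (emap s b) by [].
by apply: functional_extensionality_dep => -[].
Qed.

Section AutfNormal.
Variables (K : Type)
  (R : forall (V : Type) (sv : V -> lsort L), env M sv -> env M sv -> Prop).
Hypothesis Req : forall (V : Type) (sv : V -> lsort L),
  equivalence (@R V sv).
Hypothesis Rinv : forall (V : Type) (sv : V -> lsort L),
  invariant_rel (@R V sv).

Lemma Autf_subgroup : subgroup (Autf K R).
Proof.
split=> [V sv a _|s t sR tR V sv a KV|s sR V sv a KV].
- by rewrite emap_one; have [] := @Req V sv.
- rewrite emap_mul; have [_ _ Rt] := @Req V sv.
  by apply: (Rt _ (emap t a)); [exact: tR | exact: sR].
- have [_ Rs _] := @Req V sv; apply: Rs.
  have := sR V sv (emap (s^-1%g : aut M) a) KV.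
  by rewrite -emap_mul mulgV emap_one.
Qed.

Lemma Autf_normal (s t : aut M) : Autf K R s -> Autf K R (t * s * t^-1).
Proof.
move=> sR V sv a KV; rewrite !emap_mul.
have := Rinv t (sR V sv (emap (t^-1%g : aut M) a) KV).
by rewrite -(emap_mul t (t^-1)%g) mulgV emap_one.
Qed.

Definition Autf_nsubgroup := NSubgroup Autf_subgroup Autf_normal.
End AutfNormal.

Lemma E_L_equivalence (K V : Type) (sv : V -> lsort L) :
  equivalence (@E_L K V sv).
Proof.
split=> [a E [] //|a b ab E Eq Ei Eb|a b c ab bc E Eq Ei Eb].
  by have [_ + _] := Eq; apply; exact: ab.
by have [_ _ +] := Eq; apply; [exact: ab | exact: bc].
Qed.

Lemma E_L_invariant (K V : Type) (sv : V -> lsort L) :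
  invariant_rel (@E_L K V sv).
Proof. by move=> s a b ab E Eq Ei Eb; apply: (Ei); exact: ab. Qed.

Lemma E_KP_equivalence (K V : Type) (sv : V -> lsort L) :
  equivalence (@E_KP K V sv).
Proof.
split=> [a E [] //|a b ab E Eq Ei Eb|a b c ab bc E Eq Ei Eb].
  by have [_ + _] := Eq; apply; exact: ab.
by have [_ _ +] := Eq; apply; [exact: ab | exact: bc].
Qed.

Lemma E_KP_invariant (K V : Type) (sv : V -> lsort L) :
  invariant_rel (@E_KP K V sv).
Proof.
move=> s a b ab E Eq Ei Eb.
by apply: (type_definable0_invariant Ei); exact: ab.
Qed.

End ModelTheory.

(* The logic topologies of Gal_L and of G/G^00 (below) are introduced as the   *)
(* topologies generated by the complements of the sets that are to be closed.  *)
(* In monster models those sets already are the closed sets of a topology.     *)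

Section Galois.
Variables (K : Type) (L : signature) (M : structure L).

Definition Gal_L : Type :=
  quotient (Autf_nsubgroup K
    (@E_L_equivalence L M K) (@E_L_invariant L M K)).
HB.instance Definition _ := Group.on Gal_L.

Definition to_Gal_L (s : aut M) : Gal_L := coset _ s.

Definition Gal_L_closed (C : set Gal_L) :=
  exists (V : Type) (sv : V -> lsort L) (a : env M sv) (D : set (env M sv)),
    [/\ small K V, type_definable K D &
        forall s : aut M, C (to_Gal_L s) <-> D (emap s a)].

HB.instance Definition _ := isSubBaseTopological.Build Gal_L
  (I := set Gal_L) Gal_L_closed (@setC Gal_L).

Definition Gal_KP : Type :=
  quotient (Autf_nsubgroup K
    (@E_KP_equivalence L M K) (@E_KP_invariant L M K)).
HB.instance Definition _ := Group.on Gal_KP.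

Definition to_Gal_KP (s : aut M) : Gal_KP := coset _ s.

Definition Gal_L_to_KP (x : Gal_L) : Gal_KP := to_Gal_KP (repr x).

Definition Gal_KP_open (U : set Gal_KP) := open (Gal_L_to_KP @^-1` U).

Lemma Gal_KP_openT : Gal_KP_open setT.
Proof. by rewrite /Gal_KP_open preimage_setT; exact: openT. Qed.
Lemma Gal_KP_openI : setI_closed Gal_KP_open.
Proof. by move=> A B oA oB; rewrite /Gal_KP_open preimage_setI; exact: openI. Qed.
Lemma Gal_KP_open_bigU (I : Type) (f : I -> set Gal_KP) :
  (forall i, Gal_KP_open (f i)) -> Gal_KP_open (\bigcup_i f i).
Proof.
by move=> fo; rewrite /Gal_KP_open preimage_bigcup; apply: bigcup_open => i _; exact: fo.
Qed.

HB.instance Definition _ := isOpenTopological.Build Gal_KP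
  Gal_KP_openT Gal_KP_openI Gal_KP_open_bigU.

End Galois.

(* The structure (M, G, action, open subsets of G), G = Aut(M): the sorts are  *)
(* those of M, as Some s, and the sort None of G.                              *)

Section WithGroup.
Variables (L : signature) (M : structure L).

Variant gfsym := Base of fsym L | Act of lsort L | Mul | One | Inv.

Definition gfargs (f : gfsym) : finType :=
  match f with
  | Base f => fargs f | Act _ => bool | Mul => bool | One => void | Inv => unit
  end.

Definition gfdom (f : gfsym) : gfargs f -> option (lsort L) :=
  match f return gfargs f -> option (lsort L) with
  | Base f => fun i => Some (fdom i)
  | Act s => fun b => if b then None else Some s
  | _ => fun _ => None
  end.

Definition gfcod (f : gfsym) : option (lsort L) :=
  match f with
  | Base f => Some (fcod f) | Act s => Some s | _ => None
  end.

Definition open_subset := {U : set (aut M) | open U}.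

Definition grargs (r : rsym L + open_subset) : finType :=
  match r with inl r => rargs r | inr _ => unit end.

Definition grdom (r : rsym L + open_subset) : grargs r -> option (lsort L) :=
  match r return grargs r -> option (lsort L) with
  | inl r => fun i => Some (rdom i)
  | inr _ => fun _ => None
  end.

Definition gsig : signature := Signature gfdom gfcod grdom.

Definition gcarrier (s : option (lsort L)) : Type :=
  if s is Some s then M s else aut M.

Definition gfint (f : gfsym) :
    (forall i : gfargs f, gcarrier (gfdom i)) -> gcarrier (gfcod f) :=
  match f return (forall i : gfargs f, gcarrier (gfdom i)) -> gcarrier (gfcod f)
  with
  | Base f => fun a => @fint L M f a
  | Act s => fun a => (a true : aut M) s (a false)
  | Mul => fun a => (a true : aut M) * (a false : aut M)
  | One => fun _ => 1 : aut M
  | Inv => fun a => (a tt : aut M)^-1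
  end.

Definition grint (r : rsym L + open_subset) :
    (forall i : grargs r, gcarrier (grdom i)) -> Prop :=
  match r return (forall i : grargs r, gcarrier (grdom i)) -> Prop with
  | inl r => fun a => @rint L M r a
  | inr U => fun a => sval U (a tt)
  end.

Lemma ginhab s : inhabited (gcarrier s).
Proof. by case: s => [s|]; [exact: inhab | exact: (inhabits (1 : aut M))]. Qed.

Definition with_group : structure gsig :=
  @Structure gsig gcarrier gfint grint ginhab.

Definition reduct (X : structure gsig) : structure L :=
  @Structure L (fun s => X (Some s))
    (fun f => @fint gsig X (Base f)) (fun r => @rint gsig X (inl r))
    (fun s => inhab X (Some s)).

Definition gmul (X : structure gsig) (g h : X None) : X None :=
  @fint gsig X Mul (fun b : bool => if b then g else h).
Definition gone (X : structure gsig) : X None :=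
  @fint gsig X One (fun v : void => match v with end).
Definition ginv (X : structure gsig) (g : X None) : X None :=
  @fint gsig X Inv (fun _ => g).
Definition gact (X : structure gsig) (g : X None) (s : lsort L)
    (x : X (Some s)) : X (Some s) :=
  @fint gsig X (Act s)
    (fun b : bool => match b return X (if b then None else Some s)
                     with true => g | false => x end).

Definition interp (X : structure gsig) (U : open_subset) : set (X None) :=
  [set g : X None | @rint gsig X (inr U) (fun _ => g)].

End WithGroup.

Section GroupSort.
Variables (L : signature) (M : structure L) (X : elext (with_group M)).

Definition gsort : Type := X None.
HB.instance Definition _ := gen_eqMixin gsort.
HB.instance Definition _ := gen_choiceMixin gsort.

Local Notation V3 := (option (option (option void))).
Local Notation ctx :=
  (vext (vext (vext (@no_var (gsig M)) None) None) None).
Local Notation v0 := (Some (Some None) : V3).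
Local Notation v1 := (Some None : V3).
Local Notation v2 := (None : V3).
Let tv (v : V3) : term ctx (ctx v) := Var ctx v.
Let tx : term ctx (None : lsort (gsig M)) := tv v0.
Let ty : term ctx (None : lsort (gsig M)) := tv v1.
Let tz : term ctx (None : lsort (gsig M)) := tv v2.
Let tmul (t u : term ctx (None : lsort (gsig M))) :
    term ctx (None : lsort (gsig M)) :=
  @App (gsig M) _ ctx (Mul L) (fun b : bool => if b then t else u).
Let tone : term ctx (None : lsort (gsig M)) :=
  @App (gsig M) _ ctx (One L) (fun v : void => match v with end).
Let tinv (t : term ctx (None : lsort (gsig M))) :
    term ctx (None : lsort (gsig M)) :=
  @App (gsig M) _ ctx (Inv L) (fun _ => t).

Let env0 (Y : structure (gsig M)) : env Y (@no_var (gsig M)) :=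
  fun v => match v with end.
Let env3 (Y : structure (gsig M)) (x y z : Y None) : env Y ctx :=
  econs (econs (econs (env0 Y) x) y) z.

Let eval_mul (Y : structure (gsig M)) (a : env Y ctx) t u :
  eval a (tmul t u) = gmul (eval a t) (eval a u).
Proof.
rewrite /gmul /=; congr (@fint (gsig M) Y (Mul L)).
by apply: functional_extensionality_dep => -[].
Qed.

Let eval_one (Y : structure (gsig M)) (a : env Y ctx) :
  eval a tone = gone Y.
Proof.
rewrite /gone /=; congr (@fint (gsig M) Y (One L)).
by apply: functional_extensionality_dep => -[].
Qed.

Let eval_inv (Y : structure (gsig M)) (a : env Y ctx) t :
  eval a (tinv t) = ginv (eval a t).
Proof. by []. Qed.

Let transfer (t u : term ctx (None : lsort (gsig M))) :
  (forall x y z, eval (@env3 (with_group M) x y z) t =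
                 eval (@env3 (with_group M) x y z) u) ->
  forall x y z, eval (@env3 X x y z) t = eval (@env3 X x y z) u.
Proof.
move=> H.
have := @ext_elem _ _ X _ _ (All (All (All (Equ t u)))) (env0 _).
set e := emap _ _; have -> : e = env0 X.
  by apply: functional_extensionality_dep => -[].
by move=> /= [+ _] x y z; apply => {}x {}y {}z; exact: H.
Qed.

Let gmulE (g h : aut M) : @gmul L M (with_group M) g h = g * h.
Proof. by []. Qed.

Lemma gsort_mulA : associative (@gmul L M X : gsort -> gsort -> gsort).
Proof.
move=> x y z.
have := @transfer (tmul tx (tmul ty tz)) (tmul (tmul tx ty) tz).
rewrite -[gmul x _]/(gmul (eval (env3 x y z) tx) _).
move=> /(_ _ x y z); rewrite !eval_mul; apply=> {}x {}y {}z.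
by rewrite !eval_mul !gmulE mulgA.
Qed.

Lemma gsort_mul1g : left_id (gone X : gsort) (@gmul L M X).
Proof.
move=> x; have := @transfer (tmul tone tx) tx.
move=> /(_ _ x x x); rewrite eval_mul eval_one; apply=> {}x y z.
by rewrite eval_mul eval_one gmulE; exact: mul1g.
Qed.

Lemma gsort_mulg1 : right_id (gone X : gsort) (@gmul L M X).
Proof.
move=> x; have := @transfer (tmul tx tone) tx.
move=> /(_ _ x x x); rewrite eval_mul eval_one; apply=> {}x y z.
by rewrite eval_mul eval_one gmulE; exact: mulg1.
Qed.

Lemma gsort_mulVg : left_inverse (gone X : gsort) (@ginv L M X) (@gmul L M X).
Proof.
move=> x; have := @transfer (tmul (tinv tx) tx) tone.
move=> /(_ _ x x x); rewrite eval_mul eval_inv eval_one; apply=> {}x y z.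
by rewrite eval_mul eval_inv eval_one gmulE; exact: mulVg.
Qed.

Lemma gsort_mulgV : right_inverse (gone X : gsort) (@ginv L M X) (@gmul L M X).
Proof.
move=> x; have := @transfer (tmul tx (tinv tx)) tone.
move=> /(_ _ x x x); rewrite eval_mul eval_inv eval_one; apply=> {}x y z.
by rewrite eval_mul eval_inv eval_one gmulE; exact: mulgV.
Qed.

HB.instance Definition _ := isGroup.Build gsort
  gsort_mulA gsort_mul1g gsort_mulg1 gsort_mulVg gsort_mulgV.

Definition bounded_open_type_subgroup (K : Type) (H : set gsort) :=
  [/\ subgroup H,
      card_lt (left_cosets H) [set: K] &
      exists F : set (open_subset M), H = \bigcap_(U in F) @interp L M X U].

Definition is_G00_top (K : Type) (H : set gsort) :=
  bounded_open_type_subgroup K H /\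
  forall H', bounded_open_type_subgroup K H' -> H `<=` H'.

Definition logic_quotient (K : Type) (N : nsubgroup gsort) : Type :=
  quotient N.

Definition to_logic_quotient (K : Type) (N : nsubgroup gsort) (g : gsort) :
  logic_quotient K N := coset N g.

Section LogicTopology.
Variables (K : Type) (N : nsubgroup gsort).
Local Notation Q := (logic_quotient K N).
HB.instance Definition _ := Group.on Q.

Definition logic_quotient_closed (C : set Q) :=
  type_definable K
    [set a : env X (fun _ : unit => None : lsort (gsig M)) |
       C (to_logic_quotient K N (a tt))].

HB.instance Definition _ := isSubBaseTopological.Build Q
  (I := set Q) logic_quotient_closed (@setC Q).
End LogicTopology.

End GroupSort.

(* Elementary extensions are given by embeddings, so that an element x of M*   *)
(* appears in M** as ext_emb Mss x.                                            *)

Section Maps.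
Variables (L : signature) (M : structure L) (Ms : elext (with_group M)).

Definition extends_aut (s' : aut (reduct Ms)) (s : aut M) :=
  forall k (x : M k), s' k (@ext_emb _ _ Ms (Some k) x) =
    @ext_emb _ _ Ms (Some k) (s k x).

Definition is_r1 (K : Type) (r1 : aut M -> Gal_KP K (reduct Ms)) :=
  forall s : aut M,
    (exists s', extends_aut s' s) /\
    forall s', extends_aut s' s -> r1 s = to_Gal_KP K s'.

Variable Mss : elext Ms.
Local Notation Gss := (gsort (elext_trans Mss)).

Definition fixes_Ms_setwise : set Gss :=
  [set g | forall k,
     [set @gact L M Mss g k (@ext_emb _ _ Mss (Some k) x)
       | x in [set: Ms (Some k)]] =
     range (@ext_emb _ _ Mss (Some k))].

Definition restricts_to (g : Gss) (s : aut (reduct Ms)) :=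
  forall k (x : Ms (Some k)),
    @gact L M Mss g k (@ext_emb _ _ Mss (Some k) x) =
    @ext_emb _ _ Mss (Some k) (s k x).

Definition is_theta (K K' : Type) (N : nsubgroup Gss)
    (theta : Gal_KP K (reduct Ms) -> logic_quotient K' N) :=
  forall s : aut (reduct Ms),
    (exists g, fixes_Ms_setwise g /\ restricts_to g s) /\
    forall g, fixes_Ms_setwise g -> restricts_to g s ->
      theta (to_Gal_KP K s) = to_logic_quotient K' N g.

End Maps.

(* Main.v *)
(* Let m be the enumeration of M, a tuple of the monster model C = M*.  By      *)
(* omega-categoricity types of finite tuples are isolated, so that invariant    *)
(* sets depending on finitely many coordinates are definable; and by a coheir   *)
(* argument an automorphism of C that fixes m is Lascar-strong.  Hence closed   *)
(* subsets of Gal_L are described by sets of formulas about (s(m), m), and      *)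
(* Autf_KP = Autf_Sh.                                                           *)
(*                                                                              *)
(* Let U range over the open normal subgroups of finite index of G.  A          *)
(* pointwise stabiliser in G has finitely many double cosets, by which a        *)
(* bounded subgroup of G** that is an intersection of open sets contains an     *)
(* intersection of U**'s; thus G**^00_top is the intersection of all U**.       *)
(* Since membership in U is given by a 0-definable finite equivalence           *)
(* relation between m and g(m), and conversely such relations have open         *)
(* stabilisers, an element of G** that restricts to an automorphism s of C      *)
(* lies in this intersection iff s is in Autf_Sh: theta is well defined and     *)
(* injective.  A compatible family of cosets of the U's is realised in G by a   *)
(* back-and-forth that keeps track of the cosets of the U's meeting a basic     *)
(* open set, so that G maps onto G**/G**^00_top and onto Gal_KP.  Finally, for  *)
(* a compactification f : G -> B, the closure of the image of a stabiliser is   *)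
(* open in B, because finitely many of its double cosets cover B; so f is       *)
(* small on some U, and factors through r_1.                                    *)

From mathcomp Require Import finmap all_boot all_classical topology wochoice.
From Stdlib Require List.
Require Import Defs.

Set Implicit Arguments.
Unset Strict Implicit.
Unset Printing Implicit Defensive.

Local Open Scope classical_set_scope.
Local Open Scope card_scope.

(** * Small cardinals *)

(** Write [C] for the reduct of [Ms], [X] for [Mss] as an extension of M with its group, m for the
    enumeration of M ([elt_env], and [base_env] inside [C]), and G_A for the pointwise stabiliser
    [pstab A]. The whole proof turns on the open normal subgroups U of finite index of G
    ([open_finite]).

    Finiteness comes from two sides. By omega-categoricity, finite tuples have isolated types
    ([finite_tuple_isolated]), only finitely many ([finite_types]); hence relations that are
    invariant and depend on finitely many coordinates are definable, and G_A has finitely many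
    double cosets ([double_cosets]). By saturation, a definable equivalence relation with boundedly
    many classes has finitely many ([definable_bounded_finite]).

    On the Galois side, a coheir argument shows that automorphisms of [C] fixing m are Lascar-strong
    ([fix_base_Autf_L]). So the class of s in [Gal_L] is determined by the type of (s(m), m), and
    closed sets are given by sets of formulas about this pair ([Gal_L_closed_canonical]). Orbits of
    Lascar-strong automorphisms on finite tuples form a bounded, definable, hence finite relation,
    whence [Autf_KP_Sh].

    On the group side, the intersection [core00] of the interpretations of all U is the required
    component ([core00_bounded], [core00_least]), and the cosets of the U give a base of the logic
    topology on the quotient ([open_quotientP]).

    The two sides meet because U is described by a finite definable equivalence relation between m
    and g(m) ([open_finite_equivalence]), and stabilisers of the classes of such relations are among
    the U ([finite_equivalence_open]). Thus an element of the group of [X] that restricts to s on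
    [C] lies in [core00] iff s is in [Autf_Sh] ([core00_Autf_Sh]), so that theta is well defined and
    injective. It is onto since G itself maps onto the quotient: a compatible family of cosets of
    the U has a limit in G ([coherent_limit], [gemb_dense]). Saturation makes theta continuous and
    closed ([theta_continuous], [theta_closed_image]).

    Through theta, r_1 becomes the canonical map from G to the quotient. Any compactification of G
    is small on some U ([compactification_profinite]), so it factors through r_1
    ([profinite_bohr]). *)

Definition inj_le (T U : Type) := exists f : T -> U, injective f.

Lemma inj_leP (T U : Type) : [set: T] #<= [set: U] <-> inj_le T U.
Proof.
split=> [/card_leP/unsquash f|[f fI]].
  exists (fun x => \val (f (exist _ x (mem_set I)))) => x y /val_inj fxy.
  have : exist (fun x => x \in [set: T]) x (mem_set I) =
         exist (fun x => x \in [set: T]) y (mem_set I).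
    by apply: ('inj_f _ _ fxy); exact: mem_set.
  by case.
have e : f @` setT #= [set: T] by apply: inj_card_eq => x y _ _; exact: fI.
by rewrite -(card_le_eql e); exact: card_leT.
Qed.

Lemma sval_inj T (A : set T) : injective (@sval T A).
Proof.
by move=> [x Ax] [y Ay] /= xy; subst y; congr exist; exact: Prop_irrelevance.
Qed.

Lemma inj_le_trans T U W : inj_le T U -> inj_le U W -> inj_le T W.
Proof. by move=> [f fI] [g gI]; exists (g \o f); exact: inj_comp. Qed.

(** Zorn's lemma gives a maximal partial injection, coded as a set of pairs in which either
    coordinate determines the other. If it missed a point on both sides, these two points could be
    added as a pair; so it is total or onto. *)
Lemma inj_le_total T U : inj_le T U \/ inj_le U T.
Proof.
pose P := [set A : set (T * U) | forall x y, A x -> A y ->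
  (x.1 = y.1 <-> x.2 = y.2)].
have [|A [PA maxA]] := @Zorn_bigcup (T * U) P.
  move=> F FP Ft x y [X FX Xx] [Y FY Yy].
  by case: (Ft _ _ FX FY) => XY; [apply: (FP _ FY) => //|apply: (FP _ FX) => //];
    exact: XY.
have [Tt|] := pselect (forall t, exists u, A (t, u)).
  left; have /choice[f fP] := Tt; exists f => x y fxy.
  by have [_ /(_ fxy)] := PA _ _ (fP x) (fP y).
move/existsNP => [t At].
have [Uu|] := pselect (forall u, exists t, A (t, u)).
  right; have /choice[f fP] := Uu; exists f => x y fxy.
  by have [/(_ fxy)] := PA _ _ (fP x) (fP y).
move/existsNP => [u Au].
exfalso; apply: (maxA (A `|` [set (t, u)])).
  rewrite properEneq; split; last by left.
  by apply/eqP => AE; apply: At; exists u; rewrite AE; right.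
have h x : A x -> x.1 <> t /\ x.2 <> u.
  by case: x => x y Axy; split=> /= e; subst; [apply: At|apply: Au]; eexists; exact: Axy.
move=> x y [Ax|->] [Ay|->] //=; first exact: PA.
  by have [? ?] := h _ Ax; split => e.
by have [? ?] := h _ Ay; split => e; exfalso; auto.
Qed.

Lemma smallP K T : small K T <-> inj_le T K /\ ~ inj_le K T.
Proof. by rewrite /small /card_lt; split=> -[/inj_leP a b]; split=> // /inj_leP. Qed.

Lemma small_le K T U : inj_le T U -> small K U -> small K T.
Proof.
move=> TU /smallP[UK KU]; apply/smallP; split; first exact: inj_le_trans UK.
by move=> KT; apply: KU; exact: inj_le_trans TU.
Qed.

Section StrongLimit.
Variable K : Type.
Hypothesis Klim : uncountable_strong_limit K.

Lemma small_set T : small K T -> small K (set T).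
Proof. exact: (proj2 Klim). Qed.

(** The smaller factor embeds in the larger one, and Kuratowski's pairs {{t}, {t, u}} then embed the
    product in a double power set, which is small because K is a strong limit. *)
Lemma small_prod T U : small K T -> small K U -> small K (T * U).
Proof.
wlog TU : T U / inj_le T U => [H sT sU|sT sU].
  case: (inj_le_total T U) => [TU|UT]; first exact: H.
  apply: small_le (H _ _ UT sU sT).
  by exists (fun x => (x.2, x.1)) => -[? ?] [? ?] [-> ->].
apply: small_le (small_set (small_set sU)); case: TU => f fI.
exists (fun x => [set [set f x.1]; [set f x.1; x.2]]) => -[t u] [t' u'] /= e.
have h1 : f t = f t'.
  have : [set [set f t']; [set f t'; u']] [set f t] by rewrite -e; left.
  move=> [h|h].
    by have : [set f t] (f t') by rewrite h.
  by have : [set f t] (f t') by rewrite h; left.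
rewrite -(fI _ _ h1) in e *; congr pair.
have : [set [set f t]; [set f t; u']] [set f t; u] by rewrite -e; right.
have : [set [set f t]; [set f t; u]] [set f t; u'] by rewrite e; right.
have mem (A B : set U) x : A = B -> A x -> B x by move->.
move=> [/mem/(_ (or_intror erefl))|h].
  move=> /= -> [] /mem/(_ (or_intror erefl)); [exact|case; exact].
have [/=|] := mem _ _ u' h (or_intror erefl); last by [].
by move=> u'E; have [/=|] := mem _ _ u (esym h) (or_intror erefl) => ->.
Qed.

Lemma small_countable T : countable [set: T] -> small K T.
Proof. by move/inj_leP => TN; exact: small_le (proj1 Klim). Qed.

Lemma small_count (T : countType) : small K T.
Proof. exact: small_countable (countableP _). Qed.

Lemma small_sum T U : small K T -> small K U -> small K (T + U).
Proof.
wlog TU : T U / inj_le T U => [H sT sU|sT sU].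
  case: (inj_le_total T U) => [TU|UT]; first exact: H.
  apply: small_le (H _ _ UT sU sT).
  exists (fun x => match x with inl a => inr a | inr b => inl b end).
  by move=> [?|?] [?|?] // [->].
apply: small_le (small_prod (small_count bool) sU); case: TU => f fI.
exists (fun x => match x with inl a => (true, f a) | inr b => (false, b) end).
by move=> [?|?] [?|?] // [] // => [/fI->|->].
Qed.

Lemma small_option T : small K T -> small K (option T).
Proof.
move=> sT; apply: small_le (small_sum sT (small_count unit)).
exists (fun x => match x with Some a => inl a | None => inr tt end).
by move=> [?|] [?|] // [->].
Qed.

Lemma card_lt_small T (A : set T) : card_lt A [set: K] -> small K {x | A x}.
Proof.
move=> [AK KA]; apply/smallP; split.
  have e : [set: {x | A x}] #= sval @` [set: {x | A x}].
    rewrite card_eq_sym; apply: inj_card_eq => x y _ _; exact: sval_inj.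
  apply/inj_leP; rewrite (card_le_eql e); apply: card_le_trans AK.
  by apply: subset_card_le => _ [[x Ax] _ <-].
move=> [f fI]; apply: KA.
have e : (sval \o f) @` setT #= [set: K].
  apply: inj_card_eq => x y _ _ /= fxy; apply: fI; exact: sval_inj fxy.
rewrite -(card_le_eql e); apply: subset_card_le => _ [x _ <-] /=.
exact: (svalP (f x)).
Qed.

(** Numbers of classes and cosets are bounded below by this: a class is recovered from an invariant
    that lives in a small type. *)
Lemma small_card_lt T (A : set T) U (f : {x | A x} -> U) :
  injective f -> small K U -> card_lt A [set: K].
Proof.
move=> fI sU.
have /smallP[h1 h2] : small K {x | A x} by apply: small_le sU; exists f.
have sA : sval @` [set: {x | A x}] = A.
  by apply/seteqP; split=> [_ [[x Ax] _ <-] //|x Ax]; exists (exist _ x Ax).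
have e : A #= [set: {x | A x}].
  by rewrite -[X in X #= _]sA; apply: inj_card_eq => x y _ _; exact: sval_inj.
rewrite card_eq_sym in e.
split; first by rewrite -(card_le_eql e); exact/inj_leP.
by rewrite -(card_le_eqr e) => /inj_leP.
Qed.

End StrongLimit.

(** * Formulas and substitution *)

Section Substitution.
Variable L : signature.
Implicit Types (V W : Type).

Fixpoint tsubst V W (sv : V -> lsort L) (sw : W -> lsort L)
    (tau : forall v, term sw (sv v)) s (t : term sv s) : term sw s :=
  match t in term _ s return term sw s with
  | Var v => tau v
  | App f u => App (fun i => tsubst tau (u i))
  end.

Definition tsubst_bind V W (sv : V -> lsort L) (sw : W -> lsort L)
    (tau : forall v, term sw (sv v)) s (o : option V) :
    term (vext sw s) (vext sv s o) :=
  match o return term (vext sw s) (vext sv s o) with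
  | Some v => tsubst (fun w => Var (vext sw s) (Some w)) (tau v)
  | None => Var (vext sw s) None
  end.

Fixpoint subst V (sv : V -> lsort L) (p : formula sv) :
    forall W (sw : W -> lsort L), (forall v, term sw (sv v)) -> formula sw :=
  match p with
  | Equ _ t u => fun _ _ tau => Equ (tsubst tau t) (tsubst tau u)
  | Rel r t => fun _ _ tau => Rel (fun i => tsubst tau (t i))
  | Bot => fun _ sw _ => Bot sw
  | Imp p q => fun _ _ tau => Imp (subst p tau) (subst q tau)
  | All s p => fun _ _ tau => All (subst p (tsubst_bind tau s))
  end.

Variable N : structure L.

Lemma eval_tsubst V W (sv : V -> lsort L) (sw : W -> lsort L)
    (tau : forall v, term sw (sv v)) s (t : term sv s) (b : env N sw) :
  eval b (tsubst tau t) = eval (fun v => eval b (tau v) : N (sv v)) t.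
Proof.
elim: t => //= f u IH; congr fint.
by apply: functional_extensionality_dep => i; exact: IH.
Qed.

Lemma sat_subst V (sv : V -> lsort L) (p : formula sv) W (sw : W -> lsort L)
    (tau : forall v, term sw (sv v)) (b : env N sw) :
  sat (subst p tau) b <-> sat p (fun v => eval b (tau v) : N (sv v)).
Proof.
elim: p W sw tau b => {V sv} /=.
- by move=> V sv s t u W sw tau b; rewrite !eval_tsubst.
- move=> V sv r t W sw tau b.
  suff -> : (fun i => eval b (tsubst tau (t i))) =
      (fun i => eval (fun v => eval b (tau v) : N (sv v)) (t i)) by [].
  by apply: functional_extensionality_dep => i; rewrite eval_tsubst.
- by [].
- by move=> V sv p IHp q IHq W sw tau b; rewrite (propext (IHp _ _ _ _)) (propext (IHq _ _ _ _)).
- move=> V sv s p IH W sw tau b.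
  have E x : (fun o => eval (econs b x) (tsubst_bind tau s o) : N (vext sv s o)) =
      econs (fun v => eval b (tau v) : N (sv v)) x.
    apply: functional_extensionality_dep => -[v|//] /=.
    by rewrite eval_tsubst.
  by split=> H x; [rewrite -E; apply/IH; exact: H|apply/IH; rewrite E; exact: H].
Qed.

Lemma sat_ext V (sv : V -> lsort L) (p : formula sv) (a b : env N sv) :
  (forall v, a v = b v) -> sat p a -> sat p b.
Proof. by move=> /(@functional_extensionality_dep _ _ a b) ->. Qed.

End Substitution.

Section Connectives.
Variables (L : signature) (V : Type) (sv : V -> lsort L).
Implicit Types (p q : formula sv) (N : structure L).

Definition fNot p := Imp p (Bot sv).
Definition fAnd p q := fNot (Imp p (fNot q)).
Definition fOr p q := Imp (fNot p) q.
Definition fEx s (p : formula (vext sv s)) := fNot (All (Imp p (Bot _))).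
Definition fAndL (l : seq (formula sv)) := foldr fAnd (fNot (Bot sv)) l.
Definition fOrL (l : seq (formula sv)) := foldr fOr (Bot sv) l.

Lemma sat_not N p (a : env N sv) : sat (fNot p) a <-> ~ sat p a.
Proof. by []. Qed.

Lemma sat_imp N p q (a : env N sv) : sat (Imp p q) a <-> (sat p a -> sat q a).
Proof. by []. Qed.

Lemma sat_equ N s (t u : term sv s) (a : env N sv) :
  sat (Equ t u) a <-> eval a t = eval a u.
Proof. by []. Qed.

Lemma sat_and N p q (a : env N sv) : sat (fAnd p q) a <-> sat p a /\ sat q a.
Proof.
split=> /= [h|[hp hq] h]; last exact: h.
by split; apply: contrapT => ?; apply: h.
Qed.

Lemma sat_or N p q (a : env N sv) : sat (fOr p q) a <-> sat p a \/ sat q a.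
Proof.
split=> /= [h|[//|hq _ //]].
by have [hp|/h hq] := pselect (sat p a); [left|right].
Qed.

Lemma sat_ex N s (p : formula (vext sv s)) (a : env N sv) :
  sat (fEx p) a <-> exists x, sat p (econs a x).
Proof.
split=> [/= h|[x px] /= h]; last exact: h px.
by apply: contrapT => /forallNP h'; apply: h => x /h'.
Qed.

Lemma sat_andL N l (a : env N sv) :
  sat (fAndL l) a <-> forall p, List.In p l -> sat p a.
Proof.
elim: l => [|p l IH] /=; first by split.
split=> [/sat_and[pa /IH la] q [<-//|/la]//|h].
by apply/sat_and; split; [apply: h; left|apply/IH => q ql; apply: h; right].
Qed.

Lemma sat_orL N l (a : env N sv) :
  sat (fOrL l) a <-> exists2 p, List.In p l & sat p a.
Proof.
elim: l => [|p l IH] /=; first by split=> // -[].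
split=> [/sat_or[pa|/IH[q ql qa]]|[q [<-|ql] qa]].
- by exists p => //; left.
- by exists q => //; right.
- by apply/sat_or; left.
- by apply/sat_or; right; apply/IH; exists q.
Qed.

(** Dependence on variables is expressed by truth in all structures rather than by occurrence. Lists
    with [List.In] are used because types of variables carry no decidable equality. *)
Definition supp (S : seq V) p := forall N (a b : env N sv),
  (forall v, List.In v S -> a v = b v) -> sat p a -> sat p b.

Lemma supp_iff S p N (a b : env N sv) : supp S p ->
  (forall v, List.In v S -> a v = b v) -> sat p a <-> sat p b.
Proof. by move=> Sp ab; split; apply: Sp => // v /ab. Qed.

Lemma supp_sub S S' p : (forall v, List.In v S -> List.In v S') ->
  supp S p -> supp S' p.
Proof. by move=> SS Sp N a b ab; apply: Sp => v /SS/ab. Qed.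

Lemma sat_true N (a : env N sv) : sat (fNot (Bot sv)) a.
Proof. by []. Qed.

Lemma supp_true S : supp S (fNot (Bot sv)).
Proof. by move=> N a b _ _; exact: sat_true. Qed.

Lemma supp_not S p : supp S p -> supp S (fNot p).
Proof. by move=> Sp N a b ab /= pa pb; apply: pa; apply: Sp pb => v /ab. Qed.

Lemma supp_and S p q : supp S p -> supp S q -> supp S (fAnd p q).
Proof.
by move=> Sp Sq N a b ab /sat_and[pa qa]; apply/sat_and; split; [apply: Sp pa|apply: Sq qa].
Qed.

End Connectives.

Lemma In_flatten (I : finType) V (S : I -> seq V) i v :
  List.In v (S i) -> List.In v (flatten [seq S i | i <- enum I]).
Proof.
have : i \in enum I by rewrite mem_enum.
elim: (enum _) => //= j l IH; rewrite inE => /predU1P[<-|/IH h] vS;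
  apply/List.in_app_iff; [by left|by right; exact: h].
Qed.

Lemma tsupp_ex (L : signature) V (sv : V -> lsort L) s (t : term sv s) :
  exists S : seq V, forall (N : structure L) (a b : env N sv),
    (forall v, List.In v S -> a v = b v) -> eval a t = eval b t.
Proof.
elim: t => [v|f u /choice[S SP]].
  by exists [:: v] => N a b; apply; left.
exists (flatten [seq S i | i <- enum (fargs f)]) => N a b ab /=; congr fint.
apply: functional_extensionality_dep => i; apply: SP => v vS.
by apply: ab; apply: In_flatten vS.
Qed.

Lemma supp_ex (L : signature) V (sv : V -> lsort L) (p : formula sv) :
  exists S, supp S p.
Proof.
elim: p => {V sv} [V sv s t u|V sv r t|V sv|V sv p [S Sp] q [S' Sq]|V sv s p [S Sp]].
- have [S St] := tsupp_ex t; have [S' Su] := tsupp_ex u.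
  exists (S ++ S') => N a b ab /= tu; rewrite -(St _ a b) -?(Su _ a b) //.
    by move=> v vS; apply: ab; apply/List.in_app_iff; right.
  by move=> v vS; apply: ab; apply/List.in_app_iff; left.
- have /choice[S SP] := fun i => tsupp_ex (t i).
  exists (flatten [seq S i | i <- enum (rargs r)]) => N a b ab /=.
  suff -> : (fun i => eval a (t i)) = (fun i => eval b (t i)) by [].
  apply: functional_extensionality_dep => i; apply: SP => v vS.
  by apply: ab; apply: In_flatten vS.
- by exists nil.
- exists (S ++ S') => N a b ab /= pq pb; apply: (Sq _ a).
    by move=> v vS; apply: ab; apply/List.in_app_iff; right.
  apply: pq; apply: Sp pb => v vS; apply/esym/ab.
  by apply/List.in_app_iff; left.
- exists (pmap id S) => N a b ab /= pa x; apply: Sp (pa x) => -[v|//] vS /=.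
  apply: ab; elim: S vS => //= -[w|] l IH [] //=.
  + by case=> <-; left.
  + by move=> /IH; right.
Qed.

Section NamedVariables.
Variables (L : signature) (V : Type) (sv : V -> lsort L).

Definition upd (N : structure L) (a : env N sv) v (x : N (sv v)) : env N sv :=
  fun w => match pselect (v = w) with
           | left e => eq_rect v (fun w => N (sv w)) x w e
           | right _ => a w
           end.

Lemma upd_eq (N : structure L) (a : env N sv) v (x : N (sv v)) : upd a x v = x.
Proof.
by rewrite /upd; case: pselect => // e; rewrite (Prop_irrelevance e erefl).
Qed.

Lemma upd_ne (N : structure L) (a : env N sv) v (x : N (sv v)) w :
  v <> w -> upd a x w = a w.
Proof. by rewrite /upd; case: pselect. Qed.

Definition mix (N : structure L) (D : set V) (a b : env N sv) : env N sv :=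
  fun v => if pselect (D v) then a v else b v.

Lemma mixT (N : structure L) (D : set V) (a b : env N sv) v :
  D v -> mix D a b v = a v.
Proof. by rewrite /mix; case: pselect. Qed.

Lemma mixF (N : structure L) (D : set V) (a b : env N sv) v :
  ~ D v -> mix D a b v = b v.
Proof. by rewrite /mix; case: pselect. Qed.

(** Quantifiers bind only the new variable [None]; moving v to that position lets [fEx (at_var v p)]
    quantify over a named variable. *)
Definition at_var v (p : formula sv) : formula (vext sv (sv v)) :=
  subst p (fun w => match pselect (v = w) with
    | left e => eq_rect v (fun w => term (vext sv (sv v)) (sv w))
                  (Var (vext sv (sv v)) None) w e
    | right _ => Var (vext sv (sv v)) (Some w)
    end).

Lemma sat_at_var (N : structure L) v (p : formula sv) (a : env N sv) x :
  sat (at_var v p) (econs a x) <-> sat p (upd a x).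
Proof.
rewrite /at_var (propext (sat_subst _ _ _)).
suff -> : (fun w => eval (econs a x) match pselect (v = w) with
    | left e => eq_rect v (fun w => term (vext sv (sv v)) (sv w))
                  (Var (vext sv (sv v)) None) w e
    | right _ => Var (vext sv (sv v)) (Some w)
    end) = upd a x by [].
apply: functional_extensionality_dep => w; rewrite /upd.
by case: pselect => // e; case: _ / e.
Qed.

Definition fExs (l : seq V) (p : formula sv) :=
  foldr (fun v p => fEx (at_var v p)) p l.

Lemma sat_exs (N : structure L) l (p : formula sv) (a : env N sv) :
  sat (fExs l p) a <->
  exists b, (forall v, ~ List.In v l -> b v = a v) /\ sat p b.
Proof.
elim: l a => [|v l IH] a.
  split=> [pa|[b [ab pb]]]; first by exists a.
  by apply: sat_ext pb => v; exact: ab.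
change (sat (fEx (at_var v (fExs l p))) a <->
  exists b, (forall w, ~ (v = w \/ List.In w l) -> b w = a w) /\ sat p b).
rewrite (propext (sat_ex _ _)); split.
  move=> [x /sat_at_var/IH[b [bx pb]]]; exists b; split=> // w wl.
  rewrite bx; first by apply: upd_ne => vw; apply: wl; left.
  by move=> ?; apply: wl; right.
move=> [b [ab pb]]; exists (b v); apply/sat_at_var/IH; exists b; split=> // w wl.
have [<-|vw] := pselect (v = w); first by rewrite upd_eq.
by rewrite upd_ne //; apply: ab => -[].
Qed.

Definition at_name v (p : formula (vext sv (sv v))) : formula sv :=
  subst p (fun o => match o return term sv (vext sv (sv v) o) with
    | Some w => Var sv w | None => Var sv v end).

Lemma sat_at_name (N : structure L) v p (a : env N sv) :
  sat (@at_name v p) a <-> sat p (econs a (a v)).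
Proof.
rewrite /at_name (propext (sat_subst _ _ _)).
by split; apply: sat_ext => -[].
Qed.

End NamedVariables.

Lemma In_filterN (V : Type) (P : set V) (S : seq V) v :
  List.In v [seq w <- S | ~~ `[< P w >]] <-> List.In v S /\ ~ P v.
Proof.
elim: S => [|w T IH] /=; first by split=> // -[].
case: asboolP => Pw /=; rewrite (propext IH).
  by split=> [[]|[[<-|]]] //; split=> //; right.
by split=> [[<-|[]]|[[]]]; [split=> //; left|split=> //; right|left|right].
Qed.

Section ElementaryTransfer.
Variables (L : signature) (N X : structure L) (f : forall s, N s -> X s).
Hypothesis f_elem : elementary f.
Variables (V : Type) (sv : V -> lsort L) (P : set V).

(** Only finitely many coordinates outside P matter for p. Once they are quantified existentially,
    the remaining relevant variables have values from N, and elementarity applies. *)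
Lemma elem_witness (p : formula sv) (c : env N sv) (a : env X sv) :
  (forall v, P v -> a v = f (c v)) -> sat p a ->
  exists c', (forall v, P v -> c' v = c v) /\ sat p c'.
Proof.
move=> ac pa; have [S Sp] := supp_ex p.
pose l := [seq v <- S | ~~ `[< P v >]].
have inl v : List.In v l <-> List.In v S /\ ~ P v by exact: In_filterN.
have : sat (fExs l p) (emap f c).
  apply/sat_exs; exists (mix (fun v => List.In v l) a (emap f c)); split.
    move=> v vl; exact: mixF.
  apply: Sp pa => v vS; rewrite /mix; case: pselect => // h.
  by apply: ac; apply: contrapT => nP; apply: h; apply/inl.
move=> /f_elem/sat_exs[c' [cc' pc']]; exists c'; split=> // v Pv.
by apply: cc' => /inl[].
Qed.

(** The form in which statements pass from N to X below: P holds the parameters, and all other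
    variables are universally quantified. *)
Lemma elem_valid (p : formula sv) (c : env N sv) :
  (forall a, (forall v, P v -> a v = c v) -> sat p a) ->
  forall a : env X sv, (forall v, P v -> a v = f (c v)) -> sat p a.
Proof.
move=> H a ac; apply: contrapT => np.
have [c' [cc' /sat_not]] := @elem_witness (fNot p) c a ac np.
by apply; exact: H.
Qed.

End ElementaryTransfer.

Lemma existT_inj (I : Type) (P : I -> Type) i (x y : P i) :
  existT P i x = existT P i y -> x = y.
Proof.
have h z : z = existT P i y ->
    forall e : projT1 z = i, eq_rect _ P (projT2 z) _ e = y.
  by move=> -> e; rewrite (Prop_irrelevance e erefl).
by move/h => /(_ erefl).
Qed.

(** * Coding of formulas by finite trees, and countability of the set of formulas *)

Section Coding.
Variables (L : signature).
Variables (cS : lsort L -> nat) (cF : fsym L -> nat) (cR : rsym L -> nat).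
Hypotheses (cSI : injective cS) (cFI : injective cF) (cRI : injective cR).

Fixpoint tcode V (cV : V -> nat) (sv : V -> lsort L) s (t : term sv s) :
    GenTree.tree nat :=
  match t with
  | Var v => GenTree.Leaf (cV v)
  | App f u => GenTree.Node (cF f) [seq tcode cV (u i) | i <- enum (fargs f)]
  end.

Definition ocode V (cV : V -> nat) (o : option V) :=
  if o is Some v then (cV v).+1 else 0.

(** The labels 0 to 3 mark the other constructors, whence the shift of relation symbols by 4. Under
    a quantifier, [ocode] keeps the numbering of variables injective. *)
Fixpoint fcode V (cV : V -> nat) (sv : V -> lsort L) (p : formula sv) :
    GenTree.tree nat :=
  match p with
  | Equ _ t u => GenTree.Node 0 [:: tcode cV t; tcode cV u]
  | Rel r t =>
      GenTree.Node (cR r).+4 [seq tcode cV (t i) | i <- enum (rargs r)]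
  | Bot => GenTree.Node 1 [::]
  | Imp p q => GenTree.Node 2 [:: fcode cV p; fcode cV q]
  | All s p => GenTree.Node 3 [:: GenTree.Leaf (cS s); fcode (ocode cV) p]
  end.

Lemma eq_map_enum (I : finType) (T : Type) (f g : I -> T) :
  [seq f i | i <- enum I] = [seq g i | i <- enum I] -> forall i, f i = g i.
Proof.
move=> /eq_in_map fg i; apply: fg; exact: mem_enum.
Qed.

Lemma tcode_inj V (cV : V -> nat) (sv : V -> lsort L) : injective cV ->
  forall s s' (t : term sv s) (u : term sv s'), tcode cV t = tcode cV u ->
  existT _ s t = existT _ s' u.
Proof.
move=> cVI s s' t; elim: t s' => [v|f u IH] s' [w|g u'] //=.
  by move=> [/cVI ->].
move=> [/cFI e]; subst g => /eq_map_enum uu; congr existT; congr App.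
apply: functional_extensionality_dep => i; exact: existT_inj (IH i _ _ (uu i)).
Qed.

Lemma fcode_inj V (cV : V -> nat) (sv : V -> lsort L) : injective cV ->
  injective (@fcode V cV sv).
Proof.
move=> + p; elim: p cV => {V sv}.
- move=> V sv s t u cV cVI [] //= s' t' u' [].
  move=> /(tcode_inj cVI) e; have := projT1_eq e => /= ?; subst s'.
  by rewrite (existT_inj e) => /(tcode_inj cVI) e'; rewrite (existT_inj e').
- move=> V sv r t cV cVI [] //= r' t' [/cRI e]; subst r' => /eq_map_enum tt.
  congr Rel; apply: functional_extensionality_dep => i.
  exact: existT_inj (tcode_inj cVI (tt i)).
- by move=> V sv cV cVI [].
- by move=> V sv p IHp q IHq cV cVI [] //= p' q' [] /IHp -> // /IHq ->.
- move=> V sv s p IH cV cVI [] //= s' p' [/cSI e]; subst s' => /IH -> //.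
  by move=> [x|] [y|] //= [/cVI ->].
Qed.

End Coding.

Definition countable_language (L : signature) :=
  [/\ countable [set: lsort L], countable [set: fsym L] &
      countable [set: rsym L]].

Lemma formula_countable (L : signature) (V : Type) (sv : V -> lsort L) :
  countable_language L -> countable [set: V] -> countable [set: formula sv].
Proof.
move=> [/inj_leP[cS cSI] /inj_leP[cF cFI] /inj_leP[cR cRI]] /inj_leP[cV cVI].
apply/inj_leP; exists (pickle \o fcode cS cF cR cV (sv := sv)).
exact: inj_comp (pcan_inj (@pickleK _)) (fcode_inj cSI cFI cRI cVI).
Qed.

Lemma countable_enum (T : Type) : countable [set: T] -> T ->
  exists e : nat -> T, forall x, exists n, e n = x.
Proof.
move=> /inj_leP[c cI] t.
have /choice[e eP] : forall n, exists x, forall y, c y = n -> y = x.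
  move=> n; have [[x <-]|h] := pselect (exists x, c x = n).
    by exists x => y /cI.
  by exists t => y yn; exfalso; apply: h; exists y.
by exists e => x; exists (c x); apply/esym/eP.
Qed.

(** * Formulas about the reduct, translated into the language with the group sort *)

Section Translation.
Variables (L : signature) (M : structure L).
Local Notation GL := (gsig M).

Fixpoint ttrans V (sv : V -> lsort L) W (sw : W -> lsort GL)
    (tau : forall v, term sw (Some (sv v) : lsort GL)) s (t : term sv s) :
    term sw (Some s : lsort GL) :=
  match t in term _ s return term sw (Some s : lsort GL) with
  | Var v => tau v
  | App f u => @App GL W sw (Base f) (fun i => ttrans tau (u i))
  end.

Definition trans_bind V (sv : V -> lsort L) W (sw : W -> lsort GL)
    (tau : forall v, term sw (Some (sv v) : lsort GL)) s (o : option V) :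
    term (vext sw (Some s : lsort GL)) (Some (vext sv s o) : lsort GL) :=
  match o return term (vext sw (Some s : lsort GL)) (Some (vext sv s o) : lsort GL)
  with
  | Some v => tsubst (fun w => Var (vext sw (Some s : lsort GL)) (Some w)) (tau v)
  | None => Var (vext sw (Some s : lsort GL)) None
  end.

(** Terms are substituted during the translation, so that a variable can become a term such as
    [tAct vx (u v)], the image of an element under a group element. *)
Fixpoint trans V (sv : V -> lsort L) (p : formula sv) :
    forall W (sw : W -> lsort GL),
      (forall v, term sw (Some (sv v) : lsort GL)) -> formula sw :=
  match p with
  | Equ _ t u => fun _ _ tau => Equ (ttrans tau t) (ttrans tau u)
  | Rel r t => fun _ sw tau => @Rel GL _ sw (inl r) (fun i => ttrans tau (t i))
  | Bot => fun _ sw _ => Bot sw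
  | Imp p q => fun _ _ tau => Imp (trans p tau) (trans q tau)
  | All s p => fun _ _ tau =>
      @All GL _ _ (Some s : lsort GL) (trans p (trans_bind tau s))
  end.

Variable X : structure GL.

Lemma eval_ttrans V (sv : V -> lsort L) W (sw : W -> lsort GL)
    (tau : forall v, term sw (Some (sv v) : lsort GL)) s (t : term sv s)
    (b : env X sw) :
  eval b (ttrans tau t) =
  eval (M := reduct X) (fun v => eval b (tau v) : reduct X (sv v)) t.
Proof.
elim: t => //= f u IH; congr (@fint GL X (Base f)).
by apply: functional_extensionality_dep => i; exact: IH.
Qed.

Lemma sat_trans V (sv : V -> lsort L) (p : formula sv) W (sw : W -> lsort GL)
    (tau : forall v, term sw (Some (sv v) : lsort GL)) (b : env X sw) :
  sat (trans p tau) b <->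
  sat (M := reduct X) p (fun v => eval b (tau v) : reduct X (sv v)).
Proof.
elim: p W sw tau b => {V sv} /=.
- by move=> V sv s t u W sw tau b; rewrite !eval_ttrans.
- move=> V sv r t W sw tau b.
  suff -> : (fun i => eval b (ttrans tau (t i))) =
      (fun i => eval (M := reduct X) (fun v => eval b (tau v) : reduct X (sv v)) (t i)) by [].
  by apply: functional_extensionality_dep => i; rewrite eval_ttrans.
- by [].
- by move=> V sv p IHp q IHq W sw tau b; rewrite (propext (IHp _ _ _ _)) (propext (IHq _ _ _ _)).
- move=> V sv s p IH W sw tau b.
  have E x : (fun o => eval (econs b x) (trans_bind tau s o) : reduct X (vext sv s o)) =
      econs (M := reduct X) (fun v => eval b (tau v) : reduct X (sv v)) (x : reduct X s).
    apply: functional_extensionality_dep => -[v|//] /=.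
    by rewrite eval_tsubst.
  by split=> H x; [rewrite -E; apply/IH; exact: H|apply/IH; rewrite E; exact: H].
Qed.

End Translation.

(** * Saturation and bounded relations *)

Lemma finite_set_list T (q : set T) : finite_set q ->
  exists s : seq T, forall x, q x <-> List.In x s.
Proof.
elim/Peq : T => T in q *; move=> /finite_seqP[s ->]; exists s => x.
elim: s => //= y s <-; rewrite inE; split=> [/predU1P[->|]|[->|]]; try by [left|right].
  by rewrite eqxx.
by move=> ->; rewrite orbT.
Qed.

Lemma list_finite_set T (q : set T) (s : seq T) :
  (forall x, q x -> List.In x s) -> finite_set q.
Proof.
elim/Peq : T => T in q s *; move=> qs.
apply: (@sub_finite_set _ _ [set` s]); last by apply/finite_seqP; exists s.
move=> x /qs /=; elim: s {qs} => //= y s IH [->|/IH xs]; rewrite inE ?eqxx//.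
by rewrite xs orbT.
Qed.

Lemma list_choice (T U : Type) (R : T -> U -> Prop) (s : seq T) :
  (forall x, List.In x s -> exists y, R x y) ->
  exists s' : seq U, (forall x, List.In x s -> exists2 y, List.In y s' & R x y) /\
    forall y, List.In y s' -> exists2 x, List.In x s & R x y.
Proof.
elim: s => [|x s IH] sR; first by exists nil.
have [y xy] := sR x (or_introl erefl).
have [s' [h1 h2]] := IH (fun x xs => sR x (or_intror xs)).
exists (y :: s'); split=> [z [<-|/h1[w ws zw]]|z [<-|/h2[w ws zw]]].
- by exists y => //; left.
- by exists w => //; right.
- by exists x => //; left.
- by exists w => //; right.
Qed.

Lemma dchoice (T : Type) (U : T -> Type) (R : forall x, U x -> Prop) :
  (forall x, exists y, R x y) -> exists f : forall x, U x, forall x, R x (f x).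
Proof. by move=> H; exists (fun x => sval (cid (H x))) => x; case: cid. Qed.

Section Saturation.
Variables (L : signature) (X : structure L) (K : Type).
Hypothesis Xsat : saturated X K.
Variables (V : Type) (sv : V -> lsort L).
Hypothesis smallV : small K V.

(** Extends saturation from one variable to small tuples of variables. Zorn's lemma gives a maximal
    partial assignment compatible with every finite part of phi. It is total: for an unassigned v,
    the formulas saying that the other relevant variables can be chosen form a finitely satisfiable
    type in v alone. *)
Lemma saturation (D : set V) (a : env X sv) (J : Type) (phi : J -> formula sv) :
  (forall l : seq J, exists c, (forall v, D v -> c v = a v) /\
     forall j, List.In j l -> sat (phi j) c) ->
  exists c, (forall v, D v -> c v = a v) /\ forall j, sat (phi j) c.
Proof.
move=> fin.
pose agr (A : set {v & X (sv v)}) (c : env X sv) :=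
  (forall v, D v -> c v = a v) /\ (forall v x, A (existT _ v x) -> c v = x).
pose P := [set A : set {v & X (sv v)} | forall l : seq J, exists c,
  agr A c /\ forall j, List.In j l -> sat (phi j) c].
have [|A [PA maxA]] := @Zorn_bigcup _ P.
  move=> F FP Ft l.
  have [[X0 FX0]|F0] := pselect (exists X0, F X0); last first.
    have [c [cD cl]] := fin l; exists c; split=> //; split=> // v x [Y FY].
    by exfalso; apply: F0; exists Y.
  (* For the union of a chain: the values at the finitely many coordinates of S are already assigned
     by a single member Y of the chain. *)
  have [S Sp] := supp_ex (fAndL [seq phi j | j <- l]).
  have [Y FY SY] : exists2 Y, F Y &
      forall v x, List.In v S -> (\bigcup_(Z in F) Z) (existT _ v x) -> Y (existT _ v x).
    elim: (S) => [|v T [Y FY IH]]; first by exists X0.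
    have [[x [Z FZ Zx]]|nx] :=
        pselect (exists x, (\bigcup_(Z in F) Z) (existT _ v x)); last first.
      exists Y => // w x [vw|] //; last exact: IH.
      by move=> h; exfalso; apply: nx; subst w; exists x.
    have uq x' : (\bigcup_(Z in F) Z) (existT _ v x') -> x' = x.
      move=> [Z' FZ' Z'x'].
      have [ZZ|ZZ] := Ft _ _ FZ FZ'.
        by have [c [[_ cZ] _]] := FP _ FZ' nil; rewrite -(cZ _ _ Z'x') -(cZ _ _ (ZZ _ Zx)).
      by have [c [[_ cZ] _]] := FP _ FZ nil; rewrite -(cZ _ _ (ZZ _ Z'x')) -(cZ _ _ Zx).
    have [YZ|ZY] := Ft _ _ FY FZ.
      exists Z => // w x' [vw|wT] h; last exact/YZ/IH.
      by subst w; rewrite (uq _ h); exact: Zx.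
    exists Y => // w x' [vw|wT] h; last exact: IH.
    by subst w; rewrite (uq _ h); exact: ZY.
  have [c0 [[c0D c0Y] c0l]] := FP _ FY l.
  have /dchoice : forall v, exists y, (D v -> y = a v) /\
      (forall x, (\bigcup_(Z in F) Z) (existT _ v x) -> y = x) /\
      (List.In v S -> y = c0 v).
    move=> v; have [[x [Z FZ Zx]]|nx] :=
        pselect (exists x, (\bigcup_(Z in F) Z) (existT _ v x)).
      exists x; split; [|split].
      - by move=> Dv; have [c [[cD cZ] _]] := FP _ FZ nil; rewrite -cD // -(cZ _ _ Zx).
      - move=> x' [Z' FZ' Z'x'].
        have [ZZ|ZZ] := Ft _ _ FZ FZ'.
          by have [c [[_ cZ] _]] := FP _ FZ' nil; rewrite -(cZ _ _ Z'x') -(cZ _ _ (ZZ _ Zx)).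
        by have [c [[_ cZ] _]] := FP _ FZ nil; rewrite -(cZ _ _ (ZZ _ Z'x')) -(cZ _ _ Zx).
      - by move=> vS; rewrite (c0Y v x) //; apply: SY => //; exists Z.
    exists (c0 v); split; [exact: c0D|split=> //] => x h.
    by exfalso; apply: nx; exists x.
  move=> [c cP]; exists c; split; [split|] => [v|v x h|j jl].
  - by have [] := cP v.
  - by have [_ [+ _]] := cP v; apply.
  - have : sat (fAndL [seq phi j | j <- l]) c.
      apply: (Sp _ c0); first by move=> v vS; have [_ [_ ->]] := cP v.
      by apply/sat_andL => p /List.in_map_iff[i [<-]]; exact: c0l.
    by move=> /sat_andL; apply; exact: List.in_map.
have AD v : D v -> A (existT _ v (a v)).
  move=> Dv; apply: contrapT => nA.
  apply: (maxA (A `|` [set existT _ v (a v)])).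
    rewrite properEneq; split; last by left.
    by apply/eqP => AE; apply: nA; rewrite AE; right.
  move=> l; have [c [[cD cA] cl]] := PA l; exists c; split=> //; split=> // w y.
  move=> [/cA//|e]; have e1 := projT1_eq e; rewrite /= in e1; subst w.
  by rewrite (existT_inj e) cD.
have Adom v : exists x, A (existT _ v x).
  apply: contrapT => nv.
  have nD : ~ D v by move=> /AD Av; apply: nv; exists (a v).
  have [b [[bD bA] _]] := PA nil.
  have /choice[S SP] : forall l, exists S, supp S (fAndL [seq phi j | j <- l]).
    by move=> l; exact: supp_ex.
  (* Variables with a prescribed value become parameters in [th l], and v stays free; only the
     others in the support are quantified away. *)
  pose fixd w := D w \/ (exists x, A (existT _ w x)) \/ w = v.
  pose T l := [seq w <- S l | ~~ `[< fixd w >]].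
  have inT l w : List.In w (T l) <-> List.In w (S l) /\ ~ fixd w.
    exact: In_filterN.
  pose th l := at_var v (fExs (T l) (fAndL [seq phi j | j <- l])).
  have [|x xth] := Xsat (b := b) (s := sv v) (p := range th) smallV.
    move=> q /finite_set_list[qs qsP] qth.
    have /list_choice[ll [llP _]] : forall p, List.In p qs -> exists l, p = th l.
      by move=> p /qsP /qth [l _ <-]; exists l.
    have [c [[cD cA] cl]] := PA (List.concat ll).
    exists (c v) => p /qsP /llP [l ll_l ->].
    apply/sat_at_var/sat_exs.
    exists (mix (fun w => List.In w (T l)) c (upd b (c v))); split.
      by move=> w wT; rewrite mixF.
    apply: (SP l _ c).
      move=> w wS; have [wT|wT] := pselect (List.In w (T l)); first by rewrite mixT.
      rewrite mixF //; have : fixd w.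
        by apply: contrapT => h; apply: wT; apply/inT.
      have [->|vw] := pselect (w = v); first by rewrite upd_eq.
      rewrite upd_ne; last by move=> ?; apply: vw.
      move=> [Dw|[[x Ax]|//]]; first by rewrite cD // bD.
      by rewrite (cA _ _ Ax) (bA _ _ Ax).
    apply/sat_andL => p' /List.in_map_iff[j [<- jl]]; apply: cl.
    by apply/List.in_concat; exists l.
  apply: (maxA (A `|` [set existT _ v x])).
    rewrite properEneq; split; last by left.
    by apply/eqP => AE; apply: nv; exists x; rewrite AE; right.
  move=> l; have /sat_at_var/sat_exs[c [cT cl]] : sat (th l) (econs b x).
    by apply: xth; exists l.
  exists c; split; [split=> [w Dw|w y [Aw|]]|].
  - rewrite cT; last by move=> /inT[_]; apply; left.
    by rewrite upd_ne ?bD // => vw; apply: nD; rewrite vw.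
  - rewrite cT; last by move=> /inT[_]; apply; right; left; exists y.
    rewrite upd_ne; first exact: bA.
    by move=> vw; apply: nv; rewrite vw; exists y.
  - move=> e; have e1 := projT1_eq e => /=; rewrite /= in e1; subst w.
    rewrite (existT_inj e) cT ?upd_eq //.
    by move=> /inT[_]; apply; right; right.
  - by move=> j jl; move/sat_andL: cl; apply; exact: List.in_map.
have [c cA] := dchoice Adom.
exists c; split=> [v Dv|j].
  by have [b [[bD bA] _]] := PA nil; rewrite -bD // (bA _ _ (cA v)).
have [b [[bD bA] /(_ j (or_introl erefl))]] := PA [:: j].
by apply: sat_ext => v; exact: bA.
Qed.
End Saturation.

Lemma no_inj_set T (f : set T -> T) : ~ injective f.
Proof.
move=> fI; pose D := [set x | exists2 A, x = f A & ~ A x].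
have [h|h] := pselect (D (f D)); last by apply: (h); exists D.
by have [A /fI AD nA] := h; apply: nA; rewrite -AD.
Qed.

(* Only finite nonempty subsets need a least element below, hence no          *)
(* transitivity of the order is ever used.                                    *)
Lemma choose_order (I : Type) : exists R : I -> I -> Prop,
  (forall i j, R i j -> R j i -> i = j) /\ (forall i j, i <> j -> R i j \/ R j i) /\
  forall A : set I, A !=set0 -> exists2 m, A m & forall i, A i -> R m i.
Proof.
elim/Peq : I => I; have [R Rwo] := well_ordering_principle I.
have minP (A : set I) : A !=set0 -> exists2 m, A m & forall i, A i -> R m i.
  move=> [i Ai]; have [|m [[mA mP] _]] := Rwo (mem A).
    by exists i; exact: mem_set.
  exists m => [|j Aj]; first exact: set_mem.
  by apply: mP; exact: mem_set.
exists (fun i j => R i j); split; [|split] => //.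
  move=> i j ij ji; have [|m [_ mu]] := Rwo [pred x in [:: i; j]].
    by exists i; rewrite !inE eqxx.
  have refl k : R k k.
    by have [|k' -> /(_ k)] := minP [set k]; [exists k|apply].
  rewrite -(mu i) ?(mu j) //; split; rewrite ?inE ?eqxx ?orbT // => k;
    by rewrite !inE => /orP[] /eqP ->.
move=> i j _; have [|m mij mP] := minP [set i; j]; first by exists i; left.
by case: mij mP => -> mP; [left; apply: mP; right|right; apply: mP; left].
Qed.

Section Pigeonhole.
Variables (L : signature) (X : structure L) (K : Type).
Hypothesis Klim : uncountable_strong_limit K.
Hypothesis Xsat : saturated X K.
Variables (V : Type) (sv : V -> lsort L).
Hypothesis smallV : small K V.

(** Let T be the type of classes of E. If no E-related pair realised Phi, saturation would give a
    family indexed by the subsets of T in which any two members, taken in the right order, realise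
    Phi and hence lie in distinct classes; this would embed the power set of T in T. *)
Lemma pigeonhole (E : env X sv -> env X sv -> Prop) (good : set (env X sv))
    (Phi : set (formula (vsum sv sv))) :
  equivalence E -> bounded_rel K E ->
  (forall l : seq (env X sv), (forall c, List.In c l -> good c) ->
     exists c, good c /\ forall c', List.In c' l -> realizes (epair c' c) Phi) ->
  exists c c', realizes (epair c c') Phi /\ E c c'.
Proof.
move=> [Erefl Esym Etrans] Ebdd ext; apply: contrapT => noE.
pose T := {x | classes E x}.
have sT : small K (set T) by apply: small_set => //; exact: card_lt_small.
have [R [Ranti [Rtot Rmin]]] := choose_order (set T).
pose sw := fun iv : set T * V => sv iv.2.
pose J := {t : set T * set T * formula (vsum sv sv) |
  [/\ R t.1.2 t.1.1, t.1.1 <> t.1.2 & Phi t.2]}.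
pose phi (j : J) : formula sw := subst (sval j).2
  (fun x => match x return term sw (vsum sv sv x) with
    | inl v => Var sw ((sval j).1.1, v) | inr v => Var sw ((sval j).1.2, v) end).
have satphi j (c : env X sw) : sat (phi j) c <->
    sat (sval j).2 (epair ((fun v => c ((sval j).1.1, v)) : env X sv)
                          ((fun v => c ((sval j).1.2, v)) : env X sv)).
  by rewrite /phi (propext (sat_subst _ _ _)); split; apply: sat_ext => -[].
have fin (l : seq (set T)) : exists f : set T -> env X sv,
    (forall i, List.In i l -> good (f i)) /\
    forall i j, List.In i l -> List.In j l -> R j i -> i <> j ->
      realizes (epair (f i) (f j)) Phi.
  have [c0 _] := ext nil (fun _ => False_ind _).
  have [n ln] := ubnP (size l); elim: n l ln => // n IH l ln.
  case: (l) ln => [|i0 l0] ln; first by exists (fun=> c0).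
  set ll := i0 :: l0 in ln *.
  (* Members are chosen from large indices to small ones: the least index m receives the last
     choice, which has to realise Phi with all earlier ones. *)
  have [|m ml mP] := Rmin (fun i => List.In i ll); first by exists i0; left.
  pose l' := [seq i <- ll | ~~ `[< i = m >]].
  have inl' i : List.In i l' <-> List.In i ll /\ i <> m.
    exact: (In_filterN (fun i => i = m)).
  have [|f' [f'g f'P]] := IH l'.
    rewrite -ltnS; apply: leq_trans ln; rewrite ltnS /l' size_filter.
    have : List.In m ll := ml; elim: (ll) => //= j k IHk [->|/IHk h].
      by rewrite asboolT //= add0n ltnS count_size.
    by case: asboolP => _ /=; rewrite ?add0n ?add1n ltnS // ltnW.
  have [|c [gc cP]] := ext [seq f' i | i <- l'].
    by move=> c /List.in_map_iff[i [<-]]; exact: f'g.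
  exists (fun i => if pselect (i = m) then c else f' i); split.
    by move=> i il; case: pselect => // im; apply: f'g; apply/inl'.
  move=> i j il jl ji ij; case: pselect => im.
    by exfalso; apply: ij; apply: Ranti => //; subst i; exact: mP.
  case: pselect => jm.
    by apply: cP; apply/List.in_map/inl'.
  by apply: f'P => //; apply/inl'.
have [c0 _] := ext nil (fun _ => False_ind _).
have sI : small K (set T * V) by exact: small_prod.
have [|c [_ cP]] := @saturation L X K Xsat _ sw sI set0 (fun iv => c0 iv.2) J phi.
  move=> l; have [f [_ fP]] := fin (List.concat [seq [:: (sval j).1.1; (sval j).1.2] | j <- l]).
  exists (fun iv => f iv.1 iv.2); split=> // j jl; apply/satphi.
  have [jR jne jPhi] := svalP j.
  apply: (fP (sval j).1.1 (sval j).1.2) => //.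
  - apply/List.in_concat; exists [:: (sval j).1.1; (sval j).1.2]; split; last by left.
    exact: (List.in_map (fun j : J => [:: (sval j).1.1; (sval j).1.2])).
  - apply/List.in_concat; exists [:: (sval j).1.1; (sval j).1.2]; split; last by right; left.
    exact: (List.in_map (fun j : J => [:: (sval j).1.1; (sval j).1.2])).
pose d i : env X sv := fun v => c (i, v).
have dE i j : i <> j -> ~ E (d i) (d j).
  wlog ji : i j / R j i => [H ij|ij].
    have [Rij|Rji] := Rtot _ _ ij; last exact: H.
    by move=> /Esym; apply: H => // /esym.
  move=> Eij; apply: noE; exists (d i), (d j); split=> // p pPhi.
  exact: (satphi (exist _ (i, j, p) (And3 ji ij pPhi)) c).1 (cP _).
apply: (@no_inj_set T (fun i => exist _ [set y | E (d i) y] (ex_intro2 _ _ (d i) I erefl))).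
move=> i j /(congr1 sval) /= eij; apply: contrapT => /dE; apply.
by have : [set y | E (d j) y] (d j) by []; rewrite -eij.
Qed.

(** If no finite list met all classes, every list could be extended by a tuple outside the classes
    of its members; [pigeonhole], with Phi the negation of the formula defining E, would then give
    an E-related pair that is not E-related. *)
Lemma definable_bounded_finite (E : env X sv -> env X sv -> Prop) :
  equivalence E -> definable0_rel E -> bounded_rel K E -> 
  exists l : seq (env X sv), forall a, exists2 c, List.In c l & E c a.
Proof.
move=> Eeq [p pP] Ebdd; apply: contrapT => /forallNP nl.
have [|c [c' [cc' Ecc']]] := pigeonhole (good := setT) (Phi := [set fNot p]) Eeq Ebdd.
  move=> l _; have /existsNP[c nc] := nl l; exists c; split=> // c' c'l q ->.
  by move=> /pP Ec; apply: nc; exists c'.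
by apply: (cc' (fNot p) erefl); exact/pP.
Qed.

End Pigeonhole.

(** * Countable elementary submodels *)

Section Isomorphism.
Variables (L : signature) (M N : structure L) (f : forall s, M s -> N s).
Hypothesis f_iso : is_iso f.

Lemma iso_eval V (sv : V -> lsort L) (a : env M sv) k (t : term sv k) :
  eval (emap f a) t = f (eval a t).
Proof.
have [_ ff _] := f_iso.
elim: t => //= g u IH; rewrite ff; congr fint.
by apply: functional_extensionality_dep => i; exact: IH.
Qed.

Lemma iso_elementary : elementary f.
Proof.
have [fb _ fr] := f_iso => V sv p; elim: p => {V sv} /=.
- move=> V sv k t u a; rewrite !iso_eval; split => [->//|].
  by apply: bij_inj; exact: fb.
- move=> V sv r t a; rewrite (fr r).
  suff -> : (fun i => f (eval a (t i))) = (fun i => eval (emap f a) (t i)) by [].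
  by apply: functional_extensionality_dep => i; rewrite iso_eval.
- by [].
- by move=> V sv p IHp q IHq a; rewrite (propext (IHp a)) (propext (IHq a)).
- move=> V sv k p IH a.
  have E x : emap f (econs a x) = econs (emap f a) (f x).
    by apply: functional_extensionality_dep => -[].
  split => H x; last by apply: (IH _).2; rewrite E; exact: H.
  by have [g _ gK] := fb k; rewrite -(gK x) -E; apply: (IH _).1; exact: H.
Qed.

End Isomorphism.

Section TarskiVaught.
Variables (L : signature) (C : structure L) (S : forall s, set (C s)).
Hypothesis TV : forall V (sv : V -> lsort L) s (p : formula (vext sv s))
  (a : env C sv), (forall v, S (a v)) -> (exists x, sat p (econs a x)) ->
  exists x, S x /\ sat p (econs a x).

(** The test for the formula f(x) = y gives closure under function symbols, and the test for a true
    formula gives nonempty sorts; so S carries a substructure. *)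
Lemma tarski_vaught : exists (N : structure L) (f : forall s, N s -> C s),
  [/\ elementary f, forall s, injective (f s) &
      forall s x, S x <-> exists y, f s y = x].
Proof.
have Sf (k : fsym L) (a : forall i : fargs k, {x : C (fdom i) | S x}) :
    S (fint (fun i => sval (a i))).
  have [||x [Sx /= e]] := @TV (fargs k) (@fdom L k) (fcod k)
    (@Equ L _ (vext (@fdom L k) (fcod k)) (fcod k)
       (@App L _ (vext (@fdom L k) (fcod k)) k (fun i => Var _ (Some i)))
       (Var _ None)) (fun i => sval (a i)).
  - by move=> i; exact: svalP.
  - by eexists; rewrite /=.
  - by rewrite e.
have Si s : inhabited {x : C s | S x}.
  have [||x [Sx _]] := @TV void (@no_var L) s (fNot (Bot _)) (fun v => match v with end).
  - by case.
  - by case: (inhab C s) => x; exists x.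
  by exists; exists x.
pose N := @Structure L (fun s => {x : C s | S x})
  (fun k a => exist _ _ (Sf k a)) (fun r a => @rint L C r (fun i => sval (a i))) Si.
pose f s (x : N s) : C s := sval x.
exists N, f; split; last 1 first.
- move=> s x; split=> [Sx|[[y Sy] <-]//].
  by exists (exist _ x Sx).
- have fe V (sv : V -> lsort L) (a : env N sv) k (t : term sv k) :
      f _ (eval a t) = eval (emap f a) t.
    elim: t => //= g u IH; congr fint.
    by apply: functional_extensionality_dep => i; exact: IH.
  move=> V sv p; elim: p => {V sv} /=.
  + move=> V sv k t u a; rewrite -!fe; split => [->//|]; exact: sval_inj.
  + move=> V sv r t a.
    suff -> : (fun i => sval (eval a (t i))) = (fun i => eval (emap f a) (t i)) by [].
    by apply: functional_extensionality_dep => i; rewrite -fe.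
  + by [].
  + by move=> V sv p IHp q IHq a; rewrite (propext (IHp a)) (propext (IHq a)).
  + move=> V sv k p IH a.
    have E x : emap f (econs a x) = econs (emap f a) (f k x).
      by apply: functional_extensionality_dep => -[].
    split => H x; last by apply: (IH _).2; rewrite E; exact: H.
    apply: contrapT => np.
    have [||y [Sy]] := @TV V sv k (fNot p) (emap f a).
    * by move=> v; exact: (svalP (a v)).
    * by exists x.
    apply; have := H (exist _ y Sy); rewrite (propext (IH _)).
    by rewrite E.
- by move=> s; exact: sval_inj.
Qed.

End TarskiVaught.

Lemma dependent_choice (T : Type) (P : nat -> T -> Prop)
    (R : nat -> T -> T -> Prop) (x0 : T) : P 0 x0 ->
  (forall n x, P n x -> exists y, P n.+1 y /\ R n x y) ->
  exists f : nat -> T, f 0 = x0 /\ forall n, P n (f n) /\ R n (f n) (f n.+1).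
Proof.
move=> P0 step.
have step' (nx : {nx : nat * T | P nx.1 nx.2}) :
    {y | P (sval nx).1.+1 y /\ R (sval nx).1 (sval nx).2 y}.
  by apply: cid; apply: step; exact: (svalP nx).
pose g nx : {nx : nat * T | P nx.1 nx.2} :=
  exist (fun nx => P nx.1 nx.2) ((sval nx).1.+1, sval (step' nx)) (proj1 (svalP (step' nx))).
pose h n := iter n g (exist (fun nx => P nx.1 nx.2) (0, x0) P0).
have h1 n : (sval (h n)).1 = n by elim: n => //= n ->.
exists (fun n => (sval (h n)).2); split=> // n; split.
  by have := svalP (h n); rewrite h1.
by rewrite /= /g /= -/(h n) -{1}(h1 n); case: (step' _) => y [].
Qed.

Lemma infinitely_often : exists d : nat -> nat * nat,
  forall t n0, exists2 n, n0 <= n & d n = t.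
Proof.
exists (fun n => odflt (0, 0) (unpickle (logn 2 n))) => t n0.
(* The odd factor makes the number at least n0 without changing the exponent of 2, which codes the
   pair t. *)
exists (2 ^ pickle t * n0.*2.+1).
  apply: leq_trans (leq_pmull _ _); last by rewrite expn_gt0.
  by rewrite -addnn -addnS leq_addr.
rewrite lognM ?expn_gt0 // pfactorK // logn_coprime ?addn0 ?pickleK //.
by rewrite coprime2n /= odd_double.
Qed.

Lemma countable_sum T U : countable [set: T] -> countable [set: U] ->
  countable [set: T + U].
Proof.
move=> /inj_leP[f fI] /inj_leP[g gI]; apply/inj_leP.
exists (fun x => pickle (match x with inl a => inl (f a) | inr b => inr (g b) end : nat + nat)).
by move=> [x|x] [y|y] /(pcan_inj (@pickleK _)) [] // => [/fI->|/gI->].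
Qed.

Lemma countable_option T : countable [set: T] -> countable [set: option T].
Proof.
move=> /inj_leP[f fI]; apply/inj_leP.
exists (fun x => if x is Some a then (f a).+1 else 0).
by move=> [x|] [y|] // [/fI->].
Qed.

Lemma countable_countType (T : countType) : countable [set: T].
Proof. exact: countableP. Qed.

Section Submodels.
Variables (L : signature) (M C : structure L) (emb : forall s, M s -> C s).
Hypothesis emb_elem : elementary emb.
Hypothesis Mcount : countable_structure M.
Hypothesis Mcat : omega_categorical M.

Lemma countable_lang : countable_language L.
Proof. by case: Mcount. Qed.

Section Build.
Variables (V0 : Type) (sv0 : V0 -> lsort L) (a : env C sv0).
Hypothesis cV0 : countable [set: V0].
Variables (eS : nat -> lsort L) (d : nat -> nat * nat).
Hypothesis eSP : forall s, exists n, eS n = s.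
Hypothesis dP : forall t n0, exists2 n, n0 <= n & d n = t.

(** Stage n of the construction adds one element: the pair [d n] consists of the index of its sort
    and the index of the formula that it should witness. *)
Definition seq_sort n := eS (d n).1.
Definition seq_ctx := vsum sv0 seq_sort.

Definition before n s (p : formula (vext seq_ctx s)) :=
  exists l, supp l p /\ forall m, List.In (Some (inr m)) l -> m < n.

Variable Good : nat -> env C seq_sort -> Prop.
Hypothesis Good0 : exists c, Good 0 c.
Hypothesis Good_ext : forall n c c', (forall m, m < n -> c m = c' m) ->
  Good n c -> Good n c'.
Hypothesis Good_step : forall n c (p : formula (vext seq_ctx (seq_sort n))),
  Good n c -> before n p -> (exists y, sat p (econs (epair a c) y)) ->
  exists y, Good n.+1 (upd c y) /\ sat p (econs (epair a c) y).

Lemma countable_ctx : countable [set: V0 + nat].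
Proof. by apply: countable_sum => //; exact: countable_countType. Qed.

(** A Henkin construction. A formula can be treated only after the stages of its parameters; as d
    takes each value arbitrarily late, such a stage exists. [Good] is a property of initial segments
    that is maintained throughout. *)
Lemma build : exists c : env C seq_sort, (forall n, Good n c) /\
  forall s (p : formula (vext seq_ctx s)),
    (exists y, sat p (econs (epair a c) y)) ->
    exists n (x : C s), sat p (econs (epair a c) x) /\
      existT (fun s => C s) s x = existT _ (seq_sort n) (c n).
Proof.
have /dchoice[e eP] : forall s, exists e : nat -> formula (vext seq_ctx s),
    forall p, exists n, e n = p.
  move=> s; apply: countable_enum (Bot _).
  apply: formula_countable; first exact: countable_lang.
  exact/countable_option/countable_ctx.
pose task n : formula (vext seq_ctx (seq_sort n)) := e _ (d n).2.
have [c0 c0G] := Good0.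
have [|f [_ fP]] := @dependent_choice (env C seq_sort) Good
    (fun n c c' => (forall m, m < n -> c' m = c m) /\
       (before n (task n) -> (exists y, sat (task n) (econs (epair a c) y)) ->
        sat (task n) (econs (epair a c) (c' n)))) c0 c0G.
  move=> n c cG.
  have neq m : m < n -> n <> m by move=> mn nm; rewrite nm ltnn in mn.
  have [[tn ty]|nt] := pselect (before n (task n) /\
      exists y, sat (task n) (econs (epair a c) y)).
    have [y [yG ys]] := Good_step cG tn ty.
    exists (upd c y); split=> //; split=> [m mn|_ _]; last by rewrite upd_eq.
    by rewrite upd_ne //; exact: neq.
  have [y [yG _]] : exists y, Good n.+1 (upd c y) /\
      sat (fNot (Bot (vext seq_ctx (seq_sort n)))) (econs (epair a c) y).
    apply: Good_step cG _ _; first by exists nil; split=> // N b b' _ _.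
    by case: (inhab C (seq_sort n)) => y; exists y.
  exists (upd c y); split=> //; split=> [m mn|? ?]; last by exfalso; apply: nt.
  by rewrite upd_ne //; exact: neq.
pose c : env C seq_sort := fun m => f m.+1 m.
have fst n m : m < n -> f n m = c m.
  elim: n => // n IH; rewrite ltnS leq_eqVlt => /predU1P[->//|mn].
  by have [_ [fn _]] := fP n; rewrite fn //; exact: IH.
exists c; split=> [n|s p py].
  by apply: Good_ext (proj1 (fP n)) => m; exact: fst.
have [i ei] := eSP s; subst s; have [j ej] := eP _ p.
have [l lp] := supp_ex p.
have [n0 n0l] : exists n0, forall m, List.In (Some (inr m)) l -> m < n0.
  elim: l {lp} => [|x l [n0 IH]]; first by exists 0.
  exists (maxn n0 (if x is Some (inr m) then m.+1 else 0)) => m [->|/IH h].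
    by rewrite leq_max ltnSn orbT.
  by rewrite leq_max h.
have [n n0n dn] := dP (i, j) n0.
have ei : i = (d n).1 by rewrite dn.
have ej' : j = (d n).2 by rewrite dn.
subst j => {dn}; subst i.
exists n, (c n); split=> //.
have bn : before n p by exists l; split=> // m /n0l h; exact: leq_trans n0n.
have agr x : sat p (econs (epair a (f n)) x) <-> sat p (econs (epair a c) x).
  apply: supp_iff lp _ => -[[v|m]|] //= /n0l mn.
  by apply: fst; exact: leq_trans n0n.
have [_ [_]] := fP n; rewrite /task ej.
move=> /(_ bn) H; apply/agr/H.
by have [y yp] := py; exists y; exact/agr.
Qed.

(** The values of a and c pass the Tarski-Vaught test, and by omega-categoricity the countable
    elementary submodel that they form is a copy of M. *)
Lemma countable_submodel : exists c : env C seq_sort, (forall n, Good n c) /\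
  exists g : forall s, M s -> C s, elementary g /\
    forall s x, (exists y, g s y = x) <->
      exists z, existT (fun s => C s) s x = existT _ (seq_ctx z) (epair a c z).
Proof.
have [c [cG cP]] := build; exists c; split=> //.
pose S s := [set x | exists z, existT (fun s => C s) s x = existT _ (seq_ctx z) (epair a c z)].
have [|N [f [fe fI fS]]] := @tarski_vaught L C S.
  move=> V sv s p b bS [x px].
  have /dchoice[tau tauP] : forall v, exists t : term seq_ctx (sv v),
      eval (epair a c) t = b v.
    move=> v; have [z zP] := bS v.
    have : forall w : {s & C s}, w = existT (fun s => C s) (seq_ctx z) (epair a c z) ->
        exists t : term seq_ctx (projT1 w), eval (epair a c) t = projT2 w.
      by move=> w ->; exists (Var seq_ctx z).
    by move/(_ _ zP).
  pose q := subst p (fun o => match o return term (vext seq_ctx s) (vext sv s o) with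
    | Some v => tsubst (fun z => Var (vext seq_ctx s) (Some z)) (tau v)
    | None => Var (vext seq_ctx s) None end).
  have qP y : sat q (econs (epair a c) y) <-> sat p (econs b y).
    rewrite /q (propext (sat_subst _ _ _)).
    by split; apply: sat_ext => -[v|] //=; rewrite eval_tsubst /= tauP.
  have [|n [y [yq yn]]] := cP s q; first by exists x; apply/qP.
  by exists y; split; [exists (inr n)|apply/qP].
have cN : countable [set: {s & N s}].
  have : forall w : {s & N s}, exists z, existT (fun s => C s) (projT1 w) (f _ (projT2 w)) =
      existT _ (seq_ctx z) (epair a c z).
    by move=> [s y]; apply/(fS s); exists y.
  move=> /choice[h hP]; have /inj_leP[k kI] := countable_ctx.
  apply/inj_leP; exists (k \o h) => -[s y] [s' y'] /kI hh.
  have := hP (existT _ s y); rewrite hh -hP /= => e.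
  have ss := projT1_eq e; rewrite /= in ss; subst s'.
  by rewrite (fI _ _ _ (existT_inj e)).
have MN : elementarily_equivalent M N.
  move=> p b b'; rewrite (propext (emb_elem p b)) (propext (fe _ _ p b')).
  by split; apply: sat_ext => -[].
have [h hiso] := Mcat cN MN.
exists (fun s x => f s (h s x)); split.
  exact: elementary_comp (iso_elementary hiso) fe.
move=> s x; rewrite -[X in _ <-> X]/(S s x) (propext (fS s x)).
split=> [[y <-]|[y <-]]; first by exists (h s y).
by have [hb _ _] := hiso; have [k _ kK] := hb s; exists (k y); rewrite kK.
Qed.

End Build.
End Submodels.

(** * Isolated types *)

Section Isolated.
Variables (L : signature) (C : structure L) (V : Type) (sv : V -> lsort L).

Definition isolates (S : seq V) (chi : formula sv) (a : env C sv) :=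
  [/\ supp S chi, sat chi a &
      forall b : env C sv, sat chi b -> forall p, supp S p -> sat p a <-> sat p b].

Definition isolated S a := exists chi, isolates S chi a.

Lemma isolates_ext S chi (a b : env C sv) :
  (forall p, supp S p -> sat p a -> sat p b) ->
  isolates S chi a -> isolates S chi b.
Proof.
move=> ab [Schi chia H]; have chib := ab _ Schi chia.
by split=> // c chic p Sp; rewrite -(propext (H _ chib p Sp)); exact: H.
Qed.

Lemma isolated_ext S (a b : env C sv) :
  (forall v, List.In v S -> a v = b v) -> isolated S a -> isolated S b.
Proof.
move=> ab [chi chiP]; exists chi; apply: isolates_ext chiP => p Sp.
exact: Sp.
Qed.

End Isolated.

Section Types.
Variables (L : signature) (M C : structure L) (emb : forall s, M s -> C s).
Hypothesis emb_elem : elementary emb.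
Hypothesis Mcount : countable_structure M.
Hypothesis Mcat : omega_categorical M.
Variable K : Type.
Hypothesis Klim : uncountable_strong_limit K.
Hypothesis Csat : saturated C K.

(** A countable tuple of C lies in a countable elementary submodel, which is a copy of M. *)
Lemma type_realized V (sv : V -> lsort L) (a : env C sv) :
  countable [set: V] -> exists a' : env M sv, forall p, sat p a' <-> sat p a.
Proof.
move=> cV; have [[v0]|nV] := pselect (inhabited V); last first.
  have nV' (v : V) : False by apply: nV.
  exists (fun v => False_rect _ (nV' v)) => p; rewrite (propext (emb_elem _ _)).
  by split; apply: sat_ext => v; case: (nV' v).
have [eS eSP] := countable_enum (let: And4 h _ _ _ := Mcount in h) (sv v0).
have [d dP] := infinitely_often.
have [|//||c [_ [g [ge gP]]]] := countable_submodel (a := a) emb_elem Mcount Mcat cV eSP dP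
  (Good := fun _ _ => True).
- have /dchoice[c _] : forall n, exists x : C (seq_sort eS d n), True.
    by move=> n; case: (inhab C (seq_sort eS d n)) => x; exists x.
  by exists c.
- by move=> n c p _ _ [y py]; exists y.
have /dchoice[a' a'P] : forall v, exists x : M (sv v), g _ x = a v.
  by move=> v; apply/gP; exists (inl v).
exists a' => p; rewrite (propext (ge _ _ p a')).
by split; apply: sat_ext => v; rewrite /emap a'P.
Qed.

(** An omitting types argument. If no tuple satisfying phi had an isolated type on S, one could form
    a decreasing sequence of consistent formulas whose n-th step excludes the n-th tuple of M.
    Saturation realises the whole sequence in C, and [type_realized] moves the realisation into M,
    where it has been excluded. *)
Lemma isolated_dense V (sv : V -> lsort L) (S : seq V) (phi : formula sv)
    (b0 : env C sv) : countable [set: V] -> supp S phi -> sat phi b0 ->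
  exists b : env C sv, sat phi b /\ isolated S b.
Proof.
move=> cV Sphi phib0; apply: contrapT => /forallNP noiso.
have [e eP] : exists e : nat -> env M sv,
    forall a, exists n, forall v, List.In v S -> e n v = a v.
  have [_ _ _ /inj_leP[k kI]] := Mcount.
  have [a0 _] := type_realized b0 cV.
  have /dchoice[e eP] : forall n, exists a : env M sv, forall a',
      pickle [seq k (existT (fun s => M s) (sv v) (a' v)) | v <- S] = n ->
      forall v, List.In v S -> a v = a' v.
    move=> n; have [[a aP]|na] := pselect (exists a : env M sv,
      pickle [seq k (existT (fun s => M s) (sv v) (a v)) | v <- S] = n); last first.
      by exists a0 => a' a'n; exfalso; apply: na; exists a'.
    exists a => a'; rewrite -aP => /(pcan_inj (@pickleK _)).
    elim: (S) => //= w T IH [/kI e /IH h] v [vw|]; last exact: h.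
    by subst w; apply/esym; exact: existT_inj e.
  by exists e => a; eexists => v vS; exact: eP.
pose P (n : nat) (chi : formula sv) := [/\ supp S chi, exists b : env C sv, sat chi b &
  forall b : env C sv, sat chi b -> sat phi b].
pose R (n : nat) (chi chi' : formula sv) :=
  (forall b : env C sv, sat chi' b -> sat chi b) /\ ~ sat chi' (emap emb (e n)).
have [||f [_ fP]] := @dependent_choice _ P R phi.
- by split=> //; exists b0.
- move=> n chi [Schi [b chib] chiphi].
  (* As chi does not isolate the type of b, some p splits chi; whichever of p and its negation fails
     at [e n] is added to chi. *)
  have [b2 [p [Sp chib2 pb npb2]]] : exists (b2 : env C sv) p, [/\ supp S p, sat chi b2, sat p b & ~ sat p b2].
    apply: contrapT => H; apply: (noiso b); split; first exact: chiphi.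
    exists chi; split=> // b2 chib2 p Sp; split=> [pb|pb2]; apply: contrapT => np; apply: H.
      by exists b2, p.
    by exists b2, (fNot p); split=> //; [exact: supp_not|move/sat_not].
  have [pe|npe] := pselect (sat p (emap emb (e n))).
    exists (fAnd chi (fNot p)); split; split=> //.
    + by apply: supp_and => //; exact: supp_not.
    + by exists b2; apply/sat_and.
    + by move=> b' /sat_and[/chiphi].
    + by move=> b' /sat_and[].
    + by move=> /sat_and[_]; exact.
  exists (fAnd chi p); split; split=> //.
  + exact: supp_and.
  + by exists b; apply/sat_and.
  + by move=> b' /sat_and[/chiphi].
  + by move=> b' /sat_and[].
  + by move=> /sat_and[_].
have fle m n b : m <= n -> sat (f n) b -> sat (f m) (b : env C sv).
  elim: n => [|n IH]; first by rewrite leqn0 => /eqP ->.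
  rewrite leq_eqVlt ltnS => /predU1P[->//|mn] h; apply: IH => //.
  by have [_ [+ _]] := fP n; exact.
have [l|c [_ cP]] := saturation Csat (small_countable Klim cV) (D := set0) (a := b0) (phi := f).
  have [N NP] : exists N, forall m, List.In m l -> m <= N.
    elim: l => [|m l [N IH]]; first by exists 0.
    exists (maxn m N) => k [->|/IH h]; first by rewrite leq_maxl.
    by rewrite leq_max h orbT.
  have [[_ [b fb] _] _] := fP N; exists b; split=> // j /NP jN; exact: fle fb.
have [a' a'P] := type_realized c cV.
have [n en] := eP a'.
have [_ [_]] := fP n; apply.
have [Sf _ _] := proj1 (fP n.+1).
by rewrite -(propext (emb_elem _ _)); apply: (Sf _ a'); [move=> v /en|apply/a'P].
Qed.

Lemma supp_at_name V (sv : V -> lsort L) v l (p : formula (vext sv (sv v))) :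
  supp l p -> supp (v :: pmap id l) (at_name p).
Proof.
move=> lp N a b ab /sat_at_name pa; apply/sat_at_name; apply: lp pa => -[w|] wl /=.
  apply: ab; right; elim: l wl => //= -[x|] l IH [] // => [[->]|/IH]; first by left.
  by right.
by apply: ab; left.
Qed.

Lemma supp_ex_at V (sv : V -> lsort L) v S S' (p : formula sv) :
  (forall w, List.In w S -> w = v \/ List.In w S') ->
  supp S p -> supp S' (fEx (at_var v p)).
Proof.
move=> SS Sp N a b ab /sat_ex[x /sat_at_var px].
apply/sat_ex; exists x; apply/sat_at_var; apply: Sp px => w /SS[->|/ab abw].
  by rewrite !upd_eq.
have [<-|vw] := pselect (v = w); first by rewrite !upd_eq.
by rewrite !upd_ne.
Qed.

Lemma upd_self (N : structure L) V (sv : V -> lsort L) (a : env N sv) v w :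
  upd a (a v) w = a w.
Proof.
by have [<-|vw] := pselect (v = w); [rewrite upd_eq|rewrite upd_ne].
Qed.

Lemma upd_epair (N : structure L) V W (sv : V -> lsort L) (sw : W -> lsort L)
    (a : env N sv) (c : env N sw) n (x : N (sw n)) w :
  epair a (upd c x) w = upd (epair a c) (v := inr n) x w.
Proof.
case: w => [v|m] /=; first by rewrite upd_ne.
have [<-|nm] := pselect (n = m); first by rewrite upd_eq (upd_eq (epair a c) (v := inr n)).
by rewrite upd_ne // upd_ne // => -[].
Qed.

(** The submodel construction is run with all initial segments of c having isolated types. To
    witness p, [isolated_dense] finds an isolated type for some tuple satisfying p and the isolating
    formula chi of the segment built so far; chi carries this type over to the actual segment. *)
Lemma atomic_model (s0 : lsort L) : exists (sw : nat -> lsort L)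
    (c : env C (vsum (@no_var L) sw)) (g : forall s, M s -> C s),
  [/\ forall n, isolated [seq inr m | m <- iota 0 n] c, elementary g &
      forall s y, exists m, existT (fun s => C s) s (g s y) = existT _ (sw m) (c (inr m))].
Proof.
have [eS eSP] := countable_enum (let: And4 h _ _ _ := Mcount in h) s0.
have [d dP] := infinitely_often.
pose sw := seq_sort eS d; pose ctx := vsum (@no_var L) sw.
pose T n : seq (void + nat) := [seq inr m | m <- iota 0 n].
have inT n m : List.In (inr m) (T n) <-> m < n.
  rewrite List.in_map_iff.
  have -> : (m < n) = (m \in iota 0 n) by rewrite mem_iota.
  elim: (iota 0 n) => [|k l IH]; first by split=> // -[] ? [].
  rewrite inE; split=> [[j [[->] [->|jl]]]|/predU1P[->|]].
  - by rewrite eqxx.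
  - by apply/orP; right; apply/IH; exists m.
  - by exists k; split=> //; left.
  - by move=> /IH[j [jm jl]]; exists j; split=> //; right.
pose a0 : env C (@no_var L) := fun v => match v with end.
have cctx : countable [set: void + nat].
  by apply: countable_sum; exact: countable_countType.
have [|||c [cG [g [ge gP]]]] := countable_submodel (a := a0) emb_elem Mcount Mcat
    (countable_countType _) eSP dP (Good := fun n c => isolated (T n) (epair a0 c)).
- have /dchoice[c _] : forall n, exists x : C (sw n), True.
    by move=> n; case: (inhab C (sw n)) => x; exists x.
  have [||b [_ biso]] := @isolated_dense _ ctx [::] (fNot (Bot _)) (epair a0 c) cctx.
  + exact: supp_true.
  + exact: sat_true.
  by exists c; apply: isolated_ext biso.
- by move=> n c c' cc'; apply: isolated_ext => -[//|m] /inT /cc'.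
- move=> n c p [chi chiP] [l [lp lb]] [y py].
  have Tsub z : List.In z (T n) -> List.In z (T n.+1).
    by case: z => // m /inT mn; apply/inT; exact: ltnW.
  have Tn z : List.In z (T n.+1) -> z = inr n \/ List.In z (T n).
    case: z => // m /inT; rewrite ltnS leq_eqVlt => /predU1P[->|mn]; first by left.
    by right; apply/inT.
  have [Schi chic chiall] := chiP.
  pose pn : formula ctx := @at_name L _ ctx (inr n) p.
  have Spn : supp (T n.+1) pn.
    apply: supp_sub (@supp_at_name _ ctx (inr n) l p lp) => z [<-|zl]; first exact/inT.
    case: z zl => // m ml; apply/inT; apply: ltnW; apply: lb.
    by elim: (l) ml => //= -[z|] l' IH; [move=> [->|/IH]; [left|right]|move=> /IH; right].
  have neq m : m < n -> n <> m by move=> mn nm; rewrite nm ltnn in mn.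
  have lagr x (e : env C ctx) : (forall m, m < n -> e (inr m) = c m) ->
      sat p (econs e x) <-> sat p (econs (epair a0 c) x).
    move=> ec; apply: supp_iff lp _ => -[[//|m]|//] /lb /ec /=; exact.
  have [||b [/sat_and[chib pnb] [xi [Sxi xib xiall]]]] :=
      @isolated_dense _ ctx (T n.+1) (fAnd chi pn) (epair a0 (upd c y)) cctx.
  + by apply: supp_and => //; apply: supp_sub Schi.
  + apply/sat_and; split.
      by apply: Schi chic => -[//|m] /inT mn /=; rewrite upd_ne //; exact: neq.
    apply/sat_at_name; rewrite /= upd_eq; apply/lagr => // m mn /=.
    by rewrite upd_ne //; exact: neq.
  (* The tuple b may differ from c before stage n too; since both satisfy chi, a suitable n-th
     coordinate exists for c as well. *)
  have : sat (fEx (at_var (inr n) xi)) (epair a0 c).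
    apply/(chiall b chib); first exact: supp_ex_at Sxi.
    apply/sat_ex; exists (b (inr n)); apply/sat_at_var.
    by apply: sat_ext xib => w; rewrite upd_self.
  move=> /sat_ex[x /sat_at_var xix].
  have {}xix : sat xi (epair a0 (upd c x)).
    by apply: sat_ext xix => w; rewrite upd_epair.
  exists x; split.
    exists xi; split=> // b' xib' q Sq.
    by rewrite -(propext (xiall _ xix _ Sq)); exact: xiall.
  have := (xiall _ xix _ Spn).1 pnb; move=> /sat_at_name /=.
  rewrite upd_eq; move/lagr; apply=> m mn /=.
  by rewrite upd_ne //; exact: neq.
exists sw, (epair a0 c), g; split=> // s y.
by have [[[]|m] e] := (gP s (g s y)).1 (ex_intro _ y erefl); exists m.
Qed.

(** Part of the Ryll-Nardzewski theorem. The type of a is realised in M, and M embeds as an atomic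
    model; so one may assume that the coordinates in S belong to an initial segment with isolated
    type. Projecting its isolating formula to these coordinates isolates the type of a. *)
Lemma finite_tuple_isolated V (sv : V -> lsort L) (S : seq V) (a : env C sv) :
  countable [set: V] -> (forall s, exists v, sv v = s) -> isolated S a.
Proof.
move=> cV svS; have [[v0]|nV] := pselect (inhabited V); last first.
  have nV' (v : V) : False by apply: nV.
  exists (fNot (Bot _)); split=> // b _ p Sp.
  by split; apply: sat_ext => v; case: (nV' v).
have [sw [c [g [cG ge gP]]]] := atomic_model (sv v0).
have [a' a'P] := type_realized a cV.
suff : isolated S (emap g a').
  move=> [chi chiP]; exists chi; apply: isolates_ext chiP => p _.
  by move=> /ge/a'P.
pose ctx := vsum (@no_var L) sw.
have /dchoice[tau tauP] : forall v, exists t : term ctx (sv v),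
    eval c t = g _ (a' v) /\ exists m, forall (N : structure L) (b b' : env N ctx),
      b (inr m) = b' (inr m) -> eval b t = eval b' t.
  move=> v; have [m mP] := gP _ (a' v).
  have : forall w : {s & C s}, w = existT (fun s => C s) (sw m) (c (inr m)) ->
      exists t : term ctx (projT1 w), eval c t = projT2 w /\
      exists m, forall (N : structure L) (b b' : env N ctx), b (inr m) = b' (inr m) -> eval b t = eval b' t.
    by move=> w ->; exists (Var ctx (inr m)); split=> //; exists m.
  by move/(_ _ mP).
have [n nP] : exists n, forall v, List.In v S -> forall (N : structure L) (b b' : env N ctx),
    (forall z, List.In z [seq inr m | m <- iota 0 n] -> b z = b' z) ->
    eval b (tau v) = eval b' (tau v).
  have inT n m : m < n -> List.In (inr m : void + nat) [seq inr m | m <- iota 0 n].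
    move=> mn; apply: List.in_map; have : m \in iota 0 n by rewrite mem_iota.
    by elim: (iota 0 n) => //= k l IH; rewrite inE => /predU1P[->|/IH]; [left|right].
  elim: S => [|v S' [n IH]]; first by exists 0.
  have [_ [m mP]] := tauP v; exists (maxn n m.+1) => w [<-|/IH h] N b b' bb'.
    by apply: mP; apply: bb'; apply: inT; rewrite leq_max ltnSn orbT.
  apply: h => -[//|k] kT; apply: bb'; apply: inT; rewrite leq_max.
  move: kT => /List.in_map_iff[j [[->] jl]].
  have : k \in iota 0 n.
    by elim: (iota 0 n) jl => //= i l IHl; rewrite inE => -[->|/IHl ->]; rewrite ?eqxx ?orbT.
  by rewrite mem_iota /= => ->.
have [chi [Schi chic chiall]] := cG n.
pose T : seq (void + nat) := [seq inr m | m <- iota 0 n].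
pose W := vsum sv ctx.
pose up s (t : term ctx s) : term W s := tsubst (fun z => Var W (inr z)) t.
pose body : formula W := fAnd (subst chi (fun z => Var W (inr z)))
  (fAndL [seq Equ (Var W (inl v)) (up _ (tau v)) | v <- S]).
(* Every variable of the segment needs a term in the context of a, although those in T get bound;
   such terms exist because every sort occurs in sv. *)
have /dchoice[rho _] : forall z : void + nat, exists t : term sv (ctx z), True.
  by move=> z; have [v <-] := svS (ctx z); exists (Var sv v).
pose psi : formula sv := subst (fExs [seq inr z | z <- T] body)
  (fun x => match x return term sv (W x) with inl v => Var sv v | inr z => rho z end).
have psiP (N : structure L) (b : env N sv) : sat psi b <-> exists e : env N ctx, sat chi e /\
    forall v, List.In v S -> b v = eval e (tau v).
  pose B : env N W := fun x => match x return N (W x) with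
    inl v => b v | inr z => eval b (rho z) end.
  have -> : sat psi b <-> sat (fExs [seq inr z | z <- T] body) B.
    by rewrite /psi (propext (sat_subst _ _ _)); split; apply: sat_ext => -[].
  rewrite (propext (sat_exs _ _ _)); split.
    move=> [b' [b'B /sat_and[/sat_subst b'chi /sat_andL b'eq]]].
    exists (fun z => b' (inr z)); split=> // v vS.
    have := b'eq _ (List.in_map (fun v => Equ (Var W (inl v)) (up _ (tau v))) _ _ vS).
    rewrite /= eval_tsubst b'B // => /List.in_map_iff[? []] //.
  move=> [e [echi eb]].
  pose e' : env N ctx := mix (fun z => List.In z T) e (fun z => eval b (rho z)).
  have e'T z : List.In z T -> e z = e' z by move=> zT; rewrite /e' mixT.
  exists (epair b e'); split.
    move=> [v|z] // nz; rewrite /= /e' mixF // => zT; apply: nz.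
    exact: List.in_map.
  apply/sat_and; split; first by apply/sat_subst; exact: Schi e'T echi.
  apply/sat_andL => p /List.in_map_iff[v [<- vS]] /=.
  by rewrite eval_tsubst eb //; apply: nP.
exists psi; split.
- move=> N b b' bb' /psiP[e [echi eb]]; apply/psiP; exists e; split=> // v vS.
  by rewrite -bb' // eb.
- by apply/psiP; exists c; split=> // v vS; have [-> _] := tauP v.
- move=> b /psiP[e [echi eb]] p Sp.
  have pE (f : env C sv) (e0 : env C ctx) : (forall v, List.In v S -> f v = eval e0 (tau v)) ->
      sat p f <-> sat (subst p tau) e0.
    move=> fe; rewrite (propext (sat_subst _ _ _)); exact: supp_iff Sp _.
  rewrite (propext (pE b e eb)) (propext (pE (emap g a') c _)); last first.
    by move=> v vS; rewrite /emap; have [-> _] := tauP v.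
  apply: chiall => // N h h' hh' /sat_subst ph; apply/sat_subst.
  by apply: Sp ph => v vS; exact: nP.
Qed.
End Types.

(** * Homogeneity and definability of invariant sets *)

Section Definability.
Variables (L : signature) (M C : structure L) (emb : forall s, M s -> C s).
Hypothesis emb_elem : elementary emb.
Hypothesis Mcount : countable_structure M.
Hypothesis Mcat : omega_categorical M.
Variable K : Type.
Hypothesis Klim : uncountable_strong_limit K.
Hypothesis Csat : saturated C K.
Variables (V : Type) (sv : V -> lsort L) (S : seq V).
Hypothesis cV : countable [set: V].
Hypothesis svS : forall s, exists v, sv v = s.

(** Otherwise saturation would realise the negations of all isolating formulas at once, contrary to
    [finite_tuple_isolated]. *)
Lemma finite_types : exists l : seq (formula sv),
  (forall chi, List.In chi l -> exists a : env C sv, isolates S chi a) /\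
  forall a : env C sv, exists2 chi, List.In chi l & sat chi a.
Proof.
pose J := {chi : formula sv | exists a : env C sv, isolates S chi a}.
have iso (a : env C sv) : isolated S a := finite_tuple_isolated emb_elem Mcount Mcat Klim Csat S a cV svS.
have [[l lP]|/forallNP nl] := pselect (exists l : seq J,
    forall a : env C sv, exists2 j, List.In j l & sat (sval j) a).
  exists [seq sval j | j <- l]; split.
    by move=> chi /List.in_map_iff[j [<- _]]; exact: (svalP j).
  move=> a; have [j jl ja] := lP a; exists (sval j) => //; exact: List.in_map.
exfalso.
have [a0 _] : exists a0 : env C sv, True.
  by have /existsNP[a _] := nl nil; exists a.
have [l|c [_ cP]] := saturation Csat (small_countable Klim cV) (D := set0) (a := a0)
    (phi := fun j : J => fNot (sval j)).
  have /existsNP[c cl] := nl l; exists c; split=> // j jl; apply/sat_not => jc.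
  by apply: cl; exists j.
have [chi chiP] := iso c; have [_ chic _] := chiP.
exact: cP (exist _ chi (ex_intro _ c chiP)) chic.
Qed.

(** D is defined by the disjunction of the finitely many isolating formulas that meet it. The
    embedding f lets N be M as well as C. *)
Lemma definable_of_types (N : structure L) (f : forall s, N s -> C s)
    (D : set (env N sv)) : elementary f ->
  (forall a b, (forall p, supp S p -> sat p a -> sat p b) -> D a -> D b) ->
  exists p, supp S p /\ forall a, D a <-> sat p a.
Proof.
move=> fe HD; have [l [lP lC]] := finite_types.
pose l' := [seq chi <- l | ~~ `[< ~ exists a : env N sv, sat chi a /\ D a >]].
have inl' chi : List.In chi l' <-> List.In chi l /\ exists a : env N sv, sat chi a /\ D a.
  rewrite (propext (In_filterN (fun chi => ~ exists a : env N sv, sat chi a /\ D a) l chi)).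
  by split=> -[h1 h2]; split=> //; exact: contrapT.
exists (fOrL l'); split.
  move=> N' b b' bb' /sat_orL[chi chil' bchi]; apply/sat_orL; exists chi => //.
  have [/lP[a [Schi _ _]] _] := (inl' chi).1 chil'; exact: Schi bb' bchi.
move=> a; rewrite (propext (sat_orL _ _)); split=> [Da|[chi /inl'[/lP[c [Schi _ chiall]] [b [chib Db]]] chia]].
  have [chi chil chia] := lC (emap f a).
  have {}chia : sat chi a by apply/fe.
  by exists chi => //; apply/inl'; split=> //; exists a.
apply: HD Db => p Sp /fe pb; apply/fe.
apply/(chiall (emap f a) ((fe _ _ _ _).1 chia) p Sp).
exact/(chiall (emap f b) ((fe _ _ _ _).1 chib) p Sp).
Qed.

End Definability.

Lemma In_enum (I : finType) (i : I) : List.In i (enum I).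
Proof.
have : i \in enum I by rewrite mem_enum.
by elim: (enum _) => //= j l IH; rewrite inE => /predU1P[->|/IH]; [left|right].
Qed.

Lemma supp_enum (L : signature) (I : finType) (sv : I -> lsort L) (p : formula sv) :
  supp (enum I) p.
Proof. by move=> N c c' cc'; apply: sat_ext => i; apply: cc'; exact: In_enum. Qed.

Arguments supp_enum {L I sv} p.

(** * Back-and-forth systems on the countable structure M *)

Section BackAndForth.
Variables (L : signature) (M : structure L).
Hypothesis Mcount : countable_structure M.
Local Notation pair_list := (seq {s & (M s * M s)%type}).

Definition pair_of s (x y : M s) : {s & (M s * M s)%type} := existT _ s (x, y).

(** One implication suffices, since it can be applied to the negation of p. *)
Definition partial_elementary (l : pair_list) :=
  forall V (sv : V -> lsort L) (a b : env M sv) (S : seq V),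
    (forall v, List.In v S -> List.In (pair_of (a v) (b v)) l) ->
    forall p, supp S p -> sat p a -> sat p b.

Definition swap_pair (z : {s & (M s * M s)%type}) : {s & (M s * M s)%type} :=
  existT _ (projT1 z) ((projT2 z).2, (projT2 z).1).

Lemma partial_elementary_swap l :
  partial_elementary l -> partial_elementary [seq swap_pair z | z <- l].
Proof.
move=> lP V sv a b S abl p Sp pa; apply: contrapT => npb.
apply: (lP V sv b a S _ (fNot p) (supp_not Sp) npb pa) => v /abl.
move=> /List.in_map_iff[[s [x y]] [e zl]].
suff -> : pair_of (b v) (a v) = existT _ s (x, y) by [].
by rewrite -[LHS]/(swap_pair (pair_of (a v) (b v))) -e.
Qed.

Lemma partial_elementary_list V (sv : V -> lsort L) (a b : env M sv) (S : seq V) :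
  (forall s, exists v, sv v = s) ->
  (forall p, supp S p -> sat p a -> sat p b) ->
  partial_elementary [seq pair_of (a v) (b v) | v <- S].
Proof.
move=> svS ab W sw a' b' T a'b' p Tp pa'.
have /dchoice[tau tauP] : forall w, exists t : term sv (sw w), List.In w T ->
    [/\ eval a t = a' w, eval b t = b' w & forall (N : structure L) (c c' : env N sv),
      (forall v, List.In v S -> c v = c' v) -> eval c t = eval c' t].
  move=> w; have [wT|wT] := pselect (List.In w T); last first.
    have [t _] : exists t : term sv (sw w), True.
      by have [v <-] := svS (sw w); exists (Var sv v).
    by exists t.
  have /List.in_map_iff[v [e vS]] := a'b' _ wT.
  have : forall z, pair_of (a v) (b v) = z -> exists t : term sv (projT1 z),
     [/\ eval a t = (projT2 z).1, eval b t = (projT2 z).2 & forall (N : structure L) (c c' : env N sv),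
      (forall v, List.In v S -> c v = c' v) -> eval c t = eval c' t].
    by move=> z <-; exists (Var sv v); split=> // N c c'; exact.
  by move=> /(_ _ e)[t tP]; exists t.
have : sat (subst p tau) b.
  apply: ab.
    move=> N c c' cc' /sat_subst h; apply/sat_subst; apply: Tp h => w /tauP[_ _]; exact.
  by apply/sat_subst; apply: Tp pa' => w /tauP[].
by move=> /sat_subst; apply: Tp => w /tauP[].
Qed.

Variable F : set pair_list.
Hypothesis F_pe : F `<=` partial_elementary.
Hypothesis forth : forall l s (x : M s), F l -> exists y l',
  [/\ F l', forall z, List.In z l -> List.In z l' & List.In (pair_of x y) l'].
Hypothesis back : forall l s (y : M s), F l -> exists x l',
  [/\ F l', forall z, List.In z l -> List.In z l' & List.In (pair_of x y) l'].

(** Besides extending l0, the limit g agrees on every finite set with a member of F contained in its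
    graph; this lets properties of the members of F pass to g, as in [coherent_limit]. *)
Lemma back_and_forth l0 : F l0 -> exists g : aut M,
  (forall s (x y : M s), List.In (pair_of x y) l0 -> g s x = y) /\
  forall A : seq {s & M s}, exists l, [/\ F l,
    forall s x, List.In (existT _ s x) A -> List.In (pair_of x (g s x)) l &
    forall s (x y : M s), List.In (pair_of x y) l -> g s x = y].
Proof.
move=> Fl0.
have [[z0]|nM] := pselect (inhabited {s & M s}); last first.
  have nM' s (x : M s) : False by apply: nM; exists; exists s.
  exists (aut_one M); split=> [s x|A]; first by case: (nM' s x).
  by exists l0; split=> // s x; case: (nM' s x).
have [_ _ _ /countable_enum/(_ z0)[e eP]] := Mcount.
have [|f [f0 fP]] := @dependent_choice pair_list (fun _ => F) (fun n l l' =>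
  [/\ forall z, List.In z l -> List.In z l',
      exists y, List.In (pair_of (projT2 (e n)) y) l' &
      exists x, List.In (pair_of x (projT2 (e n))) l']) l0 Fl0.
  move=> n l Fl; have [y [l' [Fl' ll' yl']]] := forth (projT2 (e n)) Fl.
  have [x [l2 [Fl2 l'l2 xl2]]] := back (projT2 (e n)) Fl'.
  exists l2; split=> //; split.
  - by move=> z /ll'/l'l2.
  - by exists y; exact: l'l2.
  - by exists x.
have fle m n z : m <= n -> List.In z (f m) -> List.In z (f n).
  elim: n => [|n IH]; first by rewrite leqn0 => /eqP ->.
  rewrite leq_eqVlt ltnS => /predU1P[->//|mn] /(IH mn).
  by have [_ [+ _ _]] := fP n; exact.
have FPE n : partial_elementary (f n) by apply: F_pe; have [] := fP n.
have fst s (x : M s) : exists y n, List.In (pair_of x y) (f n).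
  have [n en] := eP (existT _ s x).
  by have [_ [_ + _]] := fP n; rewrite en /= => -[y yl]; exists y, n.+1.
have snd s (y : M s) : exists x n, List.In (pair_of x y) (f n).
  have [n en] := eP (existT _ s y).
  by have [_ [_ _ +]] := fP n; rewrite en /= => -[x xl]; exists x, n.+1.
have uniq s (x x' y y' : M s) m n : List.In (pair_of x y) (f m) ->
    List.In (pair_of x' y') (f n) -> x = x' <-> y = y'.
  move=> xy xy'; pose b (u v : M s) : env M (fun _ : bool => s) := fun i => if i then u else v.
  have bl i : List.In i [:: true; false] -> List.In (pair_of (b x x' i) (b y y' i)) (f (maxn m n)).
    by case: i => _; [apply: fle xy|apply: fle xy']; rewrite ?leq_maxl ?leq_maxr.
  have sp : supp [:: true; false] (Equ (Var (fun _ : bool => s) true) (Var (fun _ : bool => s) false)).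
    by move=> N c c' cc' /=; rewrite !cc' //; [right; left|left].
  split=> h; first exact: (@FPE _ _ _ _ _ _ bl _ sp h).
  by apply: contrapT => nh; apply: (@FPE _ _ _ _ _ _ bl _ (supp_not sp) nh h).
have /dchoice[g gP] : forall s, exists g : M s -> M s, forall x,
    exists n, List.In (pair_of x (g x)) (f n).
  by move=> s; exact: dchoice (fst s).
have gE s (x y : M s) n : List.In (pair_of x y) (f n) -> g s x = y.
  by move=> h; have [m h'] := gP s x; have [+ _] := uniq _ _ _ _ _ _ _ h' h; exact.
have big (I : finType) (P : I -> nat -> Prop) : (forall i, exists n, P i n) ->
    (forall i m n, m <= n -> P i m -> P i n) -> exists n, forall i, P i n.
  move=> /choice[h hP] mon; exists (\max_i h i) => i.
  by apply: mon (hP i); exact: leq_bigmax.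
have all_in (I : finType) (si : I -> lsort L) (a : env M si) :
    exists n, forall i, List.In (pair_of (a i) (g _ (a i))) (f n).
  apply: big => [i|i m n mn]; [exact: gP|exact: fle].
have giso : is_iso g.
  split=> [s|k a|r a].
  - have [h hP] := dchoice (snd s).
    have gh : cancel h (g s) by move=> y; have [n] := hP y; exact: gE.
    exists h => // x; have [n h1] := hP (g s x); have [m h2] := gP s x.
    by have [_ /(_ erefl)] := uniq _ _ _ _ _ _ _ h1 h2.
  - pose si := vext (@fdom L k) (fcod k).
    have [n nP] := all_in _ si (econs a (fint a)).
    pose p : formula si := Equ (@App L _ si k (fun i => Var si (Some i))) (Var si None).
    have h : sat p (fun i => g _ (econs a (fint a) i)).
      exact: (@FPE n _ si (econs a (fint a)) (fun i => g _ (econs a (fint a) i)) (enum _) (fun v _ => nP v) p (supp_enum p) erefl).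
    exact: esym h.
  - have [n nP] := all_in _ (@rdom L r) a.
    pose p : formula (@rdom L r) := Rel (fun i => Var (@rdom L r) i).
    have H := @FPE n _ (@rdom L r) a (fun i => g _ (a i)) _ (fun v _ => nP v).
    split=> h; first exact: H (supp_enum p) h.
    by apply: contrapT => nh; exact: H (supp_enum (fNot p)) nh h.
exists (Aut giso); split=> [s x y xy|A]; first by apply: (gE s x y 0); rewrite f0.
have [n nA] : exists n, forall s x, List.In (existT _ s x) A -> List.In (pair_of x (g s x)) (f n).
  elim: A => [|[s x] A [n IH]]; first by exists 0.
  have [m mP] := gP s x; exists (maxn m n) => s' x' [e'|/IH h].
    have ss := projT1_eq e'; rewrite /= in ss; subst s'.
    by rewrite -(existT_inj e'); apply: fle mP; exact: leq_maxl.
  by apply: fle h; exact: leq_maxr.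
by exists (f n); split=> // [|s x y]; [have [] := fP n|exact: gE].
Qed.

End BackAndForth.

Lemma In_tnth (T : Type) (l : seq T) z :
  List.In z l -> exists i : 'I_(size l), tnth (in_tuple l) i = z.
Proof.
move=> zl; have [k kl kz] : exists2 k, k < size l & forall z0, nth z0 l k = z.
  elim: l zl => //= w l IH [->|/IH[k kl kz]]; first by exists 0.
  by exists k.+1.
by exists (Ordinal kl); rewrite (tnth_nth z).
Qed.

Lemma tnth_In (T : Type) (l : seq T) (i : 'I_(size l)) :
  List.In (tnth (in_tuple l) i) l.
Proof.
rewrite (tnth_nth (tnth (in_tuple l) i)) /=; case: i => k /= kl.
move: (tnth _ _) => z; elim: l k kl => //= w l IH [|k] kl; first by left.
by right; exact: IH.
Qed.

Section Homogeneity.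
Variables (L : signature) (M C : structure L) (emb : forall s, M s -> C s).
Hypothesis emb_elem : elementary emb.
Hypothesis Mcount : countable_structure M.
Hypothesis Mcat : omega_categorical M.
Variable K : Type.
Hypothesis Klim : uncountable_strong_limit K.
Hypothesis Csat : saturated C K.

Definition elt := {s & M s}.
Definition elt_sort : elt -> lsort L := @projT1 _ _.
Definition elt_env : env M elt_sort := fun z => projT2 z.

Lemma countable_elt : countable [set: elt].
Proof. by case: Mcount. Qed.

Lemma elt_surj s : exists z, elt_sort z = s.
Proof. by case: (inhab M s) => x; exists (existT _ s x). Qed.

(** With chi isolating the type of the domain of l together with x, the formula [fEx chi] passes
    from the domain to the image of l and provides y. *)
Lemma partial_elementary_forth l s (x : M s) : partial_elementary l ->
  exists y l', [/\ partial_elementary l', forall z, List.In z l -> List.In z l' &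
                   List.In (pair_of x y) l'].
Proof.
move=> lP; pose n := size l; pose t i := tnth (in_tuple l) i.
pose si (i : 'I_n) := projT1 (t i).
(* The elements of M are added as variables so that every sort occurs in the context. *)
pose W := vsum si elt_sort.
pose a0 : env M si := fun i => (projT2 (t i)).1.
pose b0 : env M si := fun i => (projT2 (t i)).2.
pose S : seq (option ('I_n + elt)) := None :: [seq Some (inl i) | i <- enum 'I_n].
have cW : countable [set: option ('I_n + elt)].
  by apply/countable_option/countable_sum/countable_elt; exact: countable_countType.
have Wsurj r : exists w, vext W s w = r.
  by have [z <-] := elt_surj r; exists (Some (inr z)).
have Sin i : List.In (Some (inl i)) S.
  by right; apply: (List.in_map (fun i => Some (inl i))); exact: In_enum.
pose a := econs (epair a0 elt_env) x.
have [chi [Schi chia chiall]] :=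
  finite_tuple_isolated emb_elem Mcount Mcat Klim Csat S (emap emb a) cW Wsurj.
have {}chia : sat chi a by apply/emb_elem.
have : sat (fEx chi) (epair b0 elt_env).
  apply: (lP _ W (epair a0 elt_env) _ [seq inl i | i <- enum 'I_n]).
  - move=> v /List.in_map_iff[i [<- _]].
    have -> : pair_of (epair a0 elt_env (inl i)) (epair b0 elt_env (inl i)) = t i.
      by rewrite /pair_of /= /a0 /b0 /si; case: (t i) => r [].
    exact: tnth_In.
  - move=> N c c' cc' /sat_ex[y chiy]; apply/sat_ex; exists y.
    apply: Schi chiy => v [<-//|/List.in_map_iff[i [<- iI]]] /=.
    exact: (cc' (inl i) (List.in_map _ _ _ iI)).
  - by apply/sat_ex; exists x.
move=> /sat_ex[y chiy]; pose b := econs (epair b0 elt_env) y.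
exists y, [seq pair_of (a v) (b v) | v <- S]; split.
- apply: partial_elementary_list Wsurj _ => p Sp.
  move=> pa; apply/(emb_elem p b).
  have eb : sat chi (emap emb b) := (emb_elem chi b).1 chiy.
  exact: (chiall _ eb p Sp).1 ((emb_elem p a).1 pa).
- move=> z zl; have [i iz] := In_tnth zl.
  have -> : z = pair_of (a (Some (inl i))) (b (Some (inl i))).
    rewrite -iz -/(t i) /pair_of /= /a0 /b0 /si; by case: (t i) => r [].
  exact: (List.in_map (fun v => pair_of (a v) (b v)) _ _ (Sin i)).
- by left.
Qed.

Lemma partial_elementary_back l s (y : M s) : partial_elementary l ->
  exists x l', [/\ partial_elementary l', forall z, List.In z l -> List.In z l' &
                   List.In (pair_of x y) l'].
Proof.
move=> /partial_elementary_swap/(partial_elementary_forth y)[x [l' [l'P ll' xl']]].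
have swapK z : swap_pair (M := M) (swap_pair z) = z by case: z => r [].
exists x, [seq swap_pair z | z <- l']; split.
- exact: partial_elementary_swap.
- move=> z zl; rewrite -(swapK z); apply/List.in_map/ll'; exact: List.in_map.
- exact: (List.in_map (@swap_pair L M)) xl'.
Qed.

Variables (V : Type) (sv : V -> lsort L) (S : seq V).
Hypothesis svS : forall s, exists v, sv v = s.

Lemma homogeneous_countable (a b : env M sv) :
  (forall p, supp S p -> sat p a -> sat p b) ->
  exists g : aut M, forall v, List.In v S -> g _ (a v) = b v.
Proof.
move=> ab; have [g [gS _]] := back_and_forth Mcount (fun l h => h)
  partial_elementary_forth partial_elementary_back (partial_elementary_list svS ab).
exists g => v vS; apply: gS.
exact: (List.in_map (fun v => pair_of (a v) (b v)) _ _ vS).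
Qed.

Lemma homogeneous_finite (N : structure L) (a b : env N sv) :
  strongly_homogeneous N K ->
  (forall p, supp S p -> sat p a -> sat p b) ->
  exists g : aut N, forall v, List.In v S -> g _ (a v) = b v.
Proof.
move=> Nhom ab.
pose t (i : 'I_(size S)) := tnth (in_tuple S) i.
have ab' p : supp S p -> sat p a <-> sat p b.
  move=> Sp; split; first exact: ab.
  by move=> pb; apply: contrapT => npa; exact: (ab _ (supp_not Sp) npa pb).
have [||g gP] := Nhom 'I_(size S) (fun i => sv (t i)) (fun i => a (t i)) (fun i => b (t i)).
- exact: small_count.
- move=> p; pose q := subst p (fun i => Var sv (t i)).
  have := ab' q; rewrite !(propext (sat_subst _ _ _)); apply.
  move=> N' c c' cc' /sat_subst h; apply/sat_subst; apply: sat_ext h => i /=.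
  by apply: cc'; exact: tnth_In.
exists g => v vS; have [i iv] := In_tnth vS; subst v.
by have := congr1 (fun f => f i) gP.
Qed.

Hypothesis cV : countable [set: V].

Lemma invariant_definable (N : structure L) (f : forall s, N s -> C s)
    (D : set (env N sv)) : elementary f ->
  (forall a b : env N sv, (forall p, supp S p -> sat p a -> sat p b) ->
     exists g : aut N, forall v, List.In v S -> g _ (a v) = b v) ->
  (forall (g : aut N) (a b : env N sv),
     (forall v, List.In v S -> g _ (a v) = b v) -> D a -> D b) ->
  exists p, supp S p /\ forall a, D a <-> sat p a.
Proof.
move=> fe hom HD.
apply: (definable_of_types (emb := emb) emb_elem Mcount Mcat Klim Csat cV svS fe).
by move=> a b /hom[g gab]; exact: HD gab.
Qed.

Lemma invariant_definable_countable (D : set (env M sv)) :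
  (forall (g : aut M) (a b : env M sv),
     (forall v, List.In v S -> g _ (a v) = b v) -> D a -> D b) ->
  exists p, supp S p /\ forall a, D a <-> sat p a.
Proof. exact: invariant_definable emb_elem homogeneous_countable. Qed.

Lemma invariant_definable_saturated (D : set (env C sv)) :
  strongly_homogeneous C K ->
  (forall (g : aut C) (a b : env C sv),
     (forall v, List.In v S -> g _ (a v) = b v) -> D a -> D b) ->
  exists p, supp S p /\ forall a, D a <-> sat p a.
Proof.
move=> Chom; apply: (invariant_definable (f := fun _ => id)) => //.
by move=> a b; exact: homogeneous_finite.
Qed.

End Homogeneity.

(** * Lascar strong types *)

Section Coheir.
Variables (L : signature) (M C : structure L) (emb : forall s, M s -> C s).
Hypothesis emb_elem : elementary emb.
Variable K : Type.
Hypothesis Klim : uncountable_strong_limit K.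
Hypothesis Csat : saturated C K.
Hypothesis Chom : strongly_homogeneous C K.
Hypothesis smallM : small K {s & M s}.

Definition base_env : env C (@elt_sort L M) := emap emb (@elt_env L M).

Section Tuple.
Variables (V : Type) (sv : V -> lsort L).
Hypothesis smallV : small K V.

Definition same_type_over (a b : env C sv) := forall p : formula (vsum sv (@elt_sort L M)),
  sat p (epair a base_env) <-> sat p (epair b base_env).

(** The type of a over M, as a filter on tuples of M; it is proper because M is elementary in C. *)
Definition definable_trace (a : env C sv) : set_system (env M sv) :=
  [set A | exists p : formula (vsum sv (@elt_sort L M)),
     sat p (epair a base_env) /\ [set e | sat p (epair e (@elt_env L M))] `<=` A].

Lemma definable_trace_proper a : ProperFilter (definable_trace a).
Proof.
apply: Build_ProperFilter_ex; last first.
  split.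
  - by exists (fNot (Bot _)); split.
  - move=> A B [p [pa pA]] [q [qa qB]]; exists (fAnd p q); split; first exact/sat_and.
    by move=> e /sat_and[/pA ? /qB].
  - by move=> A B AB [p [pa pA]]; exists p; split=> // e /pA/AB.
move=> A [p [pa pA]].
have [e0 _] : exists e0 : env M sv, True.
  have /dchoice[e0 _] : forall v, exists x : M (sv v), True.
    by move=> v; case: (inhab M (sv v)) => x; exists x.
  by exists e0.
have [|c [cP pc]] := elem_witness emb_elem (P := fun x => if x is inr _ then True else False)
    (p := p) (c := epair e0 (@elt_env L M)) (a := epair a base_env) _ pa.
- by case.
exists (fun v => c (inl v)); apply: pA; apply: sat_ext pc => -[v|z] //=.
exact: (cP (inr z) I).
Qed.

Variables (a : env C sv) (F : set_system (env M sv)).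
Hypothesis FU : UltraFilter F.
Hypothesis Fa : definable_trace a `<=` F.

(** The average along F: p(a, y) is kept when it holds for almost all tuples e of M. As these e come
    from M, only the type of a over M matters. *)
Definition coheir : set (formula (vsum sv sv)) :=
  [set p | F [set e | sat p (epair a (emap emb e))]].

Lemma coheir_complete p : coheir p \/ coheir (fNot p).
Proof. exact: (in_ultra_setVsetC [set e | sat p (epair a (emap emb e))] FU). Qed.

(** Finitely many of the conditions p(c', y), with p in [coheir], and of the formulas over M true of
    a hold together for F-almost all tuples e of M. Saturation then gives c. *)
Lemma coheir_extend (l : seq (env C sv)) :
  (forall c, List.In c l -> same_type_over a c) ->
  exists c, same_type_over a c /\
    forall c', List.In c' l -> realizes (epair c' c) coheir.
Proof.
move=> la; pose I := 'I_(size l).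
pose x (i : I) : env C sv := tnth (in_tuple l) i.
pose sI (iv : I * V) := sv iv.2.
pose W0 := vsum sI (@elt_sort L M).
pose W := vsum W0 sv.
pose b0 : env C W0 := epair (fun iv => x iv.1 iv.2) base_env.
pose J := ((I * {p | coheir p}) +
  {p : formula (vsum sv (@elt_sort L M)) | sat p (epair a base_env)})%type.
pose phi (j : J) : formula W := match j with
  | inl ip => subst (sval ip.2) (fun y => match y return term W (vsum sv sv y) with
      inl v => Var W (inl (inl (ip.1, v))) | inr v => Var W (inr v) end)
  | inr p => subst (sval p) (fun y => match y return term W (vsum sv (@elt_sort L M) y) with
      inl v => Var W (inr v) | inr z => Var W (inl (inr z)) end)
  end.
have phi1 ip (c : env C W) : sat (phi (inl ip)) c <->
    sat (sval ip.2) (epair (fun v => c (inl (inl (ip.1, v)))) (fun v => c (inr v))).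
  by rewrite /phi (propext (sat_subst _ _ _)); split; apply: sat_ext => -[].
have phi2 p (c : env C W) : sat (phi (inr p)) c <->
    sat (sval p) (epair (fun v => c (inr v)) (fun z => c (inl (inr z)))).
  by rewrite /phi (propext (sat_subst _ _ _)); split; apply: sat_ext => -[].
have sW : small K ((I * V + elt M) + V).
  apply: small_sum => //; apply: small_sum => //; apply: small_prod => //.
  exact: small_count.
have [js|c [cD cphi]] := saturation Csat sW (sv := W)
    (D := fun y => if y is inl _ then True else False) (a := epair b0 a) (phi := phi).
  suff /filter_ex[e eP] : F [set e | forall j, List.In j js -> sat (phi j) (epair b0 (emap emb e))].
    by exists (epair b0 (emap emb e)); split=> // -[].
  elim: js => [|j js IH]; first by apply: filterS filterT => e _ j [].
  have Fj : F [set e | sat (phi j) (epair b0 (emap emb e))].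
    case: j => [[i [p pF]]|[p pa]].
      apply: filterS (pF : F _) => e pe; apply/phi1 => /=.
      (* Inserting e turns p into a formula over M, on which a and [x i] agree. *)
      pose q := subst p (fun y => match y return term (vsum sv (@elt_sort L M)) (vsum sv sv y) with
        inl v => Var (vsum sv (@elt_sort L M)) (inl v)
      | inr v => Var (vsum sv (@elt_sort L M)) (inr (existT _ (sv v) (e v))) end).
      have qP y : sat q (epair y base_env) <-> sat p (epair y (emap emb e)).
        by rewrite /q (propext (sat_subst _ _ _)); split; apply: sat_ext => -[].
      have /(_ q) : same_type_over a (x i) by apply: la; exact: tnth_In.
      by rewrite !(propext (qP _)) => -[+ _]; apply.
    apply: Fa; exists p; split=> // e pe; apply/phi2 => /=.
    have := (emb_elem p (epair e (@elt_env L M))).1 pe.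
    by apply: sat_ext => -[].
  apply: filterS (filterI Fj IH) => e [h1 h2] k [<-//|]; exact: h2.
exists (fun v => c (inr v)); split=> [p|c' c'l p cp].
  have cb : (fun z => c (inl (inr z))) = base_env.
    by apply: functional_extensionality_dep => z; rewrite cD.
  have pa q : sat q (epair a base_env) -> sat q (epair (fun v => c (inr v)) base_env).
    by move=> qa; have /phi2 := cphi (inr (exist _ q qa)); rewrite cb.
  split=> [|pc]; first exact: pa.
  by apply: contrapT => np; exact: (pa (fNot p) np pc).
have [i ic] := In_tnth c'l; subst c'.
have /phi1 := cphi (inl (i, exist _ p cp)).
by apply: sat_ext => -[v|v] //=; rewrite cD.
Qed.

End Tuple.

(** The type [coheir] is complete, so all pairs realising it are conjugate; [pigeonhole] gives one
    such pair that is E-related, hence all are. Some c realises it over both a and u(a), and a E c E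
    u(a) follows. *)
Lemma fix_base_Autf_L (u : aut C) :
  (forall s (x : M s), u s (emb x) = emb x) -> Autf K (E_L K) u.
Proof.
move=> ufix V sv a sV E Eeq Einv Ebdd.
have [F [FU Fa]] := ultraFilterLemma (definable_trace_proper a).
have ext := coheir_extend sV FU Fa.
have [c1 [c2 [cc Ecc]]] := pigeonhole Klim Csat sV Eeq Ebdd ext.
have sa : same_type_over a a by [].
have su : same_type_over a (emap u a).
  move=> p; rewrite (propext (sat_aut u p _)).
  by split; apply: sat_ext => -[v|z] //=; rewrite /emap /= ufix.
have [|c [_ cP]] := ext [:: a; emap u a]; first by move=> c [<-|[<-|[]]].
have Exc x : List.In x [:: a; emap u a] -> E x c.
  move=> /cP xc.
  have [|t tP] := Chom (a := epair c1 c2) (b := epair x c) (small_sum Klim sV sV).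
    move=> p; split=> [pc|px]; apply: contrapT => np.
      have [/xc//|/cc/(_ pc)//] := coheir_complete a FU p.
    by have [/cc//|/xc/(_ px)//] := coheir_complete a FU p.
  have -> : x = emap t c1.
    by apply: functional_extensionality_dep => v; have := congr1 (fun f => f (inl v)) tP.
  have -> : c = emap t c2.
    by apply: functional_extensionality_dep => v; have := congr1 (fun f => f (inr v)) tP.
  exact: Einv.
have [_ Esym Etrans] := Eeq.
apply: (Etrans _ c); first by apply: Exc; left.
by apply/Esym/Exc; right; left.
Qed.

End Coheir.

(** Closed sets of the topology generated by the complements of members of D are intersections of
    finite unions of members of D. Serves to show that generating the logic topologies adds no
    closed sets. *)
Lemma subbase_closed_ind (T : Type) (D P : set (set T)) (O : set (set T)) :
  D `<=` P -> P set0 -> (forall A B, P A -> P B -> P (A `|` B)) ->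
  (forall F : set (set T), F `<=` P -> P (\bigcap_(A in F) A)) ->
  O `<=` finI_from D (@setC T) -> P (~` (\bigcup_(A in O) A)).
Proof.
move=> DP P0 PU PI OD; rewrite setC_bigcup.
have -> : \bigcap_(A in O) ~` A = \bigcap_(A in [set ~` A | A in O]) A.
  apply/seteqP; split=> x h.
    by move=> _ [A OA <-]; exact: h.
  by move=> A OA; apply: h; exists A.
apply: PI => _ [A /OD[E ED <-] <-]; rewrite setC_bigcap.
rewrite -[X in P X]/(\bigcup_(i in [set` E]) ~` (~` i)).
have -> : \bigcup_(i in [set` E]) ~` (~` i) = \bigcup_(i in [set` E]) i.
  by apply: eq_bigcupr => i _; rewrite setCK.
rewrite bigcup_fset big_seq; elim/big_rec: _ => // B Z BE PZ.
by apply: PU => //; apply: DP; have /set_mem := ED _ BE.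
Qed.

(** * Closed subsets of [Gal_L], and orbits of Lascar-strong automorphisms *)

Section LascarGroup.
Variables (L : signature) (M C : structure L) (emb : forall s, M s -> C s).
Hypothesis emb_elem : elementary emb.
Variable K : Type.
Hypothesis Klim : uncountable_strong_limit K.
Hypothesis Csat : saturated C K.
Hypothesis Chom : strongly_homogeneous C K.
Hypothesis smallM : small K {s & M s}.
Local Notation base := (base_env emb).
Local Notation es := (@elt_sort L M).
Local Notation over_base s := (epair (emap (s : aut C) base) base).

Lemma same_type_aut V (sv : V -> lsort L) (x y : env C sv) : small K V ->
  same_type_over emb x y ->
  exists u : aut C, emap u x = y /\ forall s (z : M s), u s (emb z) = emb z.
Proof.
move=> sV xy; have [|u uP] := Chom (a := epair x base) (b := epair y base) (small_sum Klim sV smallM).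
  exact: xy.
exists u; split.
  by apply: functional_extensionality_dep => v; have := congr1 (fun f => f (inl v)) uP.
by move=> s z; have := congr1 (fun f => f (inr (existT _ s z))) uP.
Qed.

(** Some u fixing m takes s(m) to t(m). Then u and t^-1 u s both fix m, so both are Lascar-strong,
    and s^-1 t is a product of conjugates of them and their inverses. *)
Lemma to_Gal_L_eq (s t : aut C) :
  (forall p : formula (vsum es es), sat p (over_base s) <-> sat p (over_base t)) ->
  to_Gal_L K s = to_Gal_L K t.
Proof.
move=> st; have [u [us ufix]] := same_type_aut smallM st.
have uL := fix_base_Autf_L emb_elem Klim Csat Chom smallM ufix.
apply/coset_eq.
have wL : Autf K (E_L K) (t^-1 * u * s)%g.
  apply: (fix_base_Autf_L emb_elem Klim Csat Chom smallM) => k x /=.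
  have /= := congr1 (fun f => f (existT _ k x)) us.
  rewrite /emap /base_env /emap /= => ->.
  by rewrite -[LHS]/((t^-1 * t)%g k (emb x)) mulVg.
have [_ SM SV] := Autf_subgroup K (@E_L_equivalence L C K).
have sus : Autf K (E_L K) (s^-1 * u * s)%g.
  have := Autf_normal (@E_L_invariant L C K) s^-1%g uL; by rewrite invgK.
have -> : (s^-1 * t = s^-1 * u * s * (t^-1 * u * s)^-1)%g.
  by rewrite !invgM invgK !mulgA !mulgK.
by apply: SM => //; exact: SV.
Qed.

(** Phi consists of all formulas true of (t(m), m) for every t in A. If s satisfies Phi, saturation
    and homogeneity yield t with t(a) in D such that (t(m), m) has the type of (s(m), m); so t is in
    A and has the class of s. *)
Lemma Gal_L_closed_canonical (A : set (Gal_L K C)) :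
  Gal_L_closed A <-> exists Phi : set (formula (vsum es es)),
    forall s, A (to_Gal_L K s) <-> realizes (over_base s) Phi.
Proof.
split=> [[V [sv [a [D [sV [W [sw [b [p [sW Dp]]]]] AD]]]]]|[Phi PhiP]]; last first.
  exists {s & M s}, es, base, [set y | realizes (epair y base) Phi]; split=> //.
  by exists {s & M s}, es, base, Phi.
pose Phi := [set q : formula (vsum es es) |
  forall t, A (to_Gal_L K t) -> sat q (over_base t)].
exists Phi => s; split=> [As q|sPhi]; first exact.
pose P0 := vsum sw es; pose P1 := vsum sv es; pose ctx := vsum P0 P1.
pose base0 : env C ctx := epair (epair b base) (epair a base).
pose J := ({q | p q} + ({q : formula P1 | sat q (epair a base)} +
  {q : formula (vsum es es) | sat q (over_base s)}))%type.
pose phi (j : J) : formula ctx := match j with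
  | inl q => subst (sval q) (fun y => match y return term ctx (vsum sv sw y) with
      inl v => Var ctx (inr (inl v)) | inr w => Var ctx (inl (inl w)) end)
  | inr (inl q) => subst (sval q) (fun y => Var ctx (inr y))
  | inr (inr q) => subst (sval q) (fun y => match y return term ctx (vsum es es y) with
      inl v => Var ctx (inr (inr v)) | inr w => Var ctx (inl (inr w)) end)
  end.
have phi1 q (c : env C ctx) : sat (phi (inl q)) c <->
    sat (sval q) (epair (fun v => c (inr (inl v))) (fun v => c (inl (inl v)))).
  by rewrite /phi (propext (sat_subst _ _ _)); split; apply: sat_ext => -[].
have phi2 q (c : env C ctx) : sat (phi (inr (inl q))) c <->
    sat (sval q) (fun v => c (inr v)).
  by rewrite /phi (propext (sat_subst _ _ _)).
have phi3 q (c : env C ctx) : sat (phi (inr (inr q))) c <->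
    sat (sval q) (epair (fun v => c (inr (inr v))) (fun v => c (inl (inr v)))).
  by rewrite /phi (propext (sat_subst _ _ _)); split; apply: sat_ext => -[].
have sctx : small K ((W + elt M) + (V + elt M)) by do !apply: small_sum => //.
have [js|c [cD cphi]] := saturation Csat sctx (sv := ctx)
    (D := fun y => if y is inl _ then True else False) (a := base0) (phi := phi).
  pose third (j : J) : formula (vsum es es) :=
    if j is inr (inr q) then sval q else fNot (Bot _).
  have [t [At tq]] : exists t, A (to_Gal_L K t) /\
      sat (fAndL [seq third j | j <- js]) (over_base t).
    apply: contrapT => nt.
    (* If no t in A satisfied these formulas true of s, the negation of their conjunction would
       belong to Phi. *)
    have /sPhi : Phi (fNot (fAndL [seq third j | j <- js])).
      by move=> t At; apply/sat_not => h; apply: nt; exists t.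
    move=> /sat_not; apply; apply/sat_andL => q /List.in_map_iff[j [<- _]].
    by case: j => [j|[j|[q0 q0P]]] //; exact: sat_true.
  have third_t j : List.In j js -> sat (third j) (over_base t).
    by move=> jjs; move/sat_andL: tq; apply; exact: List.in_map.
  exists (epair (epair b base) (epair (emap t a) (emap t base))); split; first by case.
  move=> [q|[q|q]] qjs.
  - by apply/phi1; have /AD/Dp/(_ _ (svalP q)) := At; apply: sat_ext => -[].
  - apply/phi2; have := (sat_aut t (sval q) _).1 (svalP q).
    by apply: sat_ext => -[].
  - by apply/phi3; have := third_t _ qjs; apply: sat_ext => -[].
have cb0 w : c (inl (inl w)) = b w by rewrite cD.
have cm0 z : c (inl (inr z)) = base z by rewrite cD.
have [|t tP] := Chom (a := epair a base) (b := fun y => c (inr y)) (small_sum Klim sV smallM).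
  have h q : sat q (epair a base) -> sat q (fun y => c (inr y)).
    by move=> qa; have /phi2 := cphi (inr (inl (exist _ q qa))).
  move=> q; split; first exact: h.
  by move=> qc; apply: contrapT => nq; exact: (h (fNot q) nq qc).
have ta v : t _ (a v) = c (inr (inl v)) by have := congr1 (fun f => f (inl v)) tP.
have tm z : t _ (base z) = c (inr (inr z)) by have := congr1 (fun f => f (inr z)) tP.
have At : A (to_Gal_L K t).
  apply/AD/Dp => q pq; have /phi1 := cphi (inl (exist _ q pq)).
  by apply: sat_ext => -[v|w] /=; rewrite ?cb0 // -ta.
suff -> : to_Gal_L K s = to_Gal_L K t by [].
apply: to_Gal_L_eq.
have h q : sat q (over_base s) -> sat q (over_base t).
  move=> qs; have /phi3 := cphi (inr (inr (exist _ q qs))).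
  by apply: sat_ext => -[z|z] /=; rewrite ?cm0 // -tm.
move=> q; split; first exact: h.
by move=> qc; apply: contrapT => nq; exact: (h (fNot q) nq qc).
Qed.

Lemma Gal_L_closedE (A : set (Gal_L K C)) : closed A <-> Gal_L_closed A.
Proof.
split=> [|gA]; last first.
  rewrite -openC; exists [set ~` A]; last by rewrite bigcup_set1.
  move=> _ ->; exact: (finI_from1 (@setC _)).
rewrite -openC => -[O OD OE]; rewrite -(setCK A) -OE.
apply: (subbase_closed_ind (D := @Gal_L_closed K L C)) OD => //.
- by apply/Gal_L_closed_canonical; exists [set Bot _] => s; split=> // /(_ _ erefl).
- move=> X Y /Gal_L_closed_canonical[Phi PhiP] /Gal_L_closed_canonical[Psi PsiP].
  apply/Gal_L_closed_canonical.
  exists [set r | exists q1 q2, [/\ Phi q1, Psi q2 & r = fOr q1 q2]] => s.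
  split=> [[/PhiP h|/PsiP h] r [q1 [q2 [h1 h2 ->]]]|h].
  + by apply/sat_or; left; exact: h.
  + by apply/sat_or; right; exact: h.
  + have [Xs|nX] := pselect (X (to_Gal_L K s)); first by left.
    right; apply/PsiP => q2 Psi2.
    have [q1 [Phi1 nq1]] : exists q1, Phi q1 /\ ~ sat q1 (over_base s).
      apply: contrapT => H; apply/nX/PhiP => q1 Phi1; apply: contrapT => nq1.
      by apply: H; exists q1.
    by have /sat_or[] : sat (fOr q1 q2) (over_base s) by apply: h; exists q1, q2.
- move=> F FG; apply/Gal_L_closed_canonical.
  exists [set q | forall s, (\bigcap_(X in F) X) (to_Gal_L K s) -> sat q (over_base s)].
  move=> s; split=> [Fs q|h X FX]; first exact.
  have /FG/Gal_L_closed_canonical[Phi PhiP] := FX.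
  by apply/PhiP => q Phiq; apply: h => t /(_ X FX)/PhiP; exact.
Qed.

(** Restricting to the finitely many coordinates in T makes this invariant relation definable, by
    omega-categoricity. *)
Definition orbit_on W (sw : W -> lsort L) (T : seq W) (a b : env C sw) :=
  exists2 k : aut C, Autf K (E_L K) k & forall w, List.In w T -> k _ (a w) = b w.

Lemma orbit_on_equivalence W (sw : W -> lsort L) T : equivalence (@orbit_on W sw T).
Proof.
have [S1 SM SV] := Autf_subgroup K (@E_L_equivalence L C K).
split=> [a|a b [k kL kab]|a b c [k kL kab] [h hL hbc]].
- by exists 1%g.
- exists k^-1%g => [|w wT]; first exact: SV.
  by rewrite -kab // -[LHS]/((k^-1 * k)%g _ (a w)) mulVg.
- exists (h * k)%g => [|w wT]; first exact: SM.
  by rewrite -[LHS]/(h _ (k _ (a w))) kab // hbc.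
Qed.

Lemma orbit_on_invariant W (sw : W -> lsort L) T (g : aut C) (a b a' b' : env C sw) :
  (forall w, List.In w T -> g _ (a w) = a' w) ->
  (forall w, List.In w T -> g _ (b w) = b' w) -> orbit_on T a b -> orbit_on T a' b'.
Proof.
move=> aa' bb' [k kL kab]; exists (g * k * g^-1)%g.
  exact: (Autf_normal (@E_L_invariant L C K)).
move=> w wT; rewrite -aa' // -bb' // -kab //.
by rewrite -[LHS]/((g * k * g^-1 * g)%g _ (a w)) mulgVK.
Qed.

(** Tuples of the same type over M are in one orbit by [fix_base_Autf_L], and there are boundedly
    many such types. *)
Lemma orbit_on_bounded W (sw : W -> lsort L) T : countable_language L ->
  countable [set: {s & M s}] -> countable [set: W] ->
  bounded_rel K (@orbit_on W sw T).
Proof.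
move=> cL cM cW.
have [_ Esym Etrans] := orbit_on_equivalence sw T.
have /choice[r rP] : forall c : {c | classes (@orbit_on W sw T) c}, exists a : env C sw, sval c = [set y | orbit_on T a y].
  by move=> c; have [a _ ca] := svalP c; exists a.
pose f c := [set p : formula (vsum sw es) | sat p (epair (r c) base)].
apply: (small_card_lt (f := f)).
  move=> c d /(congr1 (fun A p => A p)) fcd; apply: sval_inj; rewrite !rP.
  have [u [uc ufix]] : exists u : aut C, emap u (r c) = r d /\ forall s (z : M s), u s (emb z) = emb z.
    apply: same_type_aut; first exact: small_countable.
    by move=> p; have := congr1 (fun A => A p) fcd; rewrite /f /= => ->.
  have uL := fix_base_Autf_L emb_elem Klim Csat Chom smallM ufix.
  have Ecd : orbit_on T (r c) (r d) by exists u => // w _; rewrite -uc.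
  by apply/seteqP; split=> y /=; apply: Etrans => //; exact: Esym.
apply: small_set => //; apply: small_countable => //.
by apply: formula_countable => //; exact: countable_sum.
Qed.

End LascarGroup.

Lemma Autf_L_sub_KP (L : signature) (C : structure L) K : 
  (Autf K (E_L K) : set (aut C)) `<=` Autf_KP K.
Proof.
move=> u uL V sv a sV E Eeq Edef Ebdd; apply: uL => //.
exact: type_definable0_invariant.
Qed.

Lemma finite_classes X (E : X -> X -> Prop) (l : seq X) : equivalence E ->
  (forall a, exists2 c, List.In c l & E c a) -> finite_set (classes E).
Proof.
move=> [_ Esym Etrans] lE; apply: (list_finite_set (s := [seq [set y | E c y] | c <- l])).
move=> _ [a _ <-]; have [c cl Eca] := lE a.
have -> : [set y | E a y] = [set y | E c y].
  by apply/seteqP; split=> y /=; apply: Etrans => //; exact: Esym.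
exact: (List.in_map (fun c => [set y | E c y])).
Qed.

Section StrongTypes.
Variables (L : signature) (M C : structure L) (emb : forall s, M s -> C s).
Hypothesis emb_elem : elementary emb.
Hypothesis Mcount : countable_structure M.
Hypothesis Mcat : omega_categorical M.
Variable K : Type.
Hypothesis Klim : uncountable_strong_limit K.
Hypothesis Csat : saturated C K.
Hypothesis Chom : strongly_homogeneous C K.

(** Finite definable relations are type-definable and bounded. Conversely, a formula q of the type
    defining E depends on finitely many coordinates. There, lying in one orbit is a definable
    bounded relation, so it has finitely many classes, and u agrees on them with a Lascar-strong k,
    which preserves E. *)
Lemma Autf_KP_Sh : Autf_KP K = Autf_Sh K :> set (aut C).
Proof.
have cL := countable_lang Mcount.
have cM : countable [set: {s & M s}] by case: Mcount.
have sM : small K {s & M s} by exact: small_countable.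
apply/seteqP; split=> [u uKP V sv a sV E Eeq [p Ep] Efin|u uSh V sv a sV E Eeq [p Ep] Ebdd].
  apply: uKP => //.
    exists [set p] => x y; rewrite (propext (Ep x y)).
    by split=> [h _ ->//|]; exact.
  have /countable_injP[f fI] := finite_set_countable Efin.
  apply: (small_card_lt (f := f \o sval) _ (proj1 Klim)).
  move=> [x xE] [y yE] /= /fI xy; apply: sval_inj => /=; apply: xy; exact: mem_set.
apply/Ep => q pq; have [S Sq] := supp_ex q.
pose S' := pmap (fun x => if x is inr v then Some v else None) S.
have inS' v : List.In (inr v) S -> List.In v S'.
  rewrite /S'; elim: (S) => //= -[w|w] T IH [] //=; first by case=> ->; left.
  by move=> /IH; right.
pose t (i : 'I_(size S')) := tnth (in_tuple S') i.
pose W := vsum (fun i => sv (t i)) (@elt_sort L M).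
pose T : seq ('I_(size S') + elt M) := [seq inl i | i <- enum 'I_(size S')].
have inT i : List.In (inl i) T by apply: List.in_map; exact: In_enum.
have cW : countable [set: 'I_(size S') + elt M].
  by apply: countable_sum => //; exact: countable_countType.
have oeq := @orbit_on_equivalence L C K _ W T.
have odef : definable0_rel (@orbit_on L C K _ W T).
  have surj r : exists w, vsum W W w = r.
    by have [z <-] := elt_surj M r; exists (inl (inr z)).
  have [|p' [_ p'P]] := invariant_definable_saturated
      (S := [seq inl w | w <- T] ++ [seq inr w | w <- T]) (D := [set z : env C (vsum W W) |
        orbit_on K T ((fun w => z (inl w)) : env C W) ((fun w => z (inr w)) : env C W)])
      emb_elem Mcount Mcat Klim Csat surj (countable_sum cW cW) Chom.
    move=> g z z' zz'; apply: (orbit_on_invariant (g := g)) => w wT.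
      by apply: (zz' (inl w)); apply/List.in_app_iff; left; exact: List.in_map.
    by apply: (zz' (inr w)); apply/List.in_app_iff; right; exact: List.in_map.
  by exists p' => x y; exact: (p'P (epair x y)).
have obdd : bounded_rel K (@orbit_on L C K _ W T).
  exact: (orbit_on_bounded emb_elem Klim Csat Chom).
have sW : small K ('I_(size S') + elt M) by exact: small_countable.
have [l lP] := definable_bounded_finite Klim Csat sW oeq odef obdd.
have [k kL kT] := uSh _ W (epair (fun i => a (t i)) (base_env emb)) sW _ oeq odef (finite_classes oeq lP).
have := Autf_L_sub_KP kL a sV Eeq (ex_intro _ p Ep) Ebdd.
move=> /Ep /(_ _ pq); apply: Sq => -[//|v] /inS' vS' /=.
have [i iv] := In_tnth vS'; subst v; exact: (kT (inl i) (inT i)).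
Qed.

End StrongTypes.

Local Open Scope group_scope.

(** * The topological group Aut(M) *)

Section AutTopology.
Variables (L : signature) (M : structure L).
Local Notation G := (aut M).

Definition pstab (A : seq {s & M s}) : set G :=
  [set g | forall s x, List.In (existT _ s x) A -> g s x = x].

Lemma pstab_subgroup A : subgroup (pstab A).
Proof.
split=> // [g h gA hA s x xA|g gA s x xA].
  by rewrite -[LHS]/(g s (h s x)) hA // gA.
by rewrite -[in LHS](gA s x xA) -[LHS]/((g^-1 * g) s x) mulVg.
Qed.

Lemma pstab_cat A B g : pstab (A ++ B) g <-> pstab A g /\ pstab B g.
Proof.
split=> [h|[hA hB] s x /List.in_app_iff[]]; [|exact: hA|exact: hB].
by split=> s x xA; apply: h; apply/List.in_app_iff; [left|right].
Qed.

Lemma open_pstab_sub (U : set G) (g : G) : open U -> U g ->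
  exists A, forall h, pstab A h -> U (g * h).
Proof.
move=> oU /oU[A [/finite_set_list[l lP] AU]]; exists l => h hl; apply: AU => s x Ax.
by rewrite -[LHS]/(g s (h s x)) hl //; apply/lP.
Qed.

Lemma pstab_open (U : set G) A :
  (forall g h, U g -> pstab A h -> U (g * h)) -> open U.
Proof.
move=> UA; change (pointwise_open U) => g Ug; exists [set z | List.In z A]; split; first exact: (list_finite_set (s := A)).
move=> h hg; rewrite -(mulVKg g h); apply: UA => // s x xA.
by rewrite -[LHS]/(g^-1 s (h s x)) hg // -[LHS]/((g^-1 * g) s x) mulVg.
Qed.

Lemma subgroup_open (U : set G) A : subgroup U -> pstab A `<=` U -> open U.
Proof. by move=> [_ UM _] AU; apply: (@pstab_open _ A) => g h Ug /AU; exact: UM. Qed.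

Definition map_elts (g : G) (A : seq {s & M s}) : seq {s & M s} :=
  [seq existT _ (projT1 z) (g _ (projT2 z)) | z <- A].

Lemma pstab_conj (g h : G) A : pstab (map_elts g A) h <-> pstab A (g^-1 * h * g).
Proof.
split=> hA s x xA.
  have gx : List.In (existT _ s (g s x)) (map_elts g A).
    exact: (List.in_map (fun z => existT _ (projT1 z) (g _ (projT2 z))) _ _ xA).
  by rewrite -[LHS]/(g^-1 s (h s (g s x))) hA // -[LHS]/((g^-1 * g) s x) mulVg.
move: xA => /List.in_map_iff[[s' y] [e yA]].
have ss := projT1_eq e; rewrite /= in ss; subst s'; rewrite -(existT_inj e).
by rewrite -[in RHS](hA s y yA) -[RHS]/((g * (g^-1 * h * g)) s y) -!mulgA mulVKg.
Qed.

(** Finite index without a choice of representatives: each fibre of f lies in one left coset. *)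
Definition fin_index (U : set G) := exists (F : finType) (f : G -> F),
  forall g h, f g = f h -> U (g^-1 * h).

Lemma fin_index_reps (U : set G) : fin_index U ->
  exists rs : seq G, forall g, exists2 r, List.In r rs & U (r^-1 * g).
Proof.
move=> [F [f fU]].
have /choice[r rP] : forall x, exists r, forall g, f g = x -> f r = x.
  move=> x; have [[r rx]|nx] := pselect (exists r, f r = x); first by exists r.
  by exists 1 => g gx; exfalso; apply: nx; exists g.
exists [seq r x | x <- enum F] => g; exists (r (f g)).
  by apply: List.in_map; exact: In_enum.
by apply: fU; rewrite (rP (f g) g).
Qed.

Definition open_finite (U : set G) :=
  [/\ open U, subgroup U, forall x y, U x -> U (y * x * y^-1) & fin_index U].

Lemma open_finiteT : open_finite setT.
Proof. by split=> //; [exact: openT|exists unit, (fun=> tt)]. Qed.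

Lemma open_finiteI U V : open_finite U -> open_finite V -> open_finite (U `&` V).
Proof.
move=> [oU [U1 UM UV] UN [F [f fU]]] [oV [V1 VM VV] VN [F' [f' fV]]]; split.
- exact: openI.
- split=> // [x y [? ?] [? ?]|x [? ?]]; split; auto.
- by move=> x y [? ?]; split; auto.
- by exists (F * F')%type, (fun g => (f g, f' g)) => g h [/fU ? /fV].
Qed.

Lemma open_finite_bigI (l : seq (set G)) : (forall U, List.In U l -> open_finite U) ->
  open_finite (foldr setI setT l).
Proof.
elim: l => [_|U l IH lP] /=; first exact: open_finiteT.
apply: open_finiteI; first by apply: lP; left.
by apply: IH => V Vl; apply: lP; right.
Qed.

Lemma bigI_sub (l : seq (set G)) U : List.In U l -> foldr setI setT l `<=` U.
Proof. by elim: l => //= V l IH [->|/IH h] g []// _ /h. Qed.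

(** The normal core is the intersection of finitely many conjugates, by coset representatives, so it
    remains open and of finite index. *)
Lemma open_finite_core (U : set G) : open U -> subgroup U -> fin_index U ->
  exists2 V, open_finite V & V `<=` U.
Proof.
move=> oU [U1 UM UV] Ufin; have [rs rsP] := fin_index_reps Ufin.
have [F [f fU]] := Ufin.
pose V := [set g | forall y, U (y^-1 * g * y)].
have VE g : (forall r, List.In r rs -> U (r^-1 * g * r)) -> V g.
  move=> gr y; have [r rrs ry] := rsP y.
  have := UM _ _ (UM _ _ (UV _ ry) (gr _ rrs)) ry.
  by rewrite invgM invgK -!mulgA !mulVKg.
have [A AU] := open_pstab_sub oU U1.
have {}AU h : pstab A h -> U h by move=> /AU; rewrite mul1g.
have VS : subgroup V.
  split=> [y|g h Vg Vh y|g Vg y].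
  - by rewrite mulg1 mulVg.
  - by have := UM _ _ (Vg y) (Vh y); rewrite -!mulgA mulVKg.
  - by have := UV _ (Vg y); rewrite !invgM invgK !mulgA.
exists V; last by move=> g /(_ 1); rewrite invg1 mul1g mulg1.
split=> //.
- apply: (@subgroup_open _ (flatten [seq map_elts r A | r <- rs])) => // g gA.
  apply: VE => r rrs; apply/AU/pstab_conj => s x xr; apply: gA.
  elim: (rs) rrs => //= r' l IH [->|/IH h]; apply/List.in_app_iff; first by left.
  by right.
- move=> g y Vg z; have := Vg (y^-1 * z).
  by rewrite invgM invgK -!mulgA.
- exists {ffun 'I_(size rs) -> F}, (fun g => [ffun i => f ((tnth (in_tuple rs) i)^-1 * g * tnth (in_tuple rs) i)]).
  move=> g h /ffunP gh; apply: VE => r rrs; have [i <-] := In_tnth rrs.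
  have := gh i; rewrite !ffunE => /fU; rewrite !invgM invgK -!mulgA mulVKg.
  by rewrite !mulgA.
Qed.

End AutTopology.

Section DoubleCosets.
Variables (L : signature) (M C : structure L) (emb : forall s, M s -> C s).
Hypothesis emb_elem : elementary emb.
Hypothesis Mcount : countable_structure M.
Hypothesis Mcat : omega_categorical M.
Variable K : Type.
Hypothesis Klim : uncountable_strong_limit K.
Hypothesis Csat : saturated C K.
Local Notation G := (aut M).
Local Notation es := (@elt_sort L M).

Definition pair_env (g : G) : env M (vsum es es) :=
  epair (@elt_env L M) (emap g (@elt_env L M)).

Definition pair_supp (A : seq {s & M s}) : seq (elt M + elt M) :=
  [seq inl z | z <- A] ++ [seq inr z | z <- A].

Lemma pair_suppP A z : List.In z (pair_supp A) <->
  exists2 w, List.In w A & z = inl w \/ z = inr w.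
Proof.
rewrite List.in_app_iff; split.
  by move=> [] /List.in_map_iff[w [<- wA]]; exists w => //; [left|right].
by move=> [w wA [->|->]]; [left|right]; exact: List.in_map.
Qed.

Lemma pair_surj s : exists w, vsum es es w = s.
Proof. by have [z <-] := elt_surj M s; exists (inl z). Qed.

Lemma countable_pair : countable [set: elt M + elt M].
Proof. by apply: countable_sum; exact: countable_elt. Qed.

Lemma pair_aut A (k g h : G) :
  (forall z, List.In z (pair_supp A) -> k _ (pair_env g z) = pair_env h z) ->
  pstab A k /\ pstab A (h^-1 * k * g).
Proof.
move=> kA; split=> s x xA.
  by apply: (kA (inl (existT _ s x))); apply/pair_suppP; exists (existT _ s x) => //; left.
have e : k s (g s x) = h s x.
  by apply: (kA (inr (existT _ s x))); apply/pair_suppP; exists (existT _ s x) => //; right.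
by rewrite -[LHS]/(h^-1 s (k s (g s x))) e -[LHS]/((h^-1 * h) s x) mulVg.
Qed.

(** Roelcke precompactness of G: the double coset of g is determined by the type of A together with
    g(A), and there are finitely many such types. *)
Lemma double_cosets A : exists rs : seq G, forall g,
  exists r, List.In r rs /\ exists h k, [/\ pstab A h, pstab A k & g = h * r * k].
Proof.
have [l [lP lC]] := finite_types emb_elem Mcount Mcat Klim Csat (pair_supp A)
  countable_pair pair_surj.
have /choice[r rP] : forall chi : formula (vsum es es), exists r,
    forall g, sat chi (pair_env g) -> sat chi (pair_env r).
  move=> chi; have [[r rchi]|nr] := pselect (exists r, sat chi (pair_env r)).
    by exists r.
  by exists 1 => g gchi; exfalso; apply: nr; exists g.
exists [seq r chi | chi <- l] => g.
have [chi chil chig] := lC (emap emb (pair_env g)).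
have {}chig : sat chi (pair_env g) by apply/emb_elem.
exists (r chi); split; first exact: List.in_map.
have chir := rP chi g chig; have [a [Schi chia chiall]] := lP _ chil.
have [k kA] : exists k : G, forall z, List.In z (pair_supp A) ->
    k _ (pair_env (r chi) z) = pair_env g z.
  apply: (homogeneous_countable emb_elem Mcount Mcat Klim Csat pair_surj).
  move=> p Sp pr; apply/emb_elem.
  apply/(chiall _ ((emb_elem chi (pair_env g)).1 chig) p Sp).
  apply/(chiall _ ((emb_elem chi (pair_env (r chi))).1 chir) p Sp).
  exact/emb_elem.
have [kA' gA] := pair_aut kA.
have [_ _ AV] := pstab_subgroup A.
exists k, (g^-1 * k * r chi)^-1; split=> //; first exact: AV.
by rewrite !invgM invgK !mulgA mulgK mulgV mul1g.
Qed.

End DoubleCosets.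

(** * Transfer to the elementary extensions *)

Lemma elementary_fint (L : signature) (N X : structure L) (f : forall s, N s -> X s)
    (k : fsym L) (a : forall i : fargs k, N (fdom i)) :
  elementary f -> f _ (fint a) = fint (fun i => f _ (a i)).
Proof.
move=> fe; pose si := vext (@fdom L k) (fcod k).
pose p : formula si := Equ (@App L _ si k (fun i => Var si (Some i))) (Var si None).
have h : sat p (emap f (econs a (fint a))) := (fe _ _ p (econs a (fint a))).1 erefl.
exact: esym h.
Qed.

Section GroupTerms.
Variables (L : signature) (M : structure L).
Local Notation GL := (gsig M).
Local Notation gs := (None : lsort GL).
Variables (V : Type) (sw : V -> lsort GL).

Definition tMul (t u : term sw gs) : term sw gs :=
  @App GL _ sw (Mul L) (fun b : bool => if b then t else u).
Definition tInv (t : term sw gs) : term sw gs := @App GL _ sw (Inv L) (fun _ => t).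
Definition tAct (t : term sw gs) s (u : term sw (Some s : lsort GL)) :
    term sw (Some s : lsort GL) :=
  @App GL _ sw (Act s) (fun b : bool =>
    match b return term sw (if b then None else Some s : lsort GL) with
    | true => t | false => u end).
Definition fIn (U : open_subset M) (t : term sw gs) : formula sw :=
  @Rel GL _ sw (inr U) (fun _ => t).

Variable X : structure GL.

Lemma eval_tMul (b : env X sw) t u :
  eval b (tMul t u) = gmul (M := M) (eval b t) (eval b u).
Proof.
rewrite /gmul /=; congr (@fint GL X (Mul L)).
by apply: functional_extensionality_dep => -[].
Qed.

Lemma eval_tInv (b : env X sw) t : eval b (tInv t) = ginv (M := M) (eval b t).
Proof. by []. Qed.

Lemma eval_tAct (b : env X sw) t s (u : term sw (Some s : lsort GL)) :
  eval b (tAct t u) = gact (M := M) (eval b t) (eval b u).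
Proof.
rewrite /gact /=; congr (@fint GL X (Act s)).
by apply: functional_extensionality_dep => -[].
Qed.

Lemma sat_fIn (b : env X sw) U t : sat (fIn U t) b <-> interp U (eval b t).
Proof. by []. Qed.

End GroupTerms.

Section Transfer.
Variables (L : signature) (M : structure L) (X : elext (with_group M)).
Local Notation GL := (gsig M).
Local Notation gs := (None : lsort GL).
Local Notation G := (aut M).
Local Notation GX := (gsort X).
Local Notation N := (with_group M).

Definition gemb (g : G) : GX := @ext_emb _ _ X None g.
Definition pemb s (x : M s) : X (Some s) := @ext_emb _ _ X (Some s) x.

Lemma reduct_elem : @elementary L M (reduct N) (fun _ => id).
Proof. by apply: iso_elementary; split=> // s; exists id. Qed.

Lemma pemb_elem : @elementary L M (reduct X) pemb.
Proof.
move=> V sv p a.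
pose sw (v : V) : lsort GL := Some (sv v).
have := @ext_elem _ _ X _ sw (trans (M := M) p (fun v => Var sw v)) (a : env N sw).
rewrite !(propext (sat_trans _ _ _)) => h.
rewrite (propext (reduct_elem p a)); exact: h.
Qed.

Lemma gembM g h : gemb (g * h) = gemb g * gemb h.
Proof.
apply: etrans (@elementary_fint GL N X _ (Mul L)
  (fun b : bool => if b then g else h) (@ext_elem _ _ X)) _.
congr (@fint GL X (Mul L)).
by apply: functional_extensionality_dep => -[].
Qed.

Lemma gembV g : gemb g^-1 = (gemb g)^-1.
Proof. exact: (@elementary_fint GL N X _ (Inv L) (fun _ => g) (@ext_elem _ _ X)). Qed.

Lemma gemb1 : gemb 1 = 1.
Proof.
have : gemb 1 * gemb 1 = gemb 1 by rewrite -gembM mulg1.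
by move=> /(congr1 (fun x => x * (gemb 1)^-1)); rewrite mulgK mulgV.
Qed.

Lemma gact_pemb g s (x : M s) : gact (gemb g) (pemb x) = pemb (g s x).
Proof.
apply/esym; apply: etrans (@elementary_fint GL N X _ (Act s)
  (fun b : bool => match b return N (if b then None else Some s) with
                   | true => g | false => x end) (@ext_elem _ _ X)) _.
congr (@fint GL X (Act s)).
by apply: functional_extensionality_dep => -[].
Qed.

Lemma interp_gemb U g : interp U (gemb g) <-> sval U g.
Proof.
have := @ext_elem _ _ X unit (fun _ => gs) (fIn U (Var _ tt)) (fun _ => g).
by move=> h; split=> /h.
Qed.

Section GroupVariables.
Variables (V : Type) (P : set V).
Local Notation gv := (fun _ : V => gs).

Lemma group_valid (p : formula gv) (c : V -> G) :
  (forall a : V -> G, (forall v, P v -> a v = c v) -> sat (M := N) p a) ->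
  forall a : V -> GX, (forall v, P v -> a v = gemb (c v)) -> sat (M := X) p a.
Proof.
exact: (@elem_valid GL N X _ (@ext_elem _ _ X) V gv P p (c : env N gv)).
Qed.
End GroupVariables.

Lemma interp_sub U W (x : GX) : sval U `<=` sval W -> interp U x -> interp W x.
Proof.
move=> UW.
have := @group_valid unit set0 (Imp (fIn U (Var _ tt)) (fIn W (Var _ tt)))
  (fun=> 1) _ (fun=> x).
apply=> // a _ /=; exact: UW.
Qed.

Lemma interp_mul U V W (x y : GX) : (forall g h, sval U g -> sval V h -> sval W (g * h)) ->
  interp U x -> interp V y -> interp W (x * y).
Proof.
move=> UVW xU yV.
have H : sat (M := X) (Imp (fIn U (Var _ true)) (Imp (fIn V (Var _ false))
    (fIn W (tMul (Var _ true) (Var _ false)))))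
    (fun b : bool => if b then x else y).
  apply: (@group_valid bool set0 _ (fun=> 1)) => // a _.
  apply/sat_imp => aU; apply/sat_imp => aV.
  by apply/sat_fIn; rewrite eval_tMul; exact: UVW.
by move: H => /sat_imp/(_ xU)/sat_imp/(_ yV)/sat_fIn; rewrite eval_tMul.
Qed.

Lemma interp_inv U W (x : GX) : (forall g, sval U g -> sval W g^-1) ->
  interp U x -> interp W x^-1.
Proof.
move=> UW xU.
have H : sat (M := X) (Imp (fIn U (Var _ tt)) (fIn W (tInv (Var _ tt)))) (fun _ : unit => x).
  apply: (@group_valid unit set0 _ (fun=> 1)) => // a _; apply/sat_imp => aU.
  by apply/sat_fIn; rewrite eval_tInv; exact: UW.
exact: H xU.
Qed.

Lemma interp_conj U W (x y : GX) : (forall g h, sval U g -> sval W (h * g * h^-1)) ->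
  interp U x -> interp W (y * x * y^-1).
Proof.
move=> UW xU.
have H : sat (M := X) (Imp (fIn U (Var _ true))
    (fIn W (tMul (tMul (Var _ false) (Var _ true)) (tInv (Var _ false)))))
    (fun b : bool => if b then x else y).
  apply: (@group_valid bool set0 _ (fun=> 1)) => // a _; apply/sat_imp => aU.
  by apply/sat_fIn; rewrite !eval_tMul; exact: UW.
by move: H => /sat_imp/(_ xU)/sat_fIn; rewrite !eval_tMul.
Qed.

Lemma interp_coset (U : open_subset M) (rs : seq G) :
  (forall g, exists2 r, List.In r rs & sval U (r^-1 * g)) ->
  forall x : GX, exists2 r, List.In r rs & interp U ((gemb r)^-1 * x).
Proof.
move=> rsP x; pose I := 'I_(size rs); pose r (i : I) := tnth (in_tuple rs) i.
pose gv := fun _ : option I => gs.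
pose t (i : I) : formula gv := fIn U (tMul (tInv (Var gv (Some i))) (Var gv None)).
have H : sat (M := X) (fOrL [seq t i | i <- enum I])
    (fun o => if o is Some i then gemb (r i) else x).
  apply: (@group_valid _ [set o | exists i : I, o = Some i] _ (fun o => if o is Some i then r i else 1)); last first.
    by move=> _ [i ->].
  move=> a aP; have [r0 r0rs rU] := rsP (a None).
  have [i ir] := In_tnth r0rs; apply/sat_orL; exists (t i).
    by apply: List.in_map; exact: In_enum.
  apply/sat_fIn; rewrite eval_tMul eval_tInv /= (aP (Some i)); last by exists i.
  by rewrite /r ir.
move: H => /sat_orL[p /List.in_map_iff[i [<- _]] /sat_fIn]; rewrite eval_tMul eval_tInv /= => h.
by exists (r i) => //; exact: tnth_In.
Qed.

Lemma interp_double_coset (U : open_subset M) (rs : seq G) :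
  (forall g, exists r, List.In r rs /\
     exists h k, [/\ sval U h, sval U k & g = h * r * k]) ->
  forall x : GX, exists r, List.In r rs /\
     exists h k : GX, [/\ interp U h, interp U k & x = h * gemb r * k].
Proof.
move=> rsP x; pose I := 'I_(size rs); pose r (i : I) := tnth (in_tuple rs) i.
pose gv := fun _ : option I => gs.
pose gv2 := vext (vext gv gs) gs.
pose h0 : term gv2 gs := Var gv2 (Some None).
pose k0 : term gv2 gs := Var gv2 None.
pose t (i : I) : formula gv := fEx (fEx (fAnd (fAnd (fIn U h0) (fIn U k0))
  (Equ (Var gv2 (Some (Some None))) (tMul (tMul h0 (Var gv2 (Some (Some (Some i))))) k0)))).
have tP (Y : structure GL) (i : I) (b : env Y gv) : sat (t i) b <->
    exists h k, [/\ interp U h, interp U k &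
      b None = gmul (M := M) (gmul (M := M) h (b (Some i))) k].
  rewrite /t (propext (sat_ex _ _)); split.
    move=> [h /sat_ex[k /sat_and[/sat_and[hU kU] /sat_equ e]]]; exists h, k; split=> //.
    by rewrite !eval_tMul in e.
  move=> [h [k [hU kU e]]]; exists h; apply/sat_ex; exists k; apply/sat_and; split.
    exact/sat_and.
  by apply/sat_equ; rewrite !eval_tMul.
have H : sat (M := X) (fOrL [seq t i | i <- enum I])
    (fun o => if o is Some i then gemb (r i) else x).
  apply: (@group_valid _ [set o | exists i : I, o = Some i] _ (fun o => if o is Some i then r i else 1)); last first.
    by move=> _ [i ->].
  move=> a aP; have [r0 [r0rs [h [k [hU kU e]]]]] := rsP (a None).
  have [i ir] := In_tnth r0rs; apply/sat_orL; exists (t i).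
    by apply: List.in_map; exact: In_enum.
  apply/tP; exists h, k; split=> //; rewrite e (aP (Some i)); last by exists i.
  by rewrite /r ir.
move: H => /sat_orL[p /List.in_map_iff[i [<- _]] /tP[h [k [hU kU e]]]].
exists (r i); split; first exact: tnth_In.
by exists h, k.
Qed.

Lemma interp_pstab A (U : open_subset M) (x : GX) : pstab A `<=` sval U ->
  (forall s (z : M s), List.In (existT _ s z) A -> gact x (pemb z) = pemb z) -> interp U x.
Proof.
move=> AU xA; pose I := 'I_(size A); pose z (i : I) := tnth (in_tuple A) i.
pose sw (o : option I) : lsort GL := if o is Some i then Some (projT1 (z i)) else None.
pose e (i : I) : formula sw :=
  Equ (tAct (Var sw None : term sw gs) (Var sw (Some i) : term sw (Some (projT1 (z i)) : lsort GL)))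
    (Var sw (Some i) : term sw (Some (projT1 (z i)) : lsort GL)).
pose b : env X sw := fun o => match o return X (sw o) with
  Some i => pemb (projT2 (z i)) | None => x end.
pose c : env N sw := fun o => match o return N (sw o) with
  Some i => projT2 (z i) | None => (1 : G) end.
have H : sat (Imp (fAndL [seq e i | i <- enum I]) (fIn U (Var sw None))) b.
  apply: (elem_valid (@ext_elem _ _ X) (P := [set o | exists i : I, o = Some i]) (c := c)); last first.
    by move=> _ [i ->].
  move=> a aP; apply/sat_imp => /sat_andL ae.
  suff : sval U (a None : G) by [].
  apply: AU => s y yA; have [i iy] := In_tnth yA.
  have : sat (e i) a by apply: ae; apply: List.in_map; exact: In_enum.
  move=> /sat_equ; rewrite eval_tAct /= (aP (Some i)) => [h|]; last by exists i.
  have : forall w, z i = w -> (a None : G) (projT1 w) (projT2 w) = projT2 w.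
    by move=> w <-.
  by move=> /(_ _ iy).
move/sat_imp: H; apply; apply/sat_andL => p /List.in_map_iff[i [<- _]].
apply/sat_equ; rewrite eval_tAct /=; apply: xA.
by have := tnth_In i; rewrite -/(z i); case: (z i).
Qed.

Lemma gact_mul (x y : GX) s (w : X (Some s)) :
  gact (x * y : GX) w = gact x (gact y w).
Proof.
pose sw (o : option bool) : lsort GL := if o is Some i then None else Some s.
pose vx : term sw gs := Var sw (Some true).
pose vy : term sw gs := Var sw (Some false).
pose vw : term sw (Some s : lsort GL) := Var sw None.
pose b : env X sw := fun o => match o return X (sw o) with
  Some i => if i then x else y | None => w end.
have [z0] := inhab M s.
pose c : env N sw := fun o => match o return N (sw o) with
  Some i => (1 : G) | None => z0 end.
have H : sat (Equ (tAct (tMul vx vy) vw) (tAct vx (tAct vy vw))) b.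
  apply: (elem_valid (@ext_elem _ _ X) (P := set0) (c := c)) => //.
by have := (sat_equ _ _ b).1 H; rewrite !eval_tAct !eval_tMul.
Qed.

(** G acts on M by automorphisms; for each formula this is a first-order statement, which passes to
    X. *)
Lemma gact_sat V (sv : V -> lsort L) (p : formula sv) (x : GX)
    (b : env (reduct X) sv) :
  sat p b <-> sat p (fun v => gact x (b v) : reduct X (sv v)).
Proof.
suff H q : sat q b -> sat q (fun v => gact x (b v) : reduct X (sv v)).
  split=> [|pb]; first exact: H.
  by apply: contrapT => np; exact: H (fNot p) np pb.
pose sw (o : option V) : lsort GL := if o is Some v then Some (sv v) else None.
pose u v : term sw (Some (sv v) : lsort GL) := Var sw (Some v).
pose vx : term sw gs := Var sw None.
pose b' : env X sw := fun o => match o return X (sw o) with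
  Some v => b v | None => x end.
have /dchoice[c0 _] : forall v, exists z : M (sv v), True.
  by move=> v; case: (inhab M (sv v)) => z; exists z.
pose c : env N sw := fun o => match o return N (sw o) with
  Some v => c0 v | None => (1 : G) end.
have E (Y : structure GL) (d : env Y sw) :
    (fun v => eval d (tAct vx (u v)) : reduct Y (sv v)) =
    (fun v => gact (M := M) (d None : Y None) (d (Some v) : Y (Some (sv v))) : reduct Y (sv v)).
  by apply: functional_extensionality_dep => v; rewrite eval_tAct.
have H : sat (Imp (trans q u) (trans q (fun v => tAct vx (u v)))) b'.
  apply: (elem_valid (@ext_elem _ _ X) (P := set0) (c := c)) => // a _.
  apply/sat_imp => /sat_trans qa; apply/sat_trans; rewrite E.
  apply/(reduct_elem q (fun v => (a None : G) _ (a (Some v) : M (sv v)))).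
  apply/(sat_aut (a None : G) q (fun v => a (Some v) : M (sv v))).
  by apply/reduct_elem.
move: H => /sat_imp H qb.
have /H/sat_trans : sat (trans q u) b' by apply/sat_trans.
by rewrite E.
Qed.

(** The equivalence of O with p(m, g(m)) is a first-order statement about g with parameters in M, so
    it holds in X. Membership in interpreted open sets is thereby read off from the action on M. *)
Lemma interp_trans (O : open_subset M) (p : formula (vsum (@elt_sort L M) (@elt_sort L M))) :
  (forall g : G, sval O g <-> sat p (pair_env g)) ->
  forall x : GX, interp O x <->
    sat (M := reduct X) p (epair (fun z : elt M => pemb (projT2 z) : reduct X (elt_sort z))
                 (fun z : elt M => gact x (pemb (projT2 z)) : reduct X (elt_sort z))).
Proof.
move=> Op x; pose es := @elt_sort L M.
pose sw (o : option (elt M)) : lsort GL := if o is Some v then Some (es v) else None.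
pose vx : term sw gs := Var sw None.
pose u v : term sw (Some (es v) : lsort GL) := Var sw (Some v).
pose tau (y : elt M + elt M) : term sw (Some (vsum es es y) : lsort GL) :=
  match y return term sw (Some (vsum es es y) : lsort GL) with
  | inl v => u v | inr v => tAct vx (u v) end.
pose b : env X sw := fun o => match o return X (sw o) with
  Some z => pemb (projT2 z) | None => x end.
pose c : env N sw := fun o => match o return N (sw o) with
  Some z => projT2 z | None => (1 : G) end.
have E (Y : structure GL) (d : env Y sw) :
    (fun y => eval d (tau y) : reduct Y (vsum es es y)) =
    epair (M := reduct Y) (fun v => d (Some v) : reduct Y (es v))
      (fun v => gact (M := M) (d None : Y None) (d (Some v) : Y (Some (es v))) : reduct Y (es v)).
  apply: functional_extensionality_dep => -[v|v]; first by [].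
  by rewrite -[LHS]/(eval d (tAct vx (u v))) eval_tAct.
have aE (a : env N sw) : (forall v, [set o | exists z : elt M, o = Some z] v -> a v = c v) ->
    sat (trans p tau) a <-> sval O (a None : G).
  move=> aP; rewrite (propext (sat_trans _ _ _)) E (propext (Op _)).
  rewrite (propext (reduct_elem p (pair_env (a None : G)))).
  split; apply: sat_ext => -[z|z] /=.
  - by rewrite (aP (Some z)) //; exists z.
  - by rewrite (aP (Some z)) //; exists z.
  - by rewrite (aP (Some z)) //; exists z.
  - by rewrite (aP (Some z)) //; exists z.
have bP v : [set o | exists z : elt M, o = Some z] v -> b v = @ext_emb _ _ X _ (c v).
  by move=> [z ->].
have H1 : sat (Imp (fIn O vx) (trans p tau)) b.
  apply: (elem_valid (@ext_elem _ _ X) (P := [set o | exists z : elt M, o = Some z]) (c := c)) => // a aP.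
  by apply/sat_imp => Oa; apply/(aE a aP).
have H2 : sat (Imp (trans p tau) (fIn O vx)) b.
  apply: (elem_valid (@ext_elem _ _ X) (P := [set o | exists z : elt M, o = Some z]) (c := c)) => // a aP.
  by apply/sat_imp => /(aE a aP).
have -> : interp O x <-> sat (trans p tau) b.
  by split; [move/sat_imp: H1; exact|move/sat_imp: H2; exact].
by rewrite (propext (sat_trans _ _ _)) E.
Qed.

Lemma interp_forall (U : open_subset M) V (sv : V -> lsort L) (p : formula (vsum sv sv)) :
  (forall g : G, sval U g -> forall e : env M sv, sat p (epair e (emap g e))) ->
  forall x : GX, interp U x -> forall y : env (reduct X) sv,
    sat p (epair y (fun v => gact x (y v) : reduct X (sv v))).
Proof.
move=> Up x xU y.
pose sw (o : option V) : lsort GL := if o is Some v then Some (sv v) else None.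
pose vx : term sw gs := Var sw None.
pose u v : term sw (Some (sv v) : lsort GL) := Var sw (Some v).
pose tau (w : V + V) : term sw (Some (vsum sv sv w) : lsort GL) :=
  match w return term sw (Some (vsum sv sv w) : lsort GL) with
  | inl v => u v | inr v => tAct vx (u v) end.
pose b : env X sw := fun o => match o return X (sw o) with
  Some v => y v | None => x end.
have /dchoice[c0 _] : forall v, exists z : M (sv v), True.
  by move=> v; case: (inhab M (sv v)) => z; exists z.
pose c : env N sw := fun o => match o return N (sw o) with
  Some v => c0 v | None => (1 : G) end.
have E (Y : structure GL) (d : env Y sw) :
    (fun w => eval d (tau w) : reduct Y (vsum sv sv w)) =
    epair (M := reduct Y) (fun v => d (Some v) : reduct Y (sv v))
      (fun v => gact (M := M) (d None : Y None) (d (Some v) : Y (Some (sv v))) : reduct Y (sv v)).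
  apply: functional_extensionality_dep => -[v|v]; first by [].
  by rewrite -[LHS]/(eval d (tAct vx (u v))) eval_tAct.
have H : sat (Imp (fIn U vx) (trans p tau)) b.
  apply: (elem_valid (@ext_elem _ _ X) (P := set0) (c := c)) => // a _.
  apply/sat_imp => Ua; apply/sat_trans; rewrite E.
  have := (reduct_elem p (epair (fun v => a (Some v) : M (sv v)) (emap (a None : G) (fun v => a (Some v) : M (sv v))))).1 (Up _ Ua _).
  by apply: sat_ext => -[].
by move/sat_imp: H => /(_ xU)/sat_trans; rewrite E.
Qed.

Hypothesis Mcount : countable_structure M.
Hypothesis Mcat : omega_categorical M.
Variable K : Type.
Hypothesis Klim : uncountable_strong_limit K.
Hypothesis Xsat : saturated (reduct X) K.

(** Homogeneity of M in first-order form: of two tuples satisfying the isolating formula chi, some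
    group element maps the first to the second. This passes to X. *)
Lemma group_element_exists V (sv : V -> lsort L) (S : seq V) (c d : env (reduct X) sv) :
  countable [set: V] -> (forall s, exists v, sv v = s) ->
  (forall p, supp S p -> sat p c -> sat p d) ->
  exists x : GX, forall v, List.In v S -> gact x (c v) = d v.
Proof.
move=> cV svS cd.
have [chi [Schi chic chiall]] :=
  finite_tuple_isolated pemb_elem Mcount Mcat Klim Xsat S c cV svS.
have chid := cd _ Schi chic.
pose sw (w : V + V) : lsort GL := Some (vsum sv sv w).
pose sw' := vext sw gs.
pose u v : term sw (Some (sv v) : lsort GL) := Var sw (inl v).
pose u' v : term sw (Some (sv v) : lsort GL) := Var sw (inr v).
pose e v : formula sw' := Equ (tAct (Var sw' None : term sw' gs)
    (Var sw' (Some (inl v)) : term sw' (Some (sv v) : lsort GL)))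
  (Var sw' (Some (inr v)) : term sw' (Some (sv v) : lsort GL)).
pose b : env X sw := fun w => match w return X (sw w) with
  inl v => c v | inr v => d v end.
have /dchoice[c0 _] : forall w, exists z : N (sw w), True.
  by move=> w; case: (inhab N (sw w)) => z; exists z.
have H : sat (Imp (trans chi u) (Imp (trans chi u') (fEx (fAndL [seq e v | v <- S])))) b.
  apply: (elem_valid (@ext_elem _ _ X) (P := set0) (c := c0)) => // a _.
  pose a1 : env M sv := fun v => a (inl v).
  pose a2 : env M sv := fun v => a (inr v).
  apply/sat_imp => /sat_trans/(reduct_elem chi a1)/pemb_elem h1.
  apply/sat_imp => /sat_trans/(reduct_elem chi a2)/pemb_elem h2.
  have [g gP] : exists g : G, forall v, List.In v S -> g _ (a1 v) = a2 v.
    apply: (homogeneous_countable pemb_elem Mcount Mcat Klim Xsat svS) => p Sp.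
    move=> /pemb_elem/(chiall _ h1 p Sp) pc.
    by apply/pemb_elem/(chiall _ h2 p Sp).
  apply/sat_ex; exists (g : N None); apply/sat_andL => p /List.in_map_iff[v [<- vS]].
  by apply/sat_equ; rewrite eval_tAct /=; exact: gP.
have h1 : sat (trans chi u) b by apply/sat_trans.
have h2 : sat (trans chi u') b by apply/sat_trans.
move: H => /sat_imp/(_ h1)/sat_imp/(_ h2)/sat_ex[x /sat_andL xP].
exists x => v vS.
have /sat_equ : sat (e v) (econs b x) by apply: xP; exact: List.in_map.
by rewrite eval_tAct.
Qed.

End Transfer.

(** * Coherent families of cosets *)

Lemma count_sub_eq (T : Type) (p q : pred T) (s : seq T) : (forall x, p x -> q x) ->
  count q s <= count p s -> forall x, List.In x s -> q x -> p x.
Proof.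
move=> pq; have le t : count p t <= count q t by apply: sub_count => x; exact: pq.
elim: s => //= y s IH ls x [<-|xs] qx.
  apply: contraTT ls => npy; rewrite qx (negbTE npy) -ltnNge add0n add1n ltnS; exact: le.
apply: IH => //; rewrite leqNgt; apply/negP => lt.
have : p y + count p s < q y + count q s.
  rewrite -addnS; apply: leq_add => //.
  by case: (p y) (pq y) => // ->.
by rewrite ltnNge ls.
Qed.

Section Coherent.
Variables (L : signature) (M C : structure L) (emb : forall s, M s -> C s).
Hypothesis emb_elem : elementary emb.
Hypothesis Mcount : countable_structure M.
Hypothesis Mcat : omega_categorical M.
Variable K : Type.
Hypothesis Klim : uncountable_strong_limit K.
Hypothesis Csat : saturated C K.
Local Notation G := (aut M).

(** For a normal subgroup U, this says that x lies in the group G_A U. *)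
Definition coset_meets (A : seq {s & M s}) (U : set G) (x : G) :=
  exists h, pstab A h /\ U (h^-1 * x).

Lemma coset_meets_double A (U : set G) x h k : open_finite U -> pstab A h -> pstab A k ->
  coset_meets A U x -> coset_meets A U (h * x * k).
Proof.
move=> [_ [U1 UM UV] UN _] hA kA [h0 [h0A h0U]].
have [_ AM AV] := pstab_subgroup A.
exists (h * h0 * k); split; first exact/AM/kA/AM.
have := UN _ k^-1 h0U; rewrite invgK !invgM.
by rewrite -!mulgA mulKg.
Qed.

(* Among the sets G_A U, unions of finitely many double cosets of G_A, the one *)
(* containing the least number of double cosets is the least.                  *)
Lemma least_coset_meets A : exists U0 : set G, open_finite U0 /\
  forall U, open_finite U -> forall x, coset_meets A U0 x -> coset_meets A U x.
Proof.
have [rs rsP] := double_cosets emb_elem Mcount Mcat Klim Csat A.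
pose cnt U := count (fun r => `[< coset_meets A U r >]) rs.
pose Q n := `[< exists U, open_finite U /\ cnt U = n >].
have exQ : exists n, Q n.
  by exists (cnt setT); apply/asboolP; exists setT; split=> //; exact: open_finiteT.
case: (ex_minnP exQ) => n /asboolP[U0 [oU0 U0n]] nmin; exists U0; split=> // U oU x xU0.
have oUU := open_finiteI oU0 oU.
have [r [rrs [h [k [hA kA xE]]]]] := rsP x.
have [_ AM AV] := pstab_subgroup A.
have rU0 : coset_meets A U0 r.
  have -> : r = h^-1 * x * k^-1 by rewrite xE !mulgA mulVg mul1g mulgK.
  by apply: coset_meets_double => //; exact: AV.
rewrite xE; apply: coset_meets_double => //.
have /asboolP[h1 [h1A [_ h1U]]] : `[< coset_meets A (U0 `&` U) r >].
  apply: (@count_sub_eq _ (fun r => `[< coset_meets A (U0 `&` U) r >])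
     (fun r => `[< coset_meets A U0 r >]) rs _ _ r rrs); last exact/asboolP.
    by move=> y /asboolP[h1 [h1A [h1U _]]]; apply/asboolP; exists h1.
  rewrite -/(cnt U0) U0n; apply: nmin; apply/asboolP.
  by exists (U0 `&` U).
by exists h1.
Qed.

Definition coherent (gam : set G -> G) := forall U V, open_finite U -> open_finite V ->
  V `<=` U -> U ((gam U)^-1 * gam V).

(** For each U, some element of the coset of [gam U] agrees with g on A. *)
Definition approximates (gam : set G -> G) A (g : G) :=
  forall U, open_finite U -> coset_meets A U (g^-1 * gam U).

(** Choose h for the U0 given by [least_coset_meets] at A'. For any U, coherence puts (g h)^-1
    gam(U0 & U) into U0, hence by minimality into G_A' U, and gam(U0 & U) and gam(U) agree modulo
    U. *)
Lemma approximates_extend gam A A' g : coherent gam -> approximates gam A g ->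
  exists h, pstab A h /\ approximates gam A' (g * h).
Proof.
move=> gamc Ag; have [U0 [oU0 U0min]] := least_coset_meets A'.
have [h [hA hU0]] := Ag _ oU0; exists h; split=> // U oU.
have oUU := open_finiteI oU0 oU.
have [_ [_ UM UV] _ _] := oU; have [_ [_ UM0 UV0] _ _] := oU0.
have [|h' [h'A' h'U]] := U0min U oU ((g * h)^-1 * gam (U0 `&` U)).
  exists 1; split; first by have [] := pstab_subgroup A'.
  rewrite invg1 mul1g.
  have := UM0 _ _ hU0 (gamc _ _ oU0 oUU (@subIsetl _ _ _)).
  by rewrite invgM -!mulgA mulVKg.
exists h'; split=> //.
have := UM _ _ h'U (UV _ (gamc _ _ oU oUU (@subIsetr _ _ _))).
by rewrite !invgM invgK -!mulgA mulVKg.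
Qed.

Lemma coherentV gam : coherent gam -> coherent (fun U => (gam U)^-1).
Proof.
move=> gamc U V oU oV VU; have [_ [_ _ UV] UN _] := oU.
have := UN _ (gam V) (UV _ (gamc U V oU oV VU)).
by rewrite !invgM !invgK !mulgA mulgV mul1g.
Qed.

Lemma approximatesV gam A g : approximates gam A g ->
  approximates (fun U => (gam U)^-1) (map_elts g A) g^-1.
Proof.
move=> Ag U oU; have [h [hA hU]] := Ag U oU.
have [_ [_ _ UV] UN _] := oU; have [_ _ AV] := pstab_subgroup A.
exists (g * h^-1 * g^-1); split.
  by apply/pstab_conj; rewrite !mulgA mulVg mul1g mulgVK; exact: AV.
have := UN _ (g * h) (UV _ hU).
by rewrite !invgM !invgK -!mulgA mulVKg mulgV mulg1 mulKg.
Qed.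

Definition graph_list A (g : G) := [seq pair_of (projT2 z) (g _ (projT2 z)) | z <- A].

Lemma graph_listP A g s (x y : M s) :
  List.In (pair_of x y) (graph_list A g) <-> List.In (existT _ s x) A /\ y = g s x.
Proof.
rewrite List.in_map_iff; split=> [[[s' x'] [e xA]]|[xA ->]].
  have ss := projT1_eq e; rewrite /= in ss; subst s'.
  by have /= [<- <-] := existT_inj e.
by exists (existT _ s x).
Qed.

(** Graphs of finite approximations form a back-and-forth system, the back steps being forth steps
    for the inverse family. The limit agrees with an approximation on a list whose stabiliser lies
    in U, so it lies in the coset of [gam U]. *)
Lemma coherent_limit gam : coherent gam ->
  exists g, forall U, open_finite U -> U (g^-1 * gam U).
Proof.
move=> gamc.
pose F := [set l | exists A g, approximates gam A g /\ l = graph_list A g].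
have F0 : F nil.
  by exists nil, 1; split=> // U oU; exists (gam U); split=> //; rewrite invg1 mul1g mulVg; have [_ []] := oU.
have Fpe : F `<=` @partial_elementary L M.
  move=> _ [A [g [_ ->]]] V sv a b S ab p Sp pa.
  by have := (sat_aut g p a).1 pa; apply: Sp => v /ab/graph_listP[].
have [||g [_ gP]] := back_and_forth Mcount Fpe _ _ F0.
- move=> _ s x [A [g [gA ->]]].
  have [h [hA gh]] := approximates_extend (existT _ s x :: A) gamc gA.
  exists ((g * h) s x), (graph_list (existT _ s x :: A) (g * h)); split.
  + by exists (existT _ s x :: A), (g * h).
  + move=> [r [y z]] /graph_listP[yA ->]; apply/graph_listP; split; first by right.
    by rewrite -[RHS]/(g r (h r y)) hA.
  + by apply/graph_listP; split=> //; left.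
- move=> _ s y [A [g [gA ->]]].
  have [h [hA gh]] := approximates_extend (existT _ s y :: map_elts g A) (coherentV gamc)
    (approximatesV gA).
  have := approximatesV gh.
  have -> : (fun U => (gam U)^-1^-1) = gam.
    by apply: functional_extensionality_dep => U; rewrite invgK.
  rewrite invgM invgK; set A2 := map_elts _ _ => A2h.
  exists ((g^-1 * h) s y), (graph_list A2 (h^-1 * g)); split.
  + by exists A2, (h^-1 * g).
  + move=> [r [x z]] /graph_listP[xA ->]; apply/graph_listP; split.
      have -> : x = (g^-1 * h) r (g r x).
        have gxA : List.In (existT _ r (g r x)) (map_elts g A).
          exact: (List.in_map (fun z => existT _ (projT1 z) (g _ (projT2 z))) _ _ xA).
        rewrite -[RHS]/(g^-1 r (h r (g r x))) hA //.
        by rewrite -[RHS]/((g^-1 * g) r x) mulVg.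
      right; apply: (List.in_map (fun z => existT _ (projT1 z) ((g^-1 * h) _ (projT2 z)))
        _ (existT _ r (g r x))).
      exact: (List.in_map (fun z => existT _ (projT1 z) (g _ (projT2 z))) _ _ xA).
    have [_ _ AV] := pstab_subgroup (map_elts g A).
    rewrite -[RHS]/(h^-1 r (g r x)); apply/esym; apply: (AV _ hA).
    exact: (List.in_map (fun z => existT _ (projT1 z) (g _ (projT2 z))) _ _ xA).
  + apply/graph_listP; split; first by left.
    by rewrite -[RHS]/((h^-1 * g * (g^-1 * h)) s y) -!mulgA mulVKg mulVg.
exists g => U oU; have [opU [U1 UM UV] UN _] := oU.
have [A0 A0U] := open_pstab_sub opU U1.
have [_ [[A [g' [gA ->]]] A0l _]] := gP A0.
have A0A s x : List.In (existT _ s x) A0 -> List.In (existT _ s x) A /\ g s x = g' s x.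
  by move=> /A0l/graph_listP.
have [h [hA hU]] := gA _ oU.
have gg : U (g^-1 * g').
  rewrite -[g^-1 * g']mul1g; apply: A0U => s x xA; have [_ e] := A0A _ _ xA.
  by rewrite -[LHS]/(g^-1 s (g' s x)) -e -[LHS]/((g^-1 * g) s x) mulVg.
have Uh : U h.
  by rewrite -[h]mul1g; apply: A0U => s x /A0A[xA _]; exact: hA.
have := UM _ _ (UM _ _ gg Uh) hU.
by rewrite -!mulgA mulVKg mulVKg.
Qed.

End Coherent.

(** * The component G00 *)

Definition finite_double_cosets (L : signature) (M : structure L) :=
  forall A, exists rs : seq (aut M), forall g,
  exists r, List.In r rs /\ exists h k, [/\ pstab A h, pstab A k & g = h * r * k].

Lemma core_normal (G : groupType) (H : set G) : subgroup H ->
  subgroup [set x | forall y, H (y^-1 * x * y)] /\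
  forall x y, (forall z, H (z^-1 * x * z)) -> forall z, H (z^-1 * (y * x * y^-1) * z).
Proof.
move=> [H1 HM HV]; split; [split=> [y|g h Vg Vh y|g Vg y]|move=> g y Vg z].
- by rewrite mulg1 mulVg.
- by have := HM _ _ (Vg y) (Vh y); rewrite -!mulgA mulVKg.
- by have := HV _ (Vg y); rewrite !invgM invgK !mulgA.
- by have := Vg (y^-1 * z); rewrite invgM invgK -!mulgA.
Qed.

Lemma left_coset_eq (G : groupType) (H : set G) (x y : G) : subgroup H ->
  [set x * h | h in H] = [set y * h | h in H] <-> H (x^-1 * y).
Proof.
move=> [H1 HM HV]; split=> [e|xy].
  have : [set x * h | h in H] y by rewrite e; exists 1 => //; rewrite mulg1.
  by move=> [h Hh <-]; rewrite mulKg.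
apply/seteqP; split=> _ [h Hh <-].
  exists (y^-1 * x * h); last by rewrite -mulgA mulVKg -?mulgA ?mulVKg.
  by apply: HM => //; have := HV _ xy; rewrite invgM invgK.
exists (x^-1 * y * h); first exact: HM.
by rewrite -!mulgA mulVKg.
Qed.

Section TypeDefinableCore.
Variables (L : signature) (M : structure L) (X : elext (with_group M)).
Local Notation GL := (gsig M).
Local Notation gs := (None : lsort GL).
Local Notation G := (aut M).
Local Notation GX := (gsort X).

(** Interpretation of a bare set: the proof of openness is hidden in the existential, and the result
    is empty if U is not open. *)
Definition into (U : set G) : set GX :=
  [set x | exists2 W : open_subset M, sval W = U & interp W x].

Lemma intoE (W : open_subset M) x : into (sval W) x <-> interp W x.
Proof. by split=> [[W' /sval_inj -> //]|h]; exists W. Qed.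

Lemma into_open U (oU : open U) x : into U x <-> interp (exist _ U oU) x.
Proof. exact: (intoE (exist _ U oU)). Qed.

Lemma into_sub U V x : open V -> U `<=` V -> into U x -> into V x.
Proof. by move=> oV UV [W WU Wx]; apply/(into_open oV); apply: interp_sub Wx; rewrite WU. Qed.

Lemma into_gemb U g : open U -> into U (gemb X g) <-> U g.
Proof. by move=> oU; rewrite (propext (into_open oU _)); exact: interp_gemb. Qed.

Lemma into_mul U V W x y : open W -> (forall g h, U g -> V h -> W (g * h)) ->
  into U x -> into V y -> into W (x * y).
Proof.
move=> oW UVW [U' eU U'x] [V' eV V'y]; subst U V.
by apply/(into_open oW); exact: interp_mul U'x V'y.
Qed.

Lemma into_subgroup U : open U -> subgroup U -> subgroup (into U).
Proof.
move=> oU [U1 UM UV]; split=> [|x y|x [W eW Wx]].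
- by rewrite -(gemb1 X); apply/into_gemb.
- exact: into_mul.
- by subst U; apply/intoE; apply: interp_inv Wx; exact: UV.
Qed.

Lemma into_normal U x y : open_finite U -> into U x -> into U (y * x * y^-1).
Proof.
by move=> [oU _ UN _] [W WU Wx]; apply/(into_open oU); apply: interp_conj Wx => g h; rewrite WU; exact: UN.
Qed.

Lemma open_saturated U (O : set G) : open_finite U ->
  (forall g h, O g -> U h -> O (g * h)) -> open O.
Proof.
move=> [oU [U1 _ _] _ _] OU; have [A AU] := open_pstab_sub oU U1.
by apply: (@pstab_open _ _ _ A) => g h Og /AU; rewrite mul1g; exact: OU.
Qed.

Lemma into_rep U x : open_finite U -> exists g, into U ((gemb X g)^-1 * x).
Proof.
move=> [oU _ _ /fin_index_reps[rs rsP]].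
have [r _ rx] := interp_coset (U := exist _ U oU) rsP x.
by exists r; apply/(into_open oU).
Qed.

Lemma into_coset U g x : open_finite U ->
  into [set h | U (g^-1 * h)] x <-> into U ((gemb X g)^-1 * x).
Proof.
move=> oU; have [opU [U1 UM UV] UN _] := oU.
have o1 : open [set h | U (g^-1 * h)].
  by apply: (open_saturated oU) => k h /= gk hU; rewrite mulgA; exact: UM.
have o2 : open [set h | U (h * g)].
  apply: (open_saturated oU) => k h /= kg hU.
  have := UM _ _ kg (UN _ g^-1 hU).
  by rewrite invgK -!mulgA mulVKg.
split=> h.
  rewrite -gembV; apply: (into_mul (U := [set h | U (h * g)])) h => //.
    move=> k l /= kg gl; have := UM _ _ kg gl; by rewrite -mulgA mulVKg.
  by apply/into_gemb => //=; rewrite mulVg.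
rewrite -[x](mulVKg (gemb X g)).
apply: (into_mul (U := [set h | U (g^-1 * h)]) (V := U)) => //.
  by move=> k l /= gk lU; rewrite mulgA; exact: UM.
by apply/into_gemb => //=; rewrite mulVg.
Qed.

Definition core00 : set GX := [set x | forall U, open_finite U -> into U x].

Lemma core00_subgroup : subgroup core00.
Proof.
split=> [U oU|x y xN yN U oU|x xN U oU]; have [opU sU _ _] := oU;
  have [U1 UM UV] := into_subgroup opU sU; [exact: U1|exact/UM/yN/oU/xN|].
exact/UV/xN.
Qed.

Lemma core00_normal x y : core00 x -> core00 (y * x * y^-1).
Proof. by move=> xN U oU; apply: into_normal => //; exact: xN. Qed.

Definition N00 : nsubgroup GX := NSubgroup core00_subgroup core00_normal.

Variable K : Type.
Hypothesis Klim : uncountable_strong_limit K.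
Hypothesis Xsat : saturated X K.
Hypothesis smallR : small K (rsym GL).

Lemma left_cosets_rep (H : set GX) : exists r : {c | left_cosets H c} -> GX,
  forall c, sval c = [set r c * h | h in H].
Proof.
have /choice[r rP] : forall c : {c | left_cosets H c}, exists x, sval c = [set x * h | h in H].
  by move=> c; have [x _ xc] := svalP c; exists x.
by exists r.
Qed.

(** Modulo [core00], an element is determined by the open sets whose interpretations contain it, and
    the open sets are relation symbols, which form a small type. *)
Lemma core00_bounded : bounded_open_type_subgroup K core00.
Proof.
split; first exact: core00_subgroup.
- have [r rP] := left_cosets_rep core00.
  pose f c := [set W : open_subset M | interp W (r c)].
  apply: (small_card_lt (f := f)); last first.
    by apply: small_set => //; apply: small_le smallR; exists inr => x y [].
  move=> c d fcd; apply: sval_inj; rewrite !rP; apply/left_coset_eq.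
    exact: core00_subgroup.
  move=> U oU; have [g gc] := into_rep (r c) oU.
  have gd : into U ((gemb X g)^-1 * r d).
    apply/into_coset => //; move/(into_coset _ _ oU): gc => [W WU Wc]; exists W => //.
    by have : f c W by []; rewrite fcd.
  have [opU sU _ _] := oU; have [U1 UM UV] := into_subgroup opU sU.
  have := UM _ _ (UV _ gc) gd.
  by rewrite invgM invgK -mulgA mulVKg.
- exists [set W | open_finite (sval W)]; apply/seteqP; split=> x xN.
    by move=> W oW; apply/intoE; exact: xN.
  by move=> U oU; have [opU _ _ _] := oU; apply/(into_open opU); exact: xN.
Qed.

Hypothesis Mdc : finite_double_cosets M.

(** Modulo the core, an element is determined by its permutation of the left cosets of H; f records
    the graph of this permutation. *)
Lemma bounded_core (H : set GX) : subgroup H -> card_lt (left_cosets H) [set: K] ->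
  card_lt (left_cosets [set x | forall y, H (y^-1 * x * y)]) [set: K].
Proof.
move=> sH bH; have [sC _] := core_normal sH; set Hc := [set x | _] in sC *.
have [r rP] := left_cosets_rep Hc.
pose T := {c | left_cosets H c}.
have sT : small K T by exact: card_lt_small.
pose lc x : T := exist _ [set x * h | h in H] (ex_intro2 _ _ x I erefl).
pose f c := [set tt : T * T | exists y, tt = (lc y, lc (r c * y))].
apply: (small_card_lt (f := f)); last by apply: small_set => //; exact: small_prod.
move=> c d fcd; apply: sval_inj; rewrite !rP; apply/left_coset_eq => // y.
have : f c (lc y, lc (r c * y)) by exists y.
rewrite fcd => -[z e].
have /= /(left_coset_eq _ _ sH) yz := congr1 (fun t => sval t.1) e.
have /= /(left_coset_eq _ _ sH) cyz := congr1 (fun t => sval t.2) e.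
have [H1 HM HV] := sH.
have := HM _ _ cyz (HV _ yz).
by rewrite !invgM !invgK -!mulgA mulVKg.
Qed.

(** Compactness: products of two elements of H lie in the interpretation of W, so finitely many
    members of F already force this. *)
Lemma product_neighbourhood (F : set (open_subset M)) (H : set GX) W :
  subgroup H -> H = \bigcap_(U in F) @interp L M X U -> F W ->
  exists l, (forall V, List.In V l -> F V) /\
    forall x y : GX, (forall V, List.In V l -> interp V x /\ interp V y) ->
      interp W (x * y).
Proof.
move=> [_ HM _] HF FW; apply: contrapT => nl.
pose J := option ({V | F V} * bool).
pose gv := fun _ : bool => gs.
pose phi (j : J) : formula gv := match j with
  | Some Vi => fIn (sval Vi.1) (Var gv Vi.2)
  | None => fNot (fIn W (tMul (Var gv true) (Var gv false))) end.
have [l|c [_ cP]] := saturation Xsat (small_count Klim bool) (sv := gv) (D := set0)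
    (a := fun _ => (1 : GX)) (phi := phi).
  pose l' := pmap (fun j : J => if j is Some Vi then Some (sval Vi.1) else None) l.
  have l'P V i : List.In (Some (V, i)) l -> List.In (sval V) l'.
    rewrite /l'; elim: (l) => //= -[[V' i']|] k IH [] //=.
    - by case=> -> _; left.
    - by move=> /IH; right.
  have [x [y [xy nxy]]] : exists x y : GX, (forall V, List.In V l' -> interp V x /\ interp V y)
      /\ ~ interp W (x * y).
    apply: contrapT => H'; apply: nl; exists l'; split.
      move=> V; rewrite /l'; elim: (l) => //= -[[V' i']|] k IH //= [<-|/IH //].
      exact: (svalP V').
    move=> x y xy; apply: contrapT => nxy; apply: H'; by exists x, y.
  exists (fun b : bool => if b then x else y); split=> // -[[V i]|] jl.
    by apply/sat_fIn => /=; have [] := xy _ (l'P _ _ jl); case: i {jl}.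
  by move=> /sat_fIn; rewrite eval_tMul.
have HV i : H (c i).
  by rewrite HF => V FV; exact: (cP (Some (exist _ V FV, i))).
have := HM _ _ (HV true) (HV false); rewrite {1}HF => /(_ W FW) xyW.
by apply: (cP None); apply/sat_fIn; rewrite eval_tMul.
Qed.

Lemma bounded_definable_fin_index (D : set G) : open D -> subgroup D ->
  card_lt (left_cosets (into D)) [set: K] -> fin_index D.
Proof.
move=> oD sD bD; have sDX := into_subgroup oD sD; have [D1 DM DV] := sDX.
pose gv := fun _ : unit => gs.
pose E (a b : env X gv) := into D ((a tt : GX)^-1 * (b tt : GX)).
have Eeq : equivalence E.
  split=> [a|a b|a b c].
  - by rewrite /E mulVg.
  - by rewrite /E => /DV; rewrite invgM invgK.
  - by rewrite /E => ab bc; have := DM _ _ ab bc; rewrite -mulgA mulVKg.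
have Edef : definable0_rel E.
  exists (fIn (exist _ D oD) (tMul (tInv (Var (vsum gv gv) (inl tt))) (Var (vsum gv gv) (inr tt)))) => a b.
  by rewrite (propext (sat_fIn _ _ _)) eval_tMul eval_tInv /= -(propext (into_open oD _)).
have Ebdd : bounded_rel K E.
  have /choice[r rP] : forall c : {c | classes E c}, exists a : env X gv, sval c = [set y | E a y].
    by move=> c; have [a _ ca] := svalP c; exists a.
  pose f (c : {c | classes E c}) : {c | left_cosets (into D) c} :=
    exist _ [set (r c tt : GX) * h | h in into D] (ex_intro2 _ _ (r c tt : GX) I erefl).
  apply: (small_card_lt (f := f)); last exact: card_lt_small.
  move=> c d /(congr1 sval) /= /(left_coset_eq _ _ sDX) cd; apply: sval_inj; rewrite !rP.
  have [_ Esym Etrans] := Eeq.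
  by apply/seteqP; split=> y /=; apply: Etrans => //; exact: Esym.
have [l lP] := definable_bounded_finite Klim Xsat (small_count Klim unit) Eeq Edef Ebdd.
have /choice[f fP] : forall g : G, exists i : 'I_(size l), E (tnth (in_tuple l) i) (fun _ => gemb X g).
  move=> g; have [c cl cE] := lP (fun _ => gemb X g).
  by have [i ic] := In_tnth cl; exists i; rewrite ic.
exists 'I_(size l), f => g h fgh; apply/(into_gemb _ oD).
rewrite gembM gembV; have := DM _ _ (DV _ (fP g)) (fP h); rewrite fgh.
by rewrite invgM invgK -mulgA mulVKg.
Qed.

(** Choose A with G_A contained in the finitely many V from [product_neighbourhood], and let Hc be
    the normal core of H. The subgroup D, product of [into (pstab A)] and Hc, has bounded index. It
    is a union of double cosets with representatives in G, hence the interpretation of its trace D0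
    on G; so D0 has finite index, and D contains [core00]. An element of D is a product of two
    elements that lie in every V, so it lies in W. *)
Lemma core00_least (H : set GX) : bounded_open_type_subgroup K H -> core00 `<=` H.
Proof.
move=> [sH bH [F HF]] x xN; rewrite HF => W FW.
have [l [lF lW]] := product_neighbourhood sH HF FW.
have [H1 HM HV] := sH.
have Hl V y : List.In V l -> H y -> interp V y by move=> Vl; rewrite HF => /(_ V (lF V Vl)).
have [A Al] : exists A, forall V, List.In V l -> pstab A `<=` sval V.
  elim: (l) Hl => [|V k IH] Hl; first by exists nil.
  have [A AV] := IH (fun V y Vk => Hl V y (or_intror Vk)).
  have V1 : sval V 1 by apply/(interp_gemb X); rewrite gemb1; apply: Hl => //; left.
  have [B BV] := open_pstab_sub (svalP V) V1.
  exists (A ++ B) => U [<-|Uk] g /pstab_cat[gA gB]; last exact: AV gA.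
  by have := BV _ gB; rewrite mul1g.
have oA : open (pstab A) by apply: (@subgroup_open _ _ _ A) => //; exact: pstab_subgroup.
have sA := into_subgroup oA (pstab_subgroup A); have [A1 AM AV] := sA.
pose Hc := [set y | forall z, H (z^-1 * y * z)].
have [sC CN] := core_normal sH; rewrite -/Hc in sC CN; have [C1 CM CV] := sC.
pose D : set GX := [set y | exists p h, [/\ into (pstab A) p, Hc h & y = p * h]].
have DA p : into (pstab A) p -> D p by move=> pA; exists p, 1; rewrite mulg1.
have sD : subgroup D.
  split=> [|_ _ [p [h [pA hC ->]]] [p' [h' [pA' hC' ->]]]|_ [p [h [pA hC ->]]]].
  - exact: DA.
  - exists (p * p'), (p'^-1 * h * p' * h'); split; first exact: AM.
      apply: CM => //; have := CN h p'^-1 hC; by rewrite invgK.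
    by rewrite -!mulgA !mulVKg.
  - exists p^-1, (p * h^-1 * p^-1); split; first exact: AV.
      exact/CN/CV.
    by rewrite invgM -!mulgA mulKg.
have [D1 DM DV] := sD.
pose D0 : set G := [set g | D (gemb X g)].
have sD0 : subgroup D0.
  split=> [|g h|g]; rewrite /D0 /=; first by rewrite gemb1.
    by rewrite gembM; exact: DM.
  by rewrite gembV; exact: DV.
have AD0 : pstab A `<=` D0 by move=> g gA; apply: DA; apply/into_gemb.
have oD0 : open D0 := subgroup_open sD0 AD0.
have [_ IM IV] := into_subgroup oD0 sD0.
have AI y : into (pstab A) y -> into D0 y by exact: into_sub.
have DE y : D y <-> into D0 y.
  have [rs rsP] := Mdc A.
  have [r [_ [a [b [/(into_open oA) aA /(into_open oA) bA yE]]]]] :=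
    interp_double_coset (U := exist _ _ oA) rsP y.
  have rE : gemb X r = a^-1 * y * b^-1 by rewrite yE !mulgA mulVg mul1g mulgK.
  split=> h; rewrite yE.
    apply: (IM); [apply: (IM); [exact: AI|]|exact: AI]; apply/into_gemb => //.
    by rewrite /D0 /= rE; apply: (DM); [apply: (DM) => //|]; apply: DA; exact: AV.
  apply: (DM); [apply: (DM); [exact: DA|]|exact: DA].
  suff : D0 r by [].
  by apply/(into_gemb _ oD0); rewrite rE; apply: (IM); [apply: (IM) => //|]; apply: AI; exact: AV.
have bC := bounded_core sH bH; rewrite -/Hc in bC.
have fD0 : fin_index D0.
  apply: bounded_definable_fin_index => //.
  have [r rP] := left_cosets_rep (into D0).
  pose f c : {c | left_cosets Hc c} :=
    exist _ [set r c * h | h in Hc] (ex_intro2 _ _ (r c) I erefl).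
  apply: (small_card_lt (f := f)); last exact: card_lt_small.
  move=> c d /(congr1 sval) /= /(left_coset_eq _ _ sC) cd; apply: sval_inj; rewrite !rP.
  apply/left_coset_eq; first exact: into_subgroup.
  by apply/DE; exists 1, ((r c)^-1 * r d); rewrite mul1g.
have [U oU UD0] := open_finite_core oD0 sD0 fD0.
have /DE[p [h [pA hC xE]]] : into D0 x by apply: into_sub (xN U oU).
rewrite xE; apply: lW => V Vl; split.
  by apply/intoE; apply: into_sub pA; [exact: (svalP V)|exact: Al].
by apply: Hl => //; have := hC 1; rewrite invg1 mul1g mulg1.
Qed.

Lemma N00_is_G00 : is_G00_top K N00.
Proof. by split; [exact: core00_bounded|exact: core00_least]. Qed.

End TypeDefinableCore.

(** * The logic topology on the quotient *)

Section QuotientTopology.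
Variables (L : signature) (M : structure L) (X : elext (with_group M)).
Local Notation GL := (gsig M).
Local Notation gs := (None : lsort GL).
Local Notation G := (aut M).
Local Notation GX := (gsort X).
Variable K : Type.
Hypothesis Klim : uncountable_strong_limit K.
Hypothesis Xsat : saturated X K.

Local Notation Q := (logic_quotient K (N00 X)).
Local Notation proj := (to_logic_quotient K (N00 X)).

Lemma proj_eq x y : proj x = proj y <-> core00 (x^-1 * y).
Proof. exact: coset_eq. Qed.

Lemma proj_mul x y : proj x * proj y = proj (x * y).
Proof. exact: quotient_mulE. Qed.

Lemma proj_inv x : (proj x)^-1 = proj x^-1.
Proof. exact: quotient_invE. Qed.

Lemma proj_surj (q : Q) : exists x, proj x = q.
Proof. by exists (repr q); exact: coset_repr. Qed.

(** Closedness for the topology whose basic neighbourhoods are the cosets of the interpretations of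
    the U. *)
Definition limit_closed (C : set Q) := forall x,
  (forall U, open_finite U -> exists y, into U (x^-1 * y) /\ C (proj y)) -> C (proj x).

Lemma limit_closed0 : limit_closed set0.
Proof. by move=> x /(_ _ (@open_finiteT L M))[y []]. Qed.

Lemma limit_closedI (F : set (set Q)) : F `<=` limit_closed ->
  limit_closed (\bigcap_(C in F) C).
Proof.
move=> Fc x xF C FC; apply: Fc => // U /xF[y [xy yF]].
by exists y; split=> //; exact: yF.
Qed.

Lemma into_setI U V (x : GX) : open_finite U -> open_finite V ->
  into (U `&` V) x -> into U x /\ into V x.
Proof.
move=> [oU _ _ _] [oV _ _ _] xUV.
by split; apply: into_sub xUV => // g [].
Qed.

Lemma limit_closedU C D : limit_closed C -> limit_closed D -> limit_closed (C `|` D).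
Proof.
move=> cC cD x xCD; have [|nC] := pselect (C (proj x)); first by left.
right; apply: cD => U oU.
have /existsNP[V /not_implyP[oV nV]] : ~ forall V, open_finite V ->
    exists y, into V (x^-1 * y) /\ C (proj y) by move/cC.
have [y [/(into_setI oU oV)[yU yV] [Cy|Dy]]] := xCD _ (open_finiteI oU oV).
  by exfalso; apply: nV; exists y.
by exists y.
Qed.

Lemma into_bigI (l : seq (set G)) U (x : GX) : (forall U, List.In U l -> open_finite U) ->
  List.In U l -> into (foldr setI setT l) x -> into U x.
Proof.
move=> lP Ul; apply: into_sub; first by have [] := lP U Ul.
exact: bigI_sub.
Qed.

(** Saturation finds one element that satisfies the type defining C and lies in the coset of x
    modulo every U; its class is that of x. *)
Lemma logic_closed_limit C : logic_quotient_closed C -> limit_closed C.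
Proof.
move=> [W [sw [b [p [sW Dp]]]]] x xC.
pose gv := fun _ : unit => gs.
pose P0 := vsum sw gv; pose ctx := vsum gv P0.
pose J := ({q | p q} + {U : open_subset M | open_finite (sval U)})%type.
pose phi (j : J) : formula ctx := match j with
  | inl q => subst (sval q) (fun y => match y return term ctx (vsum gv sw y) with
      inl v => Var ctx (inl v) | inr w => Var ctx (inr (inl w)) end)
  | inr U => fIn (sval U) (tMul (tInv (Var ctx (inr (inr tt)))) (Var ctx (inl tt)))
  end.
have phi1 q (c : env X ctx) : sat (phi (inl q)) c <->
    sat (sval q) (epair (fun v => c (inl v)) (fun w => c (inr (inl w)))).
  by rewrite /phi (propext (sat_subst _ _ _)); split; apply: sat_ext => -[].
have phi2 U (c : env X ctx) : sat (phi (inr U)) c <->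
    into (sval (sval U)) ((c (inr (inr tt)) : GX)^-1 * (c (inl tt) : GX)).
  by rewrite /phi (propext (sat_fIn _ _ _)) eval_tMul eval_tInv (propext (intoE _ _)).
pose base0 : env X ctx := epair (fun _ => x) (epair b (fun _ => x)).
have sctx : small K (unit + (W + unit)).
  by do !apply: small_sum => //; exact: small_count.
have [js|c [cD cphi]] := saturation Xsat sctx (sv := ctx)
    (D := fun y => if y is inr _ then True else False) (a := base0) (phi := phi).
  pose Us := pmap (fun j : J => if j is inr U then Some (sval (sval U)) else None) js.
  have UsP U : List.In U Us -> open_finite U.
    rewrite /Us; elim: (js) => //= -[q|V] l IH //= [<-|/IH //]; exact: (svalP V).
  have jsU V : List.In (inr V) js -> List.In (sval (sval V)) Us.
    rewrite /Us; elim: (js) => //= -[q|V'] l IH [] //=.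
    - by case=> ->; left.
    - by move=> /IH; right.
  have [y [xy Cy]] := xC _ (open_finite_bigI UsP).
  exists (epair (fun _ => y) (epair b (fun _ => x))); split; first by case.
  move=> [q|V] jjs.
    apply/phi1; have := (Dp (fun _ => y)).1 Cy _ (svalP q).
    by apply: sat_ext => -[].
  by apply/phi2 => /=; apply: into_bigI xy => //; exact: jsU.
have cx : c (inr (inr tt)) = x by rewrite cD.
have -> : proj x = proj (c (inl tt)).
  apply/proj_eq => U oU; have [opU _ _ _] := oU.
  have /phi2 := cphi (inr (exist (fun W => open_finite (sval W)) (exist _ U opU) oU)).
  by rewrite cx.
apply: (Dp (fun v => c (inl v))).2 => q pq.
have /phi1 := cphi (inl (exist _ q pq)).
by apply: sat_ext => -[v|w] //=; rewrite cD.
Qed.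

(** The trace on G of the preimage of C multiplied by the interpretation of U. *)
Definition meet_set (C : set Q) (U : set G) : set G :=
  [set g | exists y, C (proj y) /\ into U ((gemb X g)^-1 * y)].

Lemma meet_set_saturated C U g h : open_finite U ->
  meet_set C U g -> U h -> meet_set C U (g * h).
Proof.
move=> [opU sU _ _] [y [Cy gy]] hU; have [_ _ UV] := sU.
have [_ IM _] := into_subgroup X opU sU; exists y; split=> //.
rewrite gembM invgM -mulgA; apply: IM => //; rewrite -gembV.
by apply/into_gemb => //; exact: UV.
Qed.

Lemma meet_set_open C U : open_finite U -> open (meet_set C U).
Proof. by move=> oU; apply: (open_saturated oU) => g h; exact: meet_set_saturated. Qed.

Lemma into_meet_set C U x : open_finite U ->
  into (meet_set C U) x <-> exists y, C (proj y) /\ into U (x^-1 * y).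
Proof.
move=> oU; have [opU sU _ _] := oU; have [U1 UM UV] := sU.
have oO : open (meet_set C U) by exact: meet_set_open.
have [I1 IM IV] := into_subgroup X opU sU; have [g gx] := into_rep x oU.
split=> [xO|[y [Cy xy]]].
  have [y [Cy gy]] : meet_set C U g.
    apply/(into_gemb X g oO).
    have -> : gemb X g = x * ((gemb X g)^-1 * x)^-1.
      by rewrite invgM invgK mulgA mulgV mul1g.
    apply: (into_mul (U := meet_set C U) (V := U)) (IV _ gx) => //.
    by move=> g' h'; exact: meet_set_saturated.
  exists y; split=> //; have := IM _ _ (IV _ gx) gy.
  by rewrite invgM invgK -mulgA mulVKg.
apply: into_sub oO _ ((into_coset _ _ oU).2 gx) => h /= gh.
exists y; split=> //.
have := IM _ _ (IM _ _ ((into_gemb X _ opU).2 (UV _ gh)) gx) xy.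
by rewrite invgM invgK gembM gembV -!mulgA !mulVKg.
Qed.

(** C is cut out by the open sets whose interpretations contain its preimage, among them all
    [meet_set C U]. This type has no parameters, whence the context [void]. *)
Lemma limit_closed_logic C : limit_closed C -> logic_quotient_closed C.
Proof.
move=> cC; pose gv := fun _ : unit => gs.
pose sw := @no_var GL.
exists void, sw, (fun v : void => match v return X (sw v) with end), [set q | exists O : open_subset M,
  (forall y, C (proj y) -> interp O y) /\ q = fIn O (Var (vsum gv sw) (inl tt))].
split; first exact: small_count.
move=> a; pose x : GX := a tt; split=> [Cx _ [O [CO ->]]|xO]; first exact: CO x Cx.
change (C (proj x)).
apply: cC => U oU.
have [|y [Cy xy]] := (@into_meet_set C _ x oU).1; last by exists y.
apply/(into_open (@meet_set_open C _ oU)).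
apply: (xO (fIn (exist _ _ (@meet_set_open C _ oU)) (Var (vsum gv sw) (inl tt)))).
exists (exist _ _ (@meet_set_open C _ oU)); split=> // y Cy.
apply/(into_open (@meet_set_open C _ oU))/into_meet_set => //; exists y; split=> //.
by rewrite mulVg; have [opU sU _ _] := oU; have [] := into_subgroup X opU sU.
Qed.

Lemma logic_closedE (C : set Q) : closed C <-> logic_quotient_closed C.
Proof.
split=> [|gC]; last first.
  rewrite -openC; exists [set ~` C]; last by rewrite bigcup_set1.
  move=> _ ->; exact: (finI_from1 (@setC _)).
rewrite -openC => -[O OD OE]; rewrite -(setCK C) -OE; apply: limit_closed_logic.
apply: (subbase_closed_ind (D := @logic_quotient_closed L M X K (N00 X))) OD.
- by move=> A; exact: logic_closed_limit.
- exact: limit_closed0.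
- exact: limit_closedU.
- exact: limit_closedI.
Qed.

Lemma open_quotientP (A : set Q) : open A <-> forall x, A (proj x) ->
  exists U, open_finite U /\ forall y, into U (x^-1 * y) -> A (proj y).
Proof.
rewrite -(setCK A) openC (propext (logic_closedE _)); split=> [/logic_closed_limit cA x|H].
  move=> nAx; apply: contrapT => H; apply: nAx; apply: cA => U oU.
  apply: contrapT => nU; apply: H; exists U; split=> // y xy Ay.
  by apply: nU; exists y.
apply: limit_closed_logic => x xA; apply: contrapT => /H[U [oU UA]].
by have [y [xy]] := xA U oU; exact: UA.
Qed.

Lemma level_open U x : open_finite U ->
  open [set q : Q | exists y, q = proj y /\ into U (x^-1 * y)].
Proof.
move=> oU; have [opU sU UN _] := oU; have [I1 IM IV] := into_subgroup X opU sU.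
apply/open_quotientP => y [y' [/proj_eq/(_ _ oU) yy' xy']].
exists U; split=> // z yz; exists z; split=> //.
have := IM _ _ (IM _ _ xy' (IV _ yy')) yz.
by rewrite !invgM !invgK -!mulgA !mulVKg.
Qed.

Lemma quotient_hausdorff : hausdorff_space Q.
Proof.
move=> p q; have [x <-] := proj_surj p; have [y <-] := proj_surj q => pq.
apply/proj_eq => U oU.
have [opU sU UN _] := oU; have [I1 IM IV] := into_subgroup X opU sU.
have nb z : nbhs (proj z) [set q : Q | exists y, q = proj y /\ into U (z^-1 * y)].
  by apply: open_nbhs_nbhs; split; [exact: level_open|exists z; rewrite mulVg].
have [r [[z [-> xz]] [z' [/proj_eq/(_ _ oU) zz' yz']]]] := pq _ _ (nb x) (nb y).
have := IM _ _ (IM _ _ xz zz') (IV _ yz').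
by rewrite !invgM !invgK -!mulgA !mulVKg.
Qed.

(** Saturation gives an element in the interpretation of [meet_set A U] for all A in the filter and
    all U; by [into_meet_set] its class is a cluster point. *)
Lemma quotient_compact : compact [set: Q].
Proof.
move=> F FF _; pose gv := fun _ : unit => gs.
pose J := {AU : set Q * set G | F AU.1 /\ open_finite AU.2}.
have Jo (j : J) : open (meet_set (sval j).1 (sval j).2).
  by have [_ oU] := svalP j; exact: meet_set_open.
pose phi (j : J) : formula gv := fIn (exist _ _ (Jo j)) (Var gv tt).
have [l|c [_ cP]] := saturation Xsat (small_count Klim unit) (D := set0)
    (a := (fun _ => (1 : GX)) : env X gv) (phi := phi).
  have : F [set q | forall j, List.In j l -> (sval j).1 q].
    elim: l => [|j l IH]; first by apply: filterS filterT => q _ j [].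
    apply: filterS (filterI (proj1 (svalP j)) IH) => q [qj ql] k [<-//|]; exact: ql.
  move=> /filter_ex[q qP]; have [x xq] := proj_surj q.
  exists (fun _ => x); split=> // j jl; apply/sat_fIn/(into_open (Jo j)) => /=.
  have [_ oU] := svalP j; apply/into_meet_set => //; exists x; split.
    by rewrite xq; exact: qP.
  by rewrite mulVg; have [opU sU _ _] := oU; have [] := into_subgroup X opU sU.
exists (proj (c tt)); split=> // A B FA; rewrite nbhsE => -[B' [oB' B'c] B'B].
have [U [oU UB']] := (open_quotientP B').1 oB' _ B'c.
pose j : J := exist (fun AU : set Q * set G => F AU.1 /\ open_finite AU.2) (A, U) (conj FA oU).
have /sat_fIn/(into_open (Jo j))/= cO := cP j.
have [y [Ay cy]] := (@into_meet_set A _ (c tt : GX) oU).1 cO.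
by exists (proj y); split=> //; apply/B'B/UB'.
Qed.

Lemma quotient_topological_group : topological_group Q.
Proof.
split.
  move=> [p q] A /=; have [x <-] := proj_surj p; have [y <-] := proj_surj q.
  rewrite proj_mul nbhsE => -[B [oB Bxy] BA].
  have [U [oU UB]] := (open_quotientP B).1 oB _ Bxy.
  have [opU sU _ _] := oU; have [I1 IM IV] := into_subgroup X opU sU.
  have nb z : nbhs (proj z) [set q : Q | exists y, q = proj y /\ into U (z^-1 * y)].
    by apply: open_nbhs_nbhs; split; [exact: level_open|exists z; rewrite mulVg].
  exists ([set q : Q | exists y, q = proj y /\ into U (x^-1 * y)],
          [set q : Q | exists z, q = proj z /\ into U (y^-1 * z)]); first by split; exact: nb.
  move=> [p' q'] /= [[x' [-> xx']] [y' [-> yy']]].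
  apply: BA; rewrite proj_mul; apply: UB.
  have := IM _ _ (into_normal y^-1 oU xx') yy'.
  by rewrite invgK invgM -!mulgA !mulVKg.
move=> p A /=; have [x <-] := proj_surj p.
rewrite proj_inv nbhsE => -[B [oB Bx] BA].
have [U [oU UB]] := (open_quotientP B).1 oB _ Bx.
have [opU sU _ _] := oU; have [I1 IM IV] := into_subgroup X opU sU.
have : nbhs (proj x) [set q : Q | exists y, q = proj y /\ into U (x^-1 * y)].
  by apply: open_nbhs_nbhs; split; [exact: level_open|exists x; rewrite mulVg].
apply: filterS => q [y [-> xy]] /=; apply: BA; rewrite proj_inv; apply: UB.
rewrite invgK.
have := into_normal x oU (IV _ xy).
by rewrite invgM invgK !mulgA mulgK.
Qed.

End QuotientTopology.

(** * Compactifications *)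

Section TopologicalGroup.
Variable B : preTopGroupType.
Hypothesis Btg : topological_group B.

Lemma mul_nbhs (x y : B) (O : set B) : nbhs (x * y) O ->
  exists O1 O2, [/\ nbhs x O1, nbhs y O2 & forall a b, O1 a -> O2 b -> O (a * b)].
Proof.
move=> /(proj1 Btg (x, y)) [[O1 O2] /= [O1x O2y] OO]; exists O1, O2; split=> // a b aO bO.
by apply: (OO (a, b)).
Qed.

Lemma continuous_mull (x : B) : continuous (fun y : B => x * y).
Proof.
move=> y O /mul_nbhs[O1 [O2 [xO1 yO2 OO]]]; apply: filterS yO2 => z zO.
by apply: OO => //; exact: nbhs_singleton.
Qed.

Lemma continuous_two_sided (x : B) : continuous (fun z : B * B => z.1 * x * z.2).
Proof.
move=> [a b] O /mul_nbhs[O1 [O2 [aO1 bO2 OO]]].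
have [O3 [O4 [aO3 xO4 OO']]] := mul_nbhs aO1.
exists (O3, O2) => // -[c d] [/= cO dO].
by apply: OO => //; apply: OO' => //; exact: nbhs_singleton.
Qed.

Lemma open_coset (D : set B) x : open D -> open [set y | D (x^-1 * y)].
Proof. move=> oD; by have /continuousP := @continuous_mull x^-1; apply. Qed.

Lemma closure_subgroup (H : set B) : subgroup H -> subgroup (closure H).
Proof.
move=> [H1 HM HV]; split=> [|x y xH yH O /mul_nbhs[O1 [O2 [xO1 yO2 OO]]]|x xH O Ox].
- exact: subset_closure.
- have [a [Ha aO]] := xH _ xO1; have [b [Hb bO]] := yH _ yO2.
  by exists (a * b); split; [exact: HM|exact: OO].
- have := proj2 Btg x O Ox; rewrite nbhs_simpl /= => /xH[a [Ha aO]].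
  by exists a^-1; split; [exact: HV|].
Qed.

Lemma open_subgroup_finite_cover (D : set B) : compact [set: B] -> open D -> subgroup D ->
  exists l : seq B, forall y, exists2 i, List.In i l & D (i^-1 * y).
Proof.
move=> Bc oD [D1 DM DV]; apply: contrapT => nl.
pose F : set_system B := [set A | exists l : seq B, forall y,
  (forall i, List.In i l -> ~ D (i^-1 * y)) -> A y].
have FF : ProperFilter F.
  apply: Build_ProperFilter_ex; last first.
    split; first by exists nil.
    - move=> P Q [l lP] [k kQ]; exists (l ++ k) => y ylk; split.
        by apply: lP => i il; apply: ylk; apply/List.in_app_iff; left.
      by apply: kQ => i il; apply: ylk; apply/List.in_app_iff; right.
    - by move=> P Q PQ [l lP]; exists l => y /lP/PQ.
  move=> P [l lP]; apply: contrapT => nP; apply: nl; exists l => y.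
  apply: contrapT => ny; apply: nP; exists y; apply: lP => i il iy.
  by apply: ny; exists i.
have [p [_ pF]] := Bc F FF filterT.
have Fp : F [set y | ~ D (p^-1 * y)] by exists [:: p] => y; apply; left.
have pD : nbhs p [set y | D (p^-1 * y)].
  by apply: open_nbhs_nbhs; split; [exact: open_coset|rewrite /= mulVg].
by have [y [yp py]] := pF _ _ Fp pD; exact: yp py.
Qed.

End TopologicalGroup.

Section Compactification.
Variables (L : signature) (M : structure L).
Hypothesis Mdc : finite_double_cosets M.
Local Notation G := (aut M).

(* The closure D of the image of a stabiliser G_A is open: the group is the    *)
(* union of finitely many compact sets D f(r) D, and D is one of them.         *)
Lemma compactification_profinite (B : preTopGroupType) (f : G -> B) (V : set B) :
  compactification f -> nbhs 1 V ->
  exists U, open_finite U /\ forall g, U g -> V (f g).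
Proof.
move=> [[Btg Bc Bh] [fM fC fD]] V1.
have f1 : f 1 = 1.
  have : f 1 * f 1 = f 1 by rewrite -fM mulg1.
  by move=> /(congr1 (fun x => x * (f 1)^-1)); rewrite mulgK mulgV.
have fV g : f g^-1 = (f g)^-1.
  by rewrite -[LHS]mulg1 -(mulgV (f g)) mulgA -fM mulVg f1 mul1g.
(* W has its closure in V, which keeps the closed subgroup D below inside V. *)
have [W W1 WV] := compact_regular Bh Bc (filterT : nbhs (1 : B) setT) V1.
have : nbhs (1 : G) (f @^-1` W) by apply: fC; rewrite f1.
rewrite nbhsE => -[W' [oW' W'1] W'W].
have [A AW'] := open_pstab_sub oW' W'1.
have AW g : pstab A g -> W (f g) by move=> /AW'; rewrite mul1g; exact: W'W.
have sA := pstab_subgroup A; have [A1 AM AV] := sA.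
pose D : set B := closure (f @` pstab A).
have sD : subgroup D.
  apply: closure_subgroup => //; split; first by exists 1.
  - by move=> _ _ [g gA <-] [h hA <-]; exists (g * h) => //; exact: AM.
  - by move=> _ [g gA <-]; exists g^-1 => //; exact: AV.
have [D1 DM DV] := sD.
have fAD g : pstab A g -> D (f g) by move=> gA; apply: subset_closure; exists g.
have DV' : D `<=` V.
  by move=> x xD; apply: WV; apply: closure_subset xD => _ [g gA <-]; exact: AW.
have cD : compact D by apply: (subclosed_compact _ Bc) => //; exact: closed_closure.
pose DD (r : G) : set B := (fun z : B * B => z.1 * f r * z.2) @` (D `*` D).
have cDD r : closed (DD r).
  apply: compact_closed => //; apply: continuous_compact; last exact: compact_setX.
  by apply: continuous_subspaceT => z; exact: continuous_two_sided.
have DDD r x : DD r x -> D x <-> D (f r).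
  move=> [[a b] /= [aD bD] <-]; split=> h.
    have := DM _ _ (DM _ _ (DV _ aD) h) (DV _ bD).
    by rewrite !mulgA mulVg mul1g mulgK.
  by apply: (DM) => //; exact: DM.
have [rs rsP] := Mdc A.
have DDcl (l : seq G) : closed (foldr (fun r => setU (DD r)) set0 l).
  by elim: l => [|r l IH]; [exact: closed0|exact: closedU].
have DDin (l : seq G) x : foldr (fun r => setU (DD r)) set0 l x <->
    exists2 r, List.In r l & DD r x.
  elim: l => [|r l IH] /=; first by split=> // -[].
  split=> [[h|/IH[r' h1 h2]]|[r' [<-|h1] h2]].
  - by exists r => //; left.
  - by exists r' => //; right.
  - by left.
  - by right; apply/IH; exists r'.
have cover x : exists2 r, List.In r rs & DD r x.
  apply/DDin; apply: contrapT => nx.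
  have [||y [ny [g _ gy]]] := fD (~` (foldr (fun r => setU (DD r)) set0 rs)).
  - by exists x.
  - exact/closed_openC.
  subst y; apply: ny; apply/DDin; have [r [rrs [h [k [hA kA ->]]]]] := rsP g.
  exists r => //; exists (f h, f k); first by split; exact: fAD.
  by rewrite /= !fM.
have oD : open D.
  have -> : D = ~` (foldr (fun r => setU (DD r)) set0 [seq r <- rs | ~~ `[< D (f r) >]]).
    apply/seteqP; split=> x.
      by move=> xD /DDin[r /(In_filterN (fun r => D (f r)))[_ nr] /DDD/iffLR/(_ xD)].
    move=> nx; have [r rrs xr] := cover x; apply/(DDD _ _ xr).
    apply: contrapT => nr; apply: nx; apply/DDin; exists r => //.
    by apply/(In_filterN (fun r => D (f r))).
  exact/closed_openC.
pose U0 : set G := [set g | D (f g)].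
have sU0 : subgroup U0.
  split=> [|g h|g]; rewrite /U0 /=; first by rewrite f1.
    by rewrite fM; exact: DM.
  by rewrite fV; exact: DV.
have oU0 : open U0 by apply: subgroup_open sU0 _ => g; exact: fAD.
have fU0 : fin_index U0.
  have [l lP] := open_subgroup_finite_cover Btg Bc oD sD.
  have /choice[i iP] : forall g : G, exists i : 'I_(size l), D ((tnth (in_tuple l) i)^-1 * f g).
    move=> g; have [c cl cg] := lP (f g).
    by have [i ic] := In_tnth cl; exists i; rewrite ic.
  exists 'I_(size l), i => g h gh; rewrite /U0 /= fM fV.
  have := DM _ _ (DV _ (iP g)) (iP h).
  by rewrite gh invgM invgK -mulgA mulVKg.
have [U oU UU0] := open_finite_core oU0 sU0 fU0.
by exists U; split=> // g /UU0/DV'.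
Qed.

End Compactification.

(** * Open subgroups and finite equivalence relations *)

Section FiniteEquivalenceTransfer.
Variables (L : signature) (M C : structure L) (emb : forall s, M s -> C s).
Hypothesis emb_elem : elementary emb.
Variables (V : Type) (sv : V -> lsort L) (q : formula (vsum sv sv)).

Let rel (N : structure L) (a b : env N sv) := sat q (epair a b).

Let inst W (sw : W -> lsort L) (x y : forall v, term sw (sv v)) : formula sw :=
  subst q (fun w => match w return term sw (vsum sv sv w) with
                    | inl v => x v | inr v => y v end).

Let instP (N : structure L) W (sw : W -> lsort L) x y (a : env N sw) :
  sat (inst x y) a <->
  rel (fun v => eval a (x v) : N (sv v)) (fun v => eval a (y v) : N (sv v)).
Proof. by rewrite /inst (propext (sat_subst _ _ _)); split; apply: sat_ext => -[]. Qed.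

Let some_env : exists c : env M sv, True.
Proof.
have /dchoice[c _] : forall v, exists z : M (sv v), True.
  by move=> v; case: (inhab M (sv v)) => z; exists z.
by exists c.
Qed.

Lemma equivalence_transfer : equivalence (@rel M) -> equivalence (@rel C).
Proof.
have [c _] := some_env; move=> [qrefl qsym qtrans].
pose s3 := vsum (vsum sv sv) sv.
pose x v := Var s3 (inl (inl v)); pose y v := Var s3 (inl (inr v)); pose z v := Var s3 (inr v).
have valid (p : formula s3) (a : env C s3) : (forall a : env M s3, sat p a) -> sat p a.
  by move=> H; apply: (elem_valid emb_elem (P := set0) (c := epair (epair c c) c)).
split=> [a|a b ab|a b d ab bd].
- have := valid (inst x x) (epair (epair a a) a); rewrite (propext (instP _ _ _)); apply.
  by move=> e; apply/instP; exact: qrefl.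
- have := valid (Imp (inst x y) (inst y x)) (epair (epair a b) b).
  rewrite (propext (sat_imp _ _ _)) !(propext (instP _ _ _)); apply=> // e.
  by apply/sat_imp => /instP/qsym h; apply/instP.
- have := valid (Imp (inst x y) (Imp (inst y z) (inst x z))) (epair (epair a b) d).
  rewrite !(propext (sat_imp _ _ _)) !(propext (instP _ _ _)) => H.
  apply: H ab bd => e; apply/sat_imp => /instP h1; apply/sat_imp => /instP h2.
  by apply/instP; exact: qtrans h1 h2.
Qed.

Lemma finite_classes_transfer (l : seq (env M sv)) :
  equivalence (@rel M) -> (forall a, exists2 c, List.In c l & rel c a) ->
  finite_set (classes (@rel C)).
Proof.
move=> qeq lP; apply: (finite_classes (l := [seq emap emb c | c <- l])).
  exact: equivalence_transfer.
move=> a; pose I := 'I_(size l); pose r (i : I) := tnth (in_tuple l) i.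
pose si (iv : I * V) := sv iv.2; pose W := vsum si sv.
pose t (i : I) : formula W := inst (fun v => Var W (inl (i, v))) (fun v => Var W (inr v)).
have [c0 _] := some_env.
have H : sat (fOrL [seq t i | i <- enum I]) (epair (fun iv => emb (r iv.1 iv.2)) a : env C W).
  apply: (elem_valid emb_elem (P := fun w => if w is inl _ then True else False)
    (c := (epair (fun iv => r iv.1 iv.2) c0 : env M W))); last by case.
  move=> e eP; have [c cl ca] := lP (fun v => e (inr v)); have [i ic] := In_tnth cl.
  apply/sat_orL; exists (t i); first by apply: List.in_map; exact: In_enum.
  apply/instP; apply: sat_ext ca => -[v|v] //=.
  by rewrite (eP (inl (i, v))) //= /r ic.
move: H => /sat_orL[p /List.in_map_iff[i [<- _]] /instP h].
exists (emap emb (r i)); first by apply: List.in_map; exact: tnth_In.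
by apply: sat_ext h => -[].
Qed.

End FiniteEquivalenceTransfer.

Section OpenFiniteDefinable.
Variables (L : signature) (M C : structure L) (emb : forall s, M s -> C s).
Hypothesis emb_elem : elementary emb.
Hypothesis Mcount : countable_structure M.
Hypothesis Mcat : omega_categorical M.
Variable K : Type.
Hypothesis Klim : uncountable_strong_limit K.
Hypothesis Csat : saturated C K.
Local Notation G := (aut M).
Local Notation es := (@elt_sort L M).

(** As U is normal and contains some G_A, O is stable under G_A on both sides; so whether g is in O
    depends only on the orbit of A together with g(A). *)
Lemma saturated_set_definable (U O : set G) : open_finite U ->
  (forall g h, O g -> U h -> O (g * h)) ->
  exists p : formula (vsum es es), forall g, O g <-> sat p (pair_env g).
Proof.
move=> [oU [U1 UM UV] UN _] OU.
have [A AU] := open_pstab_sub oU U1.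
have {}AU h : pstab A h -> U h by move=> /AU; rewrite mul1g.
pose D := [set z : env M (vsum es es) | exists k g : G, O g /\
  forall w, List.In w (pair_supp A) -> k _ (pair_env g w) = z w].
have [|p [_ pP]] := invariant_definable_countable emb_elem Mcount Mcat Klim Csat
    (@pair_surj L M) (countable_pair Mcount) (S := pair_supp A) (D := D).
  move=> h a b ab [k [g [Og kg]]]; exists (h * k), g; split=> // w wS.
  by rewrite -ab // -kg.
exists p => g; rewrite -(propext (pP _)); split=> [Og|[k [g' [Og' kg]]]].
  by exists 1, g.
have [/AU Uk /AU gkg] := pair_aut kg.
have -> : g = g' * (g'^-1 * k * g') * (g^-1 * k * g')^-1.
  by rewrite !invgM invgK !mulgA mulgV mul1g mulgK mulgV mul1g.
apply: (OU); last exact: UV.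
by apply: (OU) => //; have := UN _ g'^-1 Uk; rewrite invgK.
Qed.

(* Classes: the cosets of U, transported to the orbit of the enumeration of A, *)
(* and the complement of this orbit.                                           *)
Lemma open_finite_equivalence (U : set G) : open_finite U ->
  exists q : formula (vsum es es),
    [/\ equivalence (fun a b : env M es => sat q (epair a b)),
        exists l : seq (env M es), forall a, exists2 c, List.In c l & sat q (epair c a) &
        forall g, U g <-> sat q (pair_env g)].
Proof.
move=> [oU [U1 UM UV] UN Ufin].
have [A AU] := open_pstab_sub oU U1.
have {}AU h : pstab A h -> U h by move=> /AU; rewrite mul1g.
pose im (g : G) (y : env M es) := forall z, List.In z A -> y z = g _ (elt_env (M := M) z).
have imU g h y : im g y -> im h y -> U (g^-1 * h).
  move=> gy hy; apply: AU => s x xA; rewrite -[LHS]/(g^-1 s (h s x)).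
  by rewrite -(hy _ xA) (gy _ xA) -[LHS]/((g^-1 * g) s x) mulVg.
pose E (y z : env M es) := (exists g h, [/\ im g y, im h z & U (g^-1 * h)]) \/
  ~ (exists g, im g y) /\ ~ (exists g, im g z).
have Eeq : equivalence E.
  split=> [y|y z [[g [h [gy hz gh]]]|[ny nz]]|x y z].
  - have [[g gy]|ny] := pselect (exists g, im g y); last by right.
    by left; exists g, g; rewrite mulVg.
  - by left; exists h, g; split=> //; have := UV _ gh; rewrite invgM invgK.
  - by right.
  - move=> [[g [h [gx hy gh]]]|[nx ny]] [[g' [h' [gy' hz' gh']]]|[ny' nz]].
    + left; exists g, h'; split=> //.
      have := UM _ _ (UM _ _ gh (imU _ _ _ hy gy')) gh'.
      by rewrite -!mulgA !mulVKg.
    + by exfalso; apply: ny'; exists h.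
    + by exfalso; apply: ny; exists g'.
    + by right.
pose D := [set z : env M (vsum es es) | E (fun w => z (inl w)) (fun w => z (inr w))].
have [|q [_ qP]] := invariant_definable_countable emb_elem Mcount Mcat Klim Csat
    (@pair_surj L M) (countable_pair Mcount) (S := pair_supp A) (D := D).
  move=> k a b ab.
  have kab1 z : List.In z A -> k _ (a (inl z)) = b (inl z).
    by move=> zA; apply: (ab (inl z)); apply/pair_suppP; exists z => //; left.
  have kab2 z : List.In z A -> k _ (a (inr z)) = b (inr z).
    by move=> zA; apply: (ab (inr z)); apply/pair_suppP; exists z => //; right.
  have kim g (y y' : env M es) : (forall z, List.In z A -> k _ (y z) = y' z) ->
      im g y -> im (k * g) y'.
    by move=> yy' gy z zA; rewrite -yy' // gy.
  have kim' g (y y' : env M es) : (forall z, List.In z A -> k _ (y z) = y' z) ->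
      im g y' -> im (k^-1 * g) y.
    move=> yy' gy z zA; rewrite -[RHS]/(k^-1 _ (g _ (elt_env (M := M) z))) -gy // -yy' //.
    by rewrite -[RHS]/((k^-1 * k) _ (y z)) mulVg.
  move=> [[g [h [ga ha gh]]]|[n1 n2]].
    left; exists (k * g), (k * h); split; [exact: kim kab1 ga|exact: kim kab2 ha|].
    by rewrite invgM -!mulgA mulKg.
  right; split=> -[g gb]; [apply: n1|apply: n2]; exists (k^-1 * g).
    exact: kim' kab1 gb.
  exact: kim' kab2 gb.
have qE a b : E a b <-> sat q (epair a b) by exact: (qP (epair a b)).
exists q; split.
- have [h1 h2 h3] := Eeq.
  by split=> [a|a b /qE ab|a b c /qE ab /qE bc]; apply/qE; [exact: h1|exact: h2|exact: h3 ab bc].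
- have [rs rsP] := fin_index_reps Ufin.
  have [y0 y0P] : exists y0 : env M es, forall y, ~ (exists g, im g y) -> ~ exists g, im g y0.
    have [[y ny]|h] := pselect (exists y, ~ exists g, im g y); first by exists y.
    by exists (@elt_env L M) => y ny; exfalso; apply: h; exists y.
  exists (y0 :: map (fun r : G => emap r (@elt_env L M)) rs) => y.
  have [[g gy]|ny] := pselect (exists g, im g y); last first.
    by exists y0; [left|apply/qE; right; split=> //; exact: y0P ny].
  have [r rrs rg] := rsP g; exists (emap r (@elt_env L M)).
    by right; exact: (List.in_map (fun r : G => emap r (@elt_env L M))).
  by apply/qE; left; exists r, g.
- move=> g; rewrite -(propext (qE _ _)); split=> [Ug|].
    by left; exists 1, g; split=> //; rewrite invg1 mul1g.
  move=> [[h [k [h1 kg hk]]]|[n1 _]]; last by exfalso; apply: n1; exists 1.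
  have := UM _ _ (UM _ _ (imU 1 _ _ (fun _ _ => erefl) h1) hk) (imU _ g _ kg (fun _ _ => erefl)).
  by rewrite invg1 mul1g -!mulgA !mulVKg.
Qed.

End OpenFiniteDefinable.

Section StabiliserOfClasses.
Variables (L : signature) (M C : structure L) (emb : forall s, M s -> C s).
Hypothesis emb_elem : elementary emb.
Variables (V : Type) (sv : V -> lsort L) (p : formula (vsum sv sv)).
Local Notation G := (aut M).

(** The kernel of an action on finitely many classes has finite index. It is open because a class is
    preserved as soon as the relevant coordinates of one representative are fixed. *)
Lemma finite_equivalence_open :
  equivalence (fun a b : env C sv => sat p (epair a b)) ->
  finite_set (classes (fun a b : env C sv => sat p (epair a b))) ->
  open_finite [set g : G | forall e : env M sv, sat p (epair e (emap g e))].
Proof.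
set EC := fun a b : env C sv => _ => -[Crefl Csym Ctrans] Cfin.
pose E (a b : env M sv) := sat p (epair a b).
have EE a b : E a b <-> EC (emap emb a) (emap emb b).
  rewrite /E /EC (propext (emb_elem _ _)).
  by split; apply: sat_ext => -[].
have Erefl a : E a a by apply/EE.
have Esym a b : E a b -> E b a by move=> /EE/Csym h; apply/EE.
have Etrans a b c : E a b -> E b c -> E a c.
  by move=> /EE h1 /EE h2; apply/EE; exact: Ctrans h1 h2.
have Einv (g : G) a b : E a b <-> E (emap g a) (emap g b).
  rewrite /E (propext (sat_aut g p _)).
  by split; apply: sat_ext => -[].
have [e0 _] : exists e : env M sv, True.
  have /dchoice[e _] : forall v, exists z : M (sv v), True.
    by move=> v; case: (inhab M (sv v)) => z; exists z.
  by exists e.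
have [l lP] : exists l : seq (env M sv), forall a, exists2 c, List.In c l & E c a.
  have [cs csP] := finite_set_list Cfin.
  have /choice[r rP] : forall c : set (env C sv), exists e : env M sv,
      forall e', c (emap emb e') -> c (emap emb e).
    move=> c; have [[e ce]|nc] := pselect (exists e : env M sv, c (emap emb e)).
      by exists e.
    by exists e0 => e' ce'; exfalso; apply: nc; exists e'.
  exists (map r cs) => a; pose c := [set y | EC (emap emb a) y].
  exists (r c); last by apply/Esym/EE; exact: (rP c a (Crefl _)).
  by apply: List.in_map; apply/csP; exists (emap emb a).
set U := [set g | _].
have sU : subgroup U.
  split=> [e|g h gU hU e|g gU e]; first exact: Erefl.
    by apply: Etrans (hU e) _; exact: (gU (emap h e)).
  apply: Esym; have := gU (emap (g^-1%g : G) e).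
  by rewrite -emap_mul mulgV emap_one.
split=> //.
- have [S Sp] := supp_ex p.
  pose A := flatten [seq pmap (fun x => if x is inr v
    then Some (existT (fun s => M s) (sv v) (c v)) else None) S | c <- l].
  have inA c v : List.In c l -> List.In (inr v) S -> List.In (existT (fun s => M s) (sv v) (c v)) A.
    rewrite /A => cl vS; elim: (l) cl => //= c' l' IH [->|/IH h]; apply/List.in_app_iff.
      left; elim: (S) vS => //= -[w|w] T IHT [] //=; first by case=> ->; left.
      by move=> /IHT; right.
    by right.
  apply: (@subgroup_open _ _ U A) => // g gA e; have [c cl ce] := lP e.
  have cgc : E c (emap g c).
    apply: (Sp _ (epair c c)) (Erefl c) => -[//|v] vS /=.
    by rewrite /emap gA //; exact: inA.
  have gce : E (emap g c) (emap g e) := (Einv g _ _).1 ce.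
  exact: Etrans _ _ _ (Esym _ _ ce) (Etrans _ _ _ cgc gce).
- move=> x y xU e; apply/(Einv (y^-1)%g).
  by rewrite -emap_mul !mulgA mulVg mul1g emap_mul; exact: xU.
- have /choice[i iP] : forall a : env M sv, exists i : 'I_(size l), E (tnth (in_tuple l) i) a.
    by move=> a; have [c cl ca] := lP a; have [i ic] := In_tnth cl; exists i; rewrite ic.
  exists {ffun 'I_(size l) -> 'I_(size l)}, (fun g : G => [ffun j => i (emap g (tnth (in_tuple l) j))]).
  move=> g h /ffunP gh e; apply/(Einv g); rewrite -emap_mul mulVKg.
  have [c cl ce] := lP e; have [j jc] := In_tnth cl.
  have := gh j; rewrite !ffunE jc => ij.
  have gc_hc : E (emap g c) (emap h c).
    have e1 := iP (emap g c); rewrite ij in e1.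
    exact: Etrans _ _ _ (Esym _ _ e1) (iP (emap h c)).
  have gec : E (emap g e) (emap g c) := (Einv g _ _).1 (Esym _ _ ce).
  have hce : E (emap h c) (emap h e) := (Einv h _ _).1 ce.
  exact: Etrans _ _ _ gec (Etrans _ _ _ gc_hc hce).
Qed.

End StabiliserOfClasses.

(** * The isomorphism theta and the Bohr compactification *)

Lemma morph_one (A B : groupType) (f : A -> B) : {morph f : x y / x * y} -> f 1 = 1.
Proof.
move=> fM; have : f 1 * f 1 = f 1 by rewrite -fM mulg1.
by move=> /(congr1 (fun x => x * (f 1)^-1)); rewrite mulgK mulgV.
Qed.

Lemma morph_inv (A B : groupType) (f : A -> B) x : {morph f : x y / x * y} ->
  f x^-1 = (f x)^-1.
Proof.
by move=> fM; rewrite -[LHS]mulg1 -(mulgV (f x)) mulgA -fM mulVg (morph_one fM) mul1g.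
Qed.

Lemma topgroup_iso_compact_group (A B : preTopGroupType) (f : A -> B) : topgroup_iso f ->
  [/\ topological_group B, compact [set: B] & hausdorff_space B] ->
  [/\ topological_group A, compact [set: A] & hausdorff_space A].
Proof.
move=> [fM fC [g [fK gK gC]]] [[BM BV] Bc Bh]; split.
- split.
    move=> [x y] /=; have -> : (fun z : A * A => z.1 * z.2) =
        g \o (fun z => z.1 * z.2) \o (fun z : A * A => (f z.1, f z.2)).
      by apply/funext => z /=; rewrite -fM fK.
    apply: continuous_comp; last by apply: continuous_comp; [exact: BM|exact: gC].
    apply: cvg_pair => /=.
      by apply: (cvg_comp _ _ cvg_fst); exact: fC.
    by apply: (cvg_comp _ _ cvg_snd); exact: fC.
  move=> x; have -> : (fun x : A => x^-1) = g \o (fun x => x^-1) \o f.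
    by apply/funext => z /=; rewrite -(morph_inv _ fM) fK.
  apply: continuous_comp; first exact: fC.
  by apply: continuous_comp; [exact: BV|exact: gC].
- have <- : g @` [set: B] = [set: A].
    by apply/seteqP; split=> // x _; exists (f x).
  by apply: continuous_compact => //; exact: continuous_subspaceT.
- move=> x y xy; rewrite -(fK x) -(fK y); congr g; apply: Bh => P R xP yR.
  have [z [zP zR]] := xy _ _ (fC x _ xP) (fC y _ yR).
  by exists (f z).
Qed.

(* A compactification of G is determined on the cosets of the open normal      *)
(* subgroups of finite index, up to arbitrarily small errors.                  *)
Lemma profinite_bohr (L : signature) (M : structure L) (B : preTopGroupType)
    (r : aut M -> B) : finite_double_cosets M ->
  compactification r -> range r = setT ->
  (forall U g, open_finite U -> nbhs (r g) [set q | forall h, r h = q -> U (g^-1 * h)]) ->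
  bohr_compactification r.
Proof.
move=> Mdc rc rT rU; split=> // D f fc.
have [_ [rM rC _]] := rc; have [[Dtg Dc Dh] [fM fC fD]] := fc.
have f_nbhs g O : nbhs (f g) O -> exists U, open_finite U /\ forall h, U (g^-1 * h) -> O (f h).
  move=> gO; have : nbhs 1 ((fun y => f g * y) @^-1` O).
    by apply: (continuous_mull Dtg); rewrite mulg1.
  move=> /(compactification_profinite Mdc fc)[U [oU UO]]; exists U; split=> // h /UO /=.
  by rewrite -fM mulVKg.
have rf g h : r g = r h -> f g = f h.
  move=> rgh; apply: Dh => O1 O2 gO1 hO2.
  have [U [oU UO1]] := f_nbhs _ _ gO1.
  exists (f h); split; last exact: nbhs_singleton.
  by apply: UO1; apply: (nbhs_singleton (rU U g oU)).
have /choice[s sP] : forall b, exists g, r g = b.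
  move=> b; have rb : range r b by rewrite rT.
  by case: rb => g _ <-; exists g.
exists (f \o s); split.
  split.
  - by move=> a b /=; rewrite -fM; apply: rf; rewrite rM !sP.
  - move=> b O /= /f_nbhs[U [oU UO]].
    have := rU U (s b) oU; rewrite sP; apply: filterS => q qU.
    by apply: UO; apply: qU; exact: sP.
  - by apply/funext => g /=; apply: rf; exact: sP.
move=> h [_ _ hr]; apply/funext => b /=.
by rewrite -hr /= sP.
Qed.

Section Theta.
Variables (L : signature) (M : structure L).
Hypothesis Mcount : countable_structure M.
Hypothesis Mcat : omega_categorical M.
Variables (K K' : Type) (Ms : elext (with_group M)) (Mss : elext Ms).
Hypothesis Klim : uncountable_strong_limit K.
Hypothesis Csat : saturated (reduct Ms) K.
Hypothesis Chom : strongly_homogeneous (reduct Ms) K.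
Hypothesis Klim' : uncountable_strong_limit K'.
Hypothesis Mss_sat : saturated Mss K'.
Hypothesis Ms_small : small K' {s & Ms s}.
Local Notation GL := (gsig M).
Local Notation gs := (None : lsort GL).
Local Notation G := (aut M).
Local Notation C := (reduct Ms).
Local Notation X := (elext_trans Mss).
Local Notation GX := (gsort X).
Local Notation es := (@elt_sort L M).
Local Notation emb := (@pemb L M Ms).
Local Notation emb_elem := (@pemb_elem L M Ms).
Local Notation base := (@base_env L M C emb).
Local Notation Q := (logic_quotient K' (N00 X)).
Local Notation proj := (to_logic_quotient K' (N00 X)).
Local Notation toKP := (@to_Gal_KP K L C).
Local Notation restricts := (@restricts_to L M Ms Mss).

Let Xsat : saturated X K' := Mss_sat.
Let smallM : small K (elt M).
Proof. by apply: small_countable => //; exact: countable_elt. Qed.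

Definition jemb s (x : C s) : reduct X s := @ext_emb _ _ Mss (Some s) x.

Lemma jemb_elem : @elementary L C (reduct X) jemb.
Proof.
move=> V sv p a; pose sw (v : V) : lsort GL := Some (sv v).
have := @ext_elem _ _ Mss _ sw (trans (M := M) p (fun v => Var sw v)) (a : env Ms sw).
by rewrite !(propext (sat_trans _ _ _)).
Qed.

Lemma restrictsP (x : GX) (s : aut C) : restricts_to x s <->
  forall k (y : C k), gact x (jemb y) = jemb (s k y).
Proof. by []. Qed.

(** On finitely many elements s is induced by an element of the group of [Ms], by
    [group_element_exists]; saturation of [Mss] combines these conditions. *)
Lemma restricts_exists (s : aut C) : exists x : GX, restricts_to x s.
Proof.
pose E := {k : lsort L & Ms (Some k)}.
pose sw (o : option E) : lsort GL := if o is Some z then Some (projT1 z) else None.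
pose b : env Mss sw := fun o => match o return Mss (sw o) with
  | Some z => jemb (projT2 z : C (projT1 z)) | None => (1 : GX) end.
have sE : small K' (option E).
  apply: small_option => //; apply: small_le Ms_small.
  exists (fun z : E => existT (fun k => Ms k) (Some (projT1 z)) (projT2 z)).
  move=> [k y] [k' y'] /= e.
  have ek := projT1_eq e; rewrite /= in ek; case: ek => ek; subst k'.
  by rewrite (existT_inj e).
pose vx : term sw gs := Var sw None.
pose u (z : E) : term sw (Some (projT1 z) : lsort GL) := Var sw (Some z).
pose u' (z : E) : term sw (Some (projT1 z) : lsort GL) :=
  Var sw (Some (existT (fun k => Ms (Some k)) (projT1 z) (s _ (projT2 z : C (projT1 z))))).
pose phi z : formula sw := Equ (tAct vx (u z)) (u' z).
have [l|c [cD cP]] := saturation Mss_sat sE (D := fun o => if o is Some _ then True else False)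
    (a := b) (phi := phi).
  pose I := 'I_(size l); pose t (i : I) := tnth (in_tuple l) i.
  pose si (i : I) := projT1 (t i); pose W := vsum si es.
  pose c1 : env C W := epair (fun i => projT2 (t i) : C (si i)) base.
  pose d1 : env C W := epair (fun i => s _ (projT2 (t i) : C (si i))) base.
  have [||p Sp pc|x xP] := @group_element_exists L M Ms Mcount Mcat K Klim Csat _ W
      [seq inl i | i <- enum I] c1 d1.
  - by apply: countable_sum; [exact: countable_countType|exact: countable_elt].
  - by move=> r; have [z <-] := elt_surj M r; exists (inr z).
  - have := (sat_aut s p c1).1 pc; apply: Sp => w /List.in_map_iff[i [<- _]] //.
  exists (fun o => match o return Mss (sw o) with
    | Some z => b (Some z) | None => @ext_emb _ _ Mss None x end); split; first by case.
  move=> z zl; have [i iz] := In_tnth zl; apply/sat_equ; rewrite eval_tAct /=.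
  have := xP (inl i) (List.in_map _ _ _ (In_enum i)).
  rewrite /= /si -/(t i) -/(t i) => h.
  have hz : gact (M := M) (X := Ms) x (projT2 z) = s _ (projT2 z : C (projT1 z)).
    by have : forall w, t i = w -> gact (M := M) (X := Ms) x (projT2 w) = s _ (projT2 w : C (projT1 w));
      [move=> w <-|move=> /(_ _ iz)].
  rewrite /jemb -hz; apply: etrans (esym (@elementary_fint GL Ms Mss _ (Act (projT1 z))
    (fun b : bool => match b return Ms (if b then None else Some (projT1 z)) with
                     | true => x | false => projT2 z end) (@ext_elem _ _ Mss))).
  congr (@fint GL Mss (Act (projT1 z))).
  by apply: functional_extensionality_dep => -[].
exists (c None) => k y.
have := (sat_equ _ _ c).1 (cP (existT (fun k => Ms (Some k)) k y)).
rewrite eval_tAct /= (cD (Some _)) // (cD (Some _)) //.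
Qed.

Lemma restricts_mul x y (s t : aut C) : restricts_to x s -> restricts_to y t ->
  restricts_to (x * y : GX) (s * t).
Proof.
move=> /restrictsP xs /restrictsP yt; apply/restrictsP => k z.
by rewrite gact_mul yt xs.
Qed.

Lemma gact1 k (z : reduct X k) : gact (1 : GX) z = z.
Proof.
have e : gact (1 : GX) (gact (1 : GX) z) = gact (1 : GX) z by rewrite -gact_mul mulg1.
pose a : env (reduct X) (fun b : bool => k) := fun b => if b then gact (1 : GX) z else z.
have := (gact_sat (Equ (Var (fun b : bool => k) true) (Var (fun b : bool => k) false)) (1 : GX) a).2.
exact.
Qed.

Lemma restricts_inv (x : GX) (s : aut C) : restricts x s -> restricts (x^-1 : GX) s^-1.
Proof.
move=> /restrictsP xs; apply/restrictsP => k y.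
have e : s k (s^-1 k y) = y by rewrite -[LHS]/((s * s^-1) k y) mulgV.
by rewrite -[in LHS]e -xs -gact_mul mulVg gact1.
Qed.

Lemma restricts_setwise (x : GX) (s : aut C) : restricts x s -> fixes_Ms_setwise x.
Proof.
move=> xs k; apply/seteqP; split=> [_ [y _ <-]|_ [y _ <-]].
  by rewrite /= xs; exists (s k y).
exists (s^-1 k y) => //; rewrite xs.
by rewrite -[s k (s^-1 k y)]/((s * s^-1) k y) mulgV.
Qed.

Lemma restricts_sat (x : GX) (s : aut C) V (sv : V -> lsort L) (p : formula (vsum sv sv))
    (a : env C sv) : restricts x s ->
  sat p (epair a (emap s a)) <->
  sat (M := reduct X) p (epair (fun v => jemb (a v))
    (fun v => gact x (jemb (a v)) : reduct X (sv v))).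
Proof.
move=> /restrictsP xs; rewrite (propext (@jemb_elem _ _ p _)).
by split; apply: sat_ext => -[v|v] //=; rewrite xs.
Qed.

Lemma into_restricts (O : set G) (p : formula (vsum es es)) (x : GX) (s : aut C) :
  open O -> (forall g, O g <-> sat p (pair_env g)) -> restricts x s ->
  into O x <-> sat p (epair base (emap s base)).
Proof.
move=> oO Op xs; rewrite (propext (into_open oO _)) (propext (restricts_sat _ _ xs)).
exact: (interp_trans (O := exist _ O oO) Op).
Qed.

(** The stabiliser of the classes of a finite definable relation is one of the U, and preserving
    these classes transfers to its interpretation. Conversely, each U is given by a finite definable
    relation between m and its image. *)
Lemma core00_Autf_Sh (x : GX) (s : aut C) : restricts x s -> core00 x <-> Autf_Sh K s.
Proof.
move=> xs; split=> [xN V sv a sV E Eeq [p Ep] Efin|sSh U oU].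
  apply/Ep.
  have EE : E = fun a b => sat p (epair a b).
    by apply/funext => b; apply/funext => c; exact/propext.
  have oU := @finite_equivalence_open L M C _ emb_elem V sv p.
  rewrite EE in Eeq Efin; have {}oU := oU Eeq Efin; have [opU _ _ _] := oU.
  have /(into_open opU) xU := xN _ oU.
  apply/(restricts_sat _ _ xs); exact: (interp_forall (U := exist _ _ opU) _ xU).
have [q [qeq [l lP] Uq]] := open_finite_equivalence emb_elem Mcount Mcat Klim Csat oU.
have [opU _ _ _] := oU; apply/(into_restricts opU Uq xs).
apply: (sSh _ _ base smallM (fun a b => sat q (epair a b))).
- exact: (equivalence_transfer emb_elem qeq).
- by exists q.
- exact: (finite_classes_transfer emb_elem qeq lP).
Qed.

(** One implication makes theta well defined, the other makes it injective. *)
Lemma proj_restricts x y (s t : aut C) : restricts x s -> restricts y t ->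
  proj x = proj y <-> toKP s = toKP t.
Proof.
move=> xs yt; rewrite (propext (proj_eq _ _ _)).
have xy := restricts_mul (restricts_inv xs) yt.
rewrite (propext (core00_Autf_Sh xy)) -(Autf_KP_Sh emb_elem Mcount Mcat Klim Csat Chom).
by apply: iff_sym; exact: coset_eq.
Qed.

Lemma toKP_surj (q : Gal_KP K C) : exists s, toKP s = q.
Proof. by exists (repr q); exact: coset_repr. Qed.

Lemma toKP_mul s t : toKP s * toKP t = toKP (s * t).
Proof. exact: quotient_mulE. Qed.

Lemma theta_exists : exists theta : Gal_KP K C -> Q,
  forall x s, restricts x s -> theta (toKP s) = proj x.
Proof.
have /choice[e eP] := restricts_exists.
exists (fun q => proj (e (repr q))) => x s xs.
by apply/(proj_restricts (eP _) xs); exact: coset_repr.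
Qed.

Lemma fix_core00 (x : GX) :
  (forall s (z : M s), gact x (pemb X z) = pemb X z) -> core00 x.
Proof.
move=> xfix U [oU [U1 _ _] _ _]; have [A AU] := open_pstab_sub oU U1.
apply/(into_open oU); apply: (interp_pstab (A := A)) => [g gA /=|s z _].
  by have := AU g gA; rewrite mul1g.
exact: xfix.
Qed.

Lemma extends_exists (g : G) : exists s : aut C, extends_aut s g.
Proof.
have [|s sP] := Chom (a := base) (b := @emap L M C emb _ _ (emap g (@elt_env L M))) smallM.
  move=> p; rewrite -!(propext (emb_elem p _)).
  exact: sat_aut.
by exists s => k x; have := congr1 (fun f => f (existT _ k x)) sP.
Qed.

Lemma proj_extends (g : G) (s : aut C) x : extends_aut s g -> restricts x s ->
  proj x = proj (gemb X g).
Proof.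
move=> sg xs; apply/proj_eq/fix_core00 => k z.
rewrite gact_mul gact_pemb.
have -> : pemb X (g k z) = gact x (pemb X z).
  rewrite -[RHS]/(gact x (jemb (emb z))).
  by move/restrictsP: xs => ->; rewrite sg.
by rewrite -gact_mul mulVg gact1.
Qed.

(** Representatives in G of the cosets of x modulo the U form a coherent family, and its limit has
    the class of x. So G maps onto the quotient, not just onto a dense subset. *)
Lemma gemb_dense (x : GX) : exists g, proj (gemb X g) = proj x.
Proof.
have /choice[gam gamP] : forall U : set G, exists g, open_finite U -> into U ((gemb X g)^-1 * x).
  move=> U; have [oU|nU] := pselect (open_finite U); last by exists 1.
  by have [g gx] := into_rep x oU; exists g.
have [|g gP] := coherent_limit emb_elem Mcount Mcat Klim Csat (gam := gam).
  move=> U V oU oV VU; have [opU sU _ _] := oU.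
  have [_ IM IV] := into_subgroup X opU sU.
  apply/(into_gemb X _ opU); rewrite gembM gembV.
  have h := into_sub opU VU (gamP V oV).
  by have := IM _ _ (gamP U oU) (IV _ h); rewrite invgM invgK -mulgA mulVKg.
exists g; apply/proj_eq => U oU; have [opU sU _ _] := oU.
have [_ IM IV] := into_subgroup X opU sU.
have /(into_gemb X _ opU) := gP U oU; rewrite gembM gembV => h.
by have := IM _ _ h (gamP U oU); rewrite -mulgA mulVKg.
Qed.

Lemma Gal_KP_closed (B : set (Gal_KP K C)) : closed B <->
  exists Phi : set (formula (vsum es es)), forall s : aut C,
    B (toKP s) <-> realizes (epair (emap s base) base) Phi.
Proof.
have KPL s : Gal_L_to_KP (to_Gal_L K s) = toKP s.
  apply/coset_eq; apply: Autf_L_sub_KP.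
  exact: ((coset_eq (Autf_nsubgroup K (@E_L_equivalence L C K) (@E_L_invariant L C K)) _ _).1 (coset_repr _)).
have -> : closed B <-> Gal_L_closed (@Gal_L_to_KP K L C @^-1` B).
  rewrite -(propext (Gal_L_closedE emb_elem Klim Csat Chom smallM _)) -!openC.
  by rewrite preimage_setC.
rewrite (propext (Gal_L_closed_canonical emb_elem Klim Csat Chom smallM _)).
by split=> -[Phi PhiP]; exists Phi => s; have := PhiP s; rewrite /preimage /= KPL.
Qed.

Variable theta : Gal_KP K C -> Q.
Hypothesis thetaE : forall x s, restricts x s -> theta (toKP s) = proj x.

(** Closed sets of the Galois group are described by (s(m), m), open subsets of G by (m, g(m)); this
    reconciles the two orders. *)
Definition pswap (p : formula (vsum es es)) : formula (vsum es es) :=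
  subst p (fun y => match y return term (vsum es es) (vsum es es y) with
    | inl v => Var (vsum es es) (inr v) | inr v => Var (vsum es es) (inl v) end).

Lemma sat_pswap (N : structure L) p (a b : env N es) :
  sat (pswap p) (epair a b) <-> sat p (epair b a).
Proof. by rewrite /pswap (propext (sat_subst _ _ _)); split; apply: sat_ext => -[]. Qed.

Lemma theta_is_theta : is_theta theta.
Proof.
move=> s; split=> [|x _ xs]; last exact: thetaE.
by have [x xs] := restricts_exists s; exists x; split=> //; exact: restricts_setwise xs.
Qed.

Lemma theta_mul : {morph theta : x y / x * y}.
Proof.
move=> a b; have [s <-] := toKP_surj a; have [t <-] := toKP_surj b.
have [x xs] := restricts_exists s; have [y yt] := restricts_exists t.
by rewrite toKP_mul (thetaE xs) (thetaE yt) proj_mul; apply: thetaE; exact: restricts_mul.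
Qed.

Lemma theta_inj : injective theta.
Proof.
move=> a b; have [s <-] := toKP_surj a; have [t <-] := toKP_surj b.
have [x xs] := restricts_exists s; have [y yt] := restricts_exists t.
rewrite (thetaE xs) (thetaE yt).
by move/(proj_restricts xs yt).
Qed.

Lemma theta_extends g (s : aut C) : extends_aut s g -> theta (toKP s) = proj (gemb X g).
Proof.
by move=> sg; have [x xs] := restricts_exists s; rewrite (thetaE xs); exact: (proj_extends sg xs).
Qed.

Lemma extends_surj q : exists g s, extends_aut s g /\ theta (toKP s) = q.
Proof.
have [x <-] := proj_surj q; have [g <-] := gemb_dense x.
have [s sg] := extends_exists g.
by exists g, s; split=> //; exact: theta_extends.
Qed.

(** The preimage of A is defined by all formulas true of its members. An s satisfying them satisfies
    those that define the sets [meet_set A U], so its image is a limit of A. *)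
Lemma theta_continuous : continuous theta.
Proof.
apply/continuous_closedP => A /(logic_closedE Klim' Xsat)/(logic_closed_limit Klim' Xsat) cA.
apply/Gal_KP_closed.
exists [set p | forall s, A (theta (toKP s)) -> sat p (epair (emap s base) base)] => s.
split=> [As p|sP]; first exact.
have [x xs] := restricts_exists s; rewrite /preimage /= (thetaE xs); apply: cA => U oU.
have oA := @meet_set_open L M X K' A U oU.
have [p Ap] := saturated_set_definable emb_elem Mcount Mcat Klim Csat oU
  (O := meet_set A U) (fun g h => meet_set_saturated oU).
have [|y [Ay xy]] := (@into_meet_set L M X K' A _ x oU).1; last by exists y.
apply/(into_restricts oA Ap xs)/sat_pswap; apply: sP => t At; apply/sat_pswap.
have [y yt] := restricts_exists t; apply/(into_restricts oA Ap yt)/into_meet_set => //.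
exists y; rewrite -(thetaE yt); split=> //; rewrite mulVg.
by have [opU sU _ _] := oU; have [] := into_subgroup X opU sU.
Qed.

Lemma same_type_sub V (sv : V -> lsort L) (N : structure L) (a b : env N sv) :
  (forall p : formula sv, sat p a -> sat p b) -> forall p : formula sv, sat p a <-> sat p b.
Proof.
move=> ab p; split=> [|pb]; first exact: ab.
by apply: contrapT => np; exact: (ab (fNot p) np pb).
Qed.

(** Represent the class of x by g in G, so that its cosets modulo the U are definable. Saturation
    realises Phi and all these conditions by one tuple of the type of m, that is by t(m) for an
    automorphism t; its class lies in B and is mapped to that of x. *)
Lemma theta_closed_image (B : set (Gal_KP K C)) : closed B ->
  limit_closed (theta @` B).
Proof.
move=> /Gal_KP_closed[Phi PhiP] x xB.
have [g gx] := gemb_dense x.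
have {}xB U : open_finite U -> exists t y,
    [/\ B (toKP t), restricts y t & into U ((gemb X g)^-1 * y)].
  move=> oU; have [y [xy [b Bb by_]]] := xB U oU.
  have [t tb] := toKP_surj b; have [z zt] := restricts_exists t; exists t, z; split=> //.
    by rewrite tb.
  move: by_; rewrite -tb (thetaE zt) => /proj_eq/(_ _ oU) zy.
  have [opU sU _ _] := oU; have [I1 IM IV] := into_subgroup X opU sU.
  move/proj_eq: gx => /(_ _ oU) gx.
  have := IM _ _ (IM _ _ gx xy) (IV _ zy).
  by rewrite invgM invgK -!mulgA !mulVKg.
have /choice[pU pUP] : forall U : set G, exists p : formula (vsum es es), open_finite U ->
    forall h, U (g^-1 * h) <-> sat p (pair_env h).
  move=> U; have [oU|nU] := pselect (open_finite U); last by exists (Bot _).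
  have [opU [_ UM _] _ _] := oU.
  have [|p Up] := saturated_set_definable emb_elem Mcount Mcat Klim Csat oU
    (O := [set h | U (g^-1 * h)]); last by exists p.
  by move=> h k /= gh kU; rewrite mulgA; exact: UM.
have oC U : open_finite U -> open [set h | U (g^-1 * h)].
  move=> oU; apply: (open_saturated oU) => h k /= gh kU; rewrite mulgA.
  by have [_ [_ UM _] _ _] := oU; exact: UM.
have intoP U y t : open_finite U -> restricts y t ->
    into U ((gemb X g)^-1 * y) <-> sat (pU U) (epair base (emap t base)).
  move=> oU yt; rewrite -(propext (into_coset _ _ oU)).
  exact: (into_restricts (oC U oU) (pUP U oU) yt).
pose ctx := vsum es es.
pose J := ({q | Phi q} + ({q : formula es | sat q base} + {U : set G | open_finite U}))%type.
pose phi (j : J) : formula ctx := match j with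
  | inl q => sval q
  | inr (inl q) => subst (sval q) (fun y => Var ctx (inl y))
  | inr (inr U) => pswap (pU (sval U))
  end.
have phi2 q (c : env C ctx) : sat (phi (inr (inl q))) c <-> sat (sval q) (fun v => c (inl v)).
  by rewrite /phi (propext (sat_subst _ _ _)).
have phi3 U (c : env C ctx) : sat (phi (inr (inr U))) c <->
    sat (pU (sval U)) (epair (fun v => c (inr v)) (fun v => c (inl v))).
  by rewrite /phi (propext (sat_subst _ _ _)); split; apply: sat_ext => -[].
have [js|c [cD cphi]] := saturation Csat (small_sum Klim smallM smallM) (sv := ctx)
    (D := fun y => if y is inr _ then True else False) (a := epair base base) (phi := phi).
  pose Us := pmap (fun j : J => if j is inr (inr U) then Some (sval U) else None) js.
  have UsP U : List.In U Us -> open_finite U.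
    rewrite /Us; elim: (js) => //= -[q|[q|V]] l IH //= [<-|/IH //]; exact: (svalP V).
  have jsU V : List.In (inr (inr V)) js -> List.In (sval V) Us.
    rewrite /Us; elim: (js) => //= -[q|[q|V']] l IH [] //=.
    - by case=> ->; left.
    - by move=> /IH; right.
  have [t [y [Bt yt gy]]] := xB _ (open_finite_bigI UsP).
  exists (epair (emap t base) base); split; first by case.
  move=> [q|[q|V]] jjs.
  - exact: ((PhiP t).1 Bt _ (svalP q)).
  - by apply/phi2; have := (sat_aut t (sval q) _).1 (svalP q).
  - apply/phi3/(intoP _ y t (svalP V) yt).
    by apply: into_bigI gy => //; exact: jsU.
have cb z : c (inr z) = base z by rewrite cD.
have [|t tP] := Chom (a := base) (b := fun v => c (inl v)) smallM.
  by apply: same_type_sub => q qb; exact: ((phi2 (exist _ q qb) c).1 (cphi (inr (inl (exist _ q qb))))).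
have [y yt] := restricts_exists t.
exists (toKP t).
  apply/PhiP => q qP; have := cphi (inl (exist _ q qP)).
  by rewrite tP; apply: sat_ext => -[v|v] //=; rewrite cb.
rewrite (thetaE yt) -gx; apply/esym/proj_eq => U oU; apply/(intoP U y t oU yt).
have /phi3 := cphi (inr (inr (exist _ U oU))).
by rewrite tP; apply: sat_ext => -[v|v] //=; rewrite cb.
Qed.

Lemma theta_topgroup_iso : topgroup_iso theta.
Proof.
split; [exact: theta_mul|exact: theta_continuous|].
have /choice[inv invP] : forall q, exists b, theta b = q.
  by move=> q; have [g [s [_ sq]]] := extends_surj q; exists (toKP s).
exists inv; split=> [b|//|]; first exact/theta_inj.
apply/continuous_closedP => B cB; apply/(logic_closedE Klim' Xsat)/limit_closed_logic => //.
have -> : inv @^-1` B = theta @` B.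
  apply/seteqP; split=> [q qB|_ [b Bb <-]]; first by exists (inv q).
  by rewrite /preimage /= (theta_inj (invP (theta b))).
exact: theta_closed_image.
Qed.

(** The canonical map from G to the quotient by [core00], moved along the inverse of theta. Cosets
    of the U are open in the quotient, which is what [profinite_bohr] asks for. *)
Lemma r1_bohr : exists r1 : G -> Gal_KP K C,
  [/\ is_r1 r1, range r1 = [set: Gal_KP K C] & bohr_compactification r1].
Proof.
have Mdc : finite_double_cosets M := double_cosets emb_elem Mcount Mcat Klim Csat.
have iso := theta_topgroup_iso.
have [theta_mul theta_cont [inv [thetaK invK inv_cont]]] := iso.
exists (fun g => inv (proj (gemb X g))).
have rE g (s : aut C) : extends_aut s g -> inv (proj (gemb X g)) = toKP s.
  by move=> sg; rewrite -(theta_extends sg) thetaK.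
have rT : range (fun g => inv (proj (gemb X g))) = [set: Gal_KP K C].
  apply/seteqP; split=> // q _.
  have [x xq] := proj_surj (theta q); have [g gx] := gemb_dense x.
  by exists g => //; rewrite gx xq thetaK.
split=> //.
- move=> g; have [s sg] := extends_exists g; split; first by exists s.
  by move=> s' /rE.
- apply: profinite_bohr => //.
  + split.
      apply: (topgroup_iso_compact_group iso); split.
      * exact: quotient_topological_group.
      * exact: quotient_compact.
      * exact: quotient_hausdorff.
    split.
    * move=> g h; rewrite gembM -proj_mul -[in LHS](invK (proj (gemb X g))).
      by rewrite -[in LHS](invK (proj (gemb X h))) -theta_mul thetaK.
    * move=> g; apply: continuous_comp; last exact: inv_cont.
      move=> O; rewrite nbhsE => -[O' [oO' O'g] O'O].
      have [U [oU UO]] := (open_quotientP Klim' Xsat O').1 oO' _ O'g.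
      have [opU [U1 UM UV] UN _] := oU.
      apply: filterS (open_nbhs_nbhs (conj (open_saturated (O := [set h | U (g^-1 * h)]) oU _) _)).
      + by move=> h /= gh; apply/O'O/UO; rewrite -gembV -gembM; apply/into_gemb.
      + by move=> h k /= gh kU; rewrite mulgA; exact: UM.
      + by rewrite /= mulVg.
    * by rewrite rT => O [x Ox] _; exists x.
  + move=> U g oU; have [opU sU _ _] := oU; have [I1 IM IV] := into_subgroup X opU sU.
    have : nbhs (inv (proj (gemb X g)))
        (theta @^-1` [set q : Q | exists y, q = proj y /\ into U ((gemb X g)^-1 * y)]).
      apply: theta_cont; rewrite invK; apply: open_nbhs_nbhs; split.
        exact: level_open.
      by exists (gemb X g); rewrite mulVg.
    apply: filterS => q [y [qy gy]] h hq; apply/(into_gemb X _ opU).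
    move: qy; rewrite -hq invK => /proj_eq/(_ _ oU) hy.
    have := IM _ _ gy (IV _ hy).
    by rewrite invgM invgK gembM gembV -!mulgA !mulVKg.
Qed.

End Theta.

Theorem corollary5p16 (L : signature) (M : structure L)
    (M_countable : countable_structure M)
    (M_categorical : omega_categorical M)
    (M_eq : is_own_eq M)
    (K K' : Type)
    (Ms : elext (with_group M)) (Mss : elext Ms)
    (Ms_monster : monster Ms K)
    (Ms_reduct_monster : monster (reduct Ms) K)
    (Mss_monster : monster Mss K')
    (Mss_reduct_monster : monster (reduct Mss) K')
    (Ms_small : small K' {s & Ms s}) :
  [/\ Autf_KP K = Autf_Sh K :> set (aut (reduct Ms)),
      forall C : set (Gal_L K (reduct Ms)), closed C <-> Gal_L_closed C,
      exists N : nsubgroup (gsort (elext_trans Mss)),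
        [/\ is_G00_top K' N,
            forall C : set (logic_quotient K' N),
              closed C <-> logic_quotient_closed C &
            exists theta : Gal_KP K (reduct Ms) -> logic_quotient K' N,
              is_theta theta /\ topgroup_iso theta] &
      exists r1 : aut M -> Gal_KP K (reduct Ms),
        [/\ is_r1 r1, range r1 = [set: Gal_KP K (reduct Ms)] &
            bohr_compactification r1]].
Proof.
have [Klim _ Csat Chom] := Ms_reduct_monster.
have [Klim' [_ _ smallR] Xsat _] := Mss_monster.
have emb_elem := @pemb_elem L M Ms.
have smallM : small K (elt M) by apply: small_countable => //; exact: countable_elt.
have Mdc : finite_double_cosets M := double_cosets emb_elem M_countable M_categorical Klim Csat.
have [theta thetaE] := theta_exists M_countable M_categorical Klim Csat Chom Klim' Xsat Ms_small.
split.
- exact: (Autf_KP_Sh emb_elem M_countable M_categorical Klim Csat Chom).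
- exact: (Gal_L_closedE emb_elem Klim Csat Chom smallM).
- exists (N00 (elext_trans Mss)); split.
  + exact: N00_is_G00.
  + by move=> D; exact: logic_closedE.
  + exists theta; split; first exact: theta_is_theta.
    exact: theta_topgroup_iso.
- exact: (r1_bohr M_countable M_categorical Klim Csat Chom Klim' Xsat Ms_small thetaE).
Qed.
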